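(* A weak nearly $\mathcal C$-manifold $(M^{2n+s},f,Q,\xi_i,\eta^i,g)$ satisfies $$\nabla\xi_i=0\qquad(1\le i\le s)$$ if and only if the manifold is locally isometric to the Riemannian product of a Euclidean $s$-space and a weak nearly Kähler manifold.
   Context: All objects are smooth; $\mathfrak X_M$ is the set of vector fields on $M$ and $\nabla$ is the Levi-Civita connection of $g$. A weak metric $f$-structure on a manifold $M^{2n+s}$ ($n,s>0$) is a set $(f,Q,\xi_i,\eta^i,g)$ ($1\le i\le s$), where $g$ is a Riemannian metric, $f$ is a $(1,1)$-tensor of rank $2n$, skew-symmetric with respect to $g$, $Q$ is a self-adjoint nonsingular $(1,1)$-tensor, $\xi_i$ are orthonormal vector fields, and $\eta^i$ are dual 1-forms, satisfying $$f^2=-Q+\sum_{i=1}^s\eta^i\otimes\xi_i,\quad \eta^i(\xi_j)=\delta^i_j,\quad Q\xi_i=\xi_i,\quad g(fX,fY)=g(X,QY)-\sum_{i=1}^s\eta^i(X)\eta^i(Y).$$ The manifold with such a structure is called a weak nearly $\mathcal C$-manifold if $(\nabla_Xf)Y+(\nabla_Yf)X=0$ for all $X,Y\in\mathfrak X_M$. A weak Hermitian manifold $(\bar M,\bar f,\bar g)$ is a Riemannian manifold $(\bar M,\bar g)$ of even dimension equipped with a skew-symmetric $(1,1)$-tensor $\bar f$ such that $\bar f^{\,2}$ is negative-definite; it is called weak nearly Kähler if $(\overline\nabla_X\bar f)Y+(\overline\nabla_Y\bar f)X=0$ for all vector fields $X,Y$, where $\overline\nabla$ is the Levi-Civita connection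 of $\bar g$.
   Formalization: The local isometry is also required to carry each ξ_i to a Euclidean coordinate field and f to the weak nearly Kähler tensor extended by 0; with metrics alone the ''if'' part fails (flat R³∖0, fX = p×X, ξ = p/|p|). *)

(* Defs.v *)
(* MathComp / MathComp-Analysis, over an arbitrary [R : realType]. *)
From HB Require Import structures.
From mathcomp Require Import all_boot all_order all_algebra.
From mathcomp Require Import all_classical all_reals all_analysis.
From mathcomp Require Import lra.
Set Implicit Arguments.
Unset Strict Implicit.
Unset Printing Implicit Defensive.
Import Order.TTheory GRing.Theory Num.Theory.
Import numFieldNormedType.Exports.
Local Open Scope classical_set_scope.
Local Open Scope ring_scope.

(* Smoothness on an open set [U] of R^m; values of [f] outside [U] are
   irrelevant.  The differential of the library is only meaningful at points
   of differentiability, whence the explicit conjunct. *)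
Fixpoint Ck (R : realType) (m : nat) (W : normedModType R) (k : nat)
    (U : set 'rV[R]_m) (f : 'rV[R]_m -> W) : Prop :=
  match k with
  | 0%N => forall x, U x -> {for x, continuous f}
  | k'.+1 => (forall x, U x -> differentiable f x) /\
             forall l : 'I_m, Ck k' U (fun x => 'D_(delta_mx 0 l) f x)
  end.

Definition smooth_on (R : realType) (m : nat) (W : normedModType R)
    (U : set 'rV[R]_m) (f : 'rV[R]_m -> W) : Prop := forall k, Ck k U f.

(* An atlas: [coord i] is only meaningful on [dom i], and [param i], its
   inverse, only on [coord i @` dom i]. *)
Record charted (R : realType) (m : nat) := Charted {
  space :> topologicalType;
  index : Type;
  dom : index -> set space;
  coord : index -> space -> 'rV[R]_m;
  param : index -> 'rV[R]_m -> space }.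

Section Manifold.
Context {R : realType} {m : nat}.

Definition chart_image (M : charted R m) (i : index M) : set 'rV[R]_m :=
  coord i @` dom i.

Definition overlap (M : charted R m) (i j : index M) : set 'rV[R]_m :=
  coord i @` (dom i `&` dom j).

Definition transition (M : charted R m) (i j : index M) :
  'rV[R]_m -> 'rV[R]_m := coord j \o param i.

Record is_manifold (M : charted R m) : Prop := IsManifold {
  manifold_hausdorff : hausdorff_space M;
  manifold_second_countable : @second_countable M;
  manifold_cover : forall p : M, exists i, dom i p;
  manifold_dom_open : forall i : index M, open (dom i);
  manifold_image_open : forall i : index M, open (chart_image i);
  manifold_coordK : forall (i : index M) p, dom i p -> param i (coord i p) = p;
  manifold_coord_continuous : forall (i : index M) p, dom i p ->
    {for p, continuous (coord i)};
  manifold_param_continuous : forall (i : index M) x, chart_image i x ->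
    {for x, continuous (param i)};
  manifold_transition_smooth : forall i j : index M,
    smooth_on (overlap i j) (transition i j) }.

(* A tensor field is the family of its components in the charts of the atlas,
   subject to the transformation law.  Tangent vectors are row vectors of
   components: an endomorphism field F acts by [v *m F i x], a 1-form w by
   [v *m w i x] (a 1 x 1 matrix), and a bilinear form is [inner (g i x)]. *)
Definition field (M : charted R m) (W : Type) := index M -> 'rV[R]_m -> W.

Definition inner (G : 'M[R]_m) (u v : 'rV[R]_m) : R := (u *m G *m v^T) 0 0.

Definition is_vector_field (M : charted R m) (X : field M 'rV[R]_m) : Prop :=
  (forall i, smooth_on (chart_image i) (X i)) /\
  (forall i j x, overlap i j x ->
     X j (transition i j x) = 'd (transition i j) x (X i x)).

Definition is_one_form (M : charted R m) (w : field M 'cV[R]_m) : Prop :=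
  (forall i, smooth_on (chart_image i) (w i)) /\
  (forall i j x v, overlap i j x ->
     'd (transition i j) x v *m w j (transition i j x) = v *m w i x).

Definition is_endo_field (M : charted R m) (F : field M 'M[R]_m) : Prop :=
  (forall i, smooth_on (chart_image i) (F i)) /\
  (forall i j x v, overlap i j x ->
     'd (transition i j) x v *m F j (transition i j x) =
     'd (transition i j) x (v *m F i x)).

Record is_riemannian_metric (M : charted R m) (g : field M 'M[R]_m) : Prop :=
  IsRiemannianMetric {
  metric_smooth : forall i, smooth_on (chart_image i) (g i);
  metric_compatible : forall i j x u v, overlap i j x ->
    inner (g j (transition i j x))
      ('d (transition i j) x u) ('d (transition i j) x v) = inner (g i x) u v;
  metric_sym : forall i x, chart_image i x -> (g i x)^T = g i x;
  metric_pos : forall i x v, chart_image i x -> v != 0 ->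
    0 < inner (g i x) v v }.

(* Christoffel symbols, contracted with u and v: [christoffel G x u v] is the
   vector c such that, for every constant w,
   2 G_x(c, w) = D_u (G(v, w)) + D_v (G(u, w)) - D_w (G(u, v)). *)
Definition christoffel (G : 'rV[R]_m -> 'M[R]_m) (x u v : 'rV[R]_m) :
    'rV[R]_m :=
  (\row_l (2^-1 * ('D_u (fun y => inner (G y) v (delta_mx 0 l)) x
                 + 'D_v (fun y => inner (G y) u (delta_mx 0 l)) x
                 - 'D_(delta_mx 0 l) (fun y => inner (G y) u v) x)))
  *m invmx (G x).

(* The Levi-Civita connection; see [nabla_torsion_free] and [nabla_metric]. *)
Definition nabla (M : charted R m) (g : field M 'M[R]_m)
    (X Y : field M 'rV[R]_m) : field M 'rV[R]_m :=
  fun i x => 'D_(X i x) (Y i) x + christoffel (g i) x (X i x) (Y i x).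

Definition endo_app (M : charted R m) (F : field M 'M[R]_m)
    (X : field M 'rV[R]_m) : field M 'rV[R]_m := fun i x => X i x *m F i x.

Definition nabla_endo (M : charted R m) (g F : field M 'M[R]_m)
    (X Y : field M 'rV[R]_m) : field M 'rV[R]_m :=
  fun i x => nabla g X (endo_app F Y) i x - endo_app F (nabla g X Y) i x.

Definition skew_endo (M : charted R m) (g F : field M 'M[R]_m) : Prop :=
  forall i x u v, chart_image i x ->
    inner (g i x) (u *m F i x) v = - inner (g i x) u (v *m F i x).

Definition selfadjoint_endo (M : charted R m) (g F : field M 'M[R]_m) : Prop :=
  forall i x u v, chart_image i x ->
    inner (g i x) (u *m F i x) v = inner (g i x) u (v *m F i x).

Definition nearly_parallel_endo (M : charted R m) (g F : field M 'M[R]_m) :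
    Prop :=
  forall X Y, is_vector_field X -> is_vector_field Y ->
    forall i x, chart_image i x ->
      nabla_endo g F X Y i x + nabla_endo g F Y X i x = 0.

Definition parallel_field (M : charted R m) (g : field M 'M[R]_m)
    (Z : field M 'rV[R]_m) : Prop :=
  forall X, is_vector_field X ->
    forall i x, chart_image i x -> nabla g X Z i x = 0.

Record weak_hermitian (M : charted R m) (F g : field M 'M[R]_m) : Prop :=
  WeakHermitian {
  wh_even : ~~ odd m;
  wh_manifold : is_manifold M;
  wh_metric : is_riemannian_metric g;
  wh_endo : is_endo_field F;
  wh_skew : skew_endo g F;
  wh_negative : forall i x v, chart_image i x -> v != 0 ->
    inner (g i x) (v *m F i x *m F i x) v < 0 }.

Definition weak_nearly_kahler (M : charted R m) (F g : field M 'M[R]_m) :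
    Prop :=
  weak_hermitian F g /\ nearly_parallel_endo g F.

End Manifold.

Section LeviCivita.
Context {R : realType} {m : nat}.
Implicit Types (G : 'rV[R]_m -> 'M[R]_m) (Y Z : 'rV[R]_m -> 'rV[R]_m).

Lemma innerE (A : 'M[R]_m) (u v : 'rV[R]_m) :
  inner A u v = \sum_(k < m) \sum_(l < m) u 0 l * A l k * v 0 k.
Proof.
rewrite /inner mxE; apply: eq_bigr => k _; rewrite !mxE mulr_suml.
by apply: eq_bigr.
Qed.

Lemma inner_sym (A : 'M[R]_m) (u v : 'rV[R]_m) :
  A^T = A -> inner A u v = inner A v u.
Proof.
move=> AT; rewrite /inner.
have -> : v *m A *m u^T = (u *m A *m v^T)^T.
  by rewrite !trmx_mul trmxK AT mulmxA.
by rewrite [RHS]mxE.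
Qed.

Lemma is_derive_inner G Y Z (x w : 'rV[R]_m) :
  derivable G x w -> derivable Y x w -> derivable Z x w ->
  is_derive x w (fun y => inner (G y) (Y y) (Z y))
    (inner ('D_w G x) (Y x) (Z x) + inner (G x) ('D_w Y x) (Z x)
     + inner (G x) (Y x) ('D_w Z x)).
Proof.
move=> dG dY dZ; rewrite (derive_mx dG) (derive_mx dY) (derive_mx dZ).
have [/derivable_mxP cG /derivable_mxP cY] := (dG, dY).
move/derivable_mxP: dZ => cZ.
have -> : (fun y => inner (G y) (Y y) (Z y)) =
    \sum_(k < m) \sum_(l < m) (fun y => Y y 0 l * G y l k * Z y 0 k).
  by apply/funext => y; rewrite innerE fct_sumE; apply: eq_bigr => k _;
     rewrite fct_sumE.
rewrite !innerE -!big_split /=; apply: is_derive_sum => k.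
rewrite -!big_split /=; apply: is_derive_sum => l; rewrite !mxE.
have dYl : is_derive x w (fun y => Y y 0 l) ('D_w (fun y => Y y 0 l) x).
  by split.
have dGl : is_derive x w (fun y => G y l k) ('D_w (fun y => G y l k) x).
  by split.
have dZl : is_derive x w (fun y => Z y 0 k) ('D_w (fun y => Z y 0 k) x).
  by split.
have H := is_deriveM (is_deriveM dYl dGl) dZl.
apply: (is_derive_eq H); rewrite /GRing.scale /=.
rewrite -[X in X * _ + _]/(Y x 0 l * G x l k).
move: ('D_w _ x) ('D_w _ x) ('D_w _ x) => a b c.
by rewrite addrC [Z x 0 k * _]mulrC mulrDl [G x l k * _]mulrC.
Qed.

Lemma derive_innerl G (x w u v : 'rV[R]_m) : derivable G x w ->
  'D_w (fun y => inner (G y) u v) x = inner ('D_w G x) u v.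
Proof.
move=> dG; have [_ ->] := is_derive_inner dG (derivable_cst u x w)
  (derivable_cst v x w).
rewrite !derive_cst /inner.
by rewrite !mul0mx trmx0 mulmx0 [in X in _ + X = _]mxE
  [in X in _ + X + _ = _]mxE !addr0.
Qed.

Lemma inner_deltar (A : 'M[R]_m) (u v : 'rV[R]_m) :
  inner A u v = \sum_(l < m) inner A u (delta_mx 0 l) * v 0 l.
Proof.
rewrite [LHS]mxE; apply: eq_bigr => l _; rewrite [v^T _ _]mxE; congr (_ * _).
by rewrite /inner trmx_delta -colE [RHS]mxE.
Qed.

Lemma inner_christoffel G (x u v w : 'rV[R]_m) :
  G x \in unitmx -> differentiable G x ->
  inner (G x) (christoffel G x u v) w =
  2^-1 * (inner ('D_u G x) v w + inner ('D_v G x) u w - inner ('D_w G x) u v).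
Proof.
move=> Gu dG; have dd z : derivable G x z by apply: diff_derivable.
rewrite {1}/inner /christoffel mulmxKV // mxE.
have Dw : inner ('D_w G x) u v =
    \sum_(l < m) inner ('D_(delta_mx 0 l) G x) u v * w 0 l.
  rewrite [in LHS](row_sum_delta w) deriveE // linear_sum /=.
  rewrite /inner mulmx_sumr mulmx_suml summxE; apply: eq_bigr => l _.
  by rewrite linearZ /= -deriveE // -scalemxAr -scalemxAl mxE mulrC.
rewrite Dw; transitivity (\sum_(l < m) 2^-1 * (inner ('D_u G x) v (delta_mx 0 l)
    + inner ('D_v G x) u (delta_mx 0 l)
    - inner ('D_(delta_mx 0 l) G x) u v) * w 0 l).
  apply: eq_bigr => l _; rewrite !mxE; congr (_ * (_ + _ - _) * _);
  exact: derive_innerl.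
generalize ('D_u G x) ('D_v G x) => A B.
rewrite (inner_deltar A) (inner_deltar B) -big_split -sumrB mulr_sumr.
by apply: eq_bigr => l _ /=; rewrite -mulrA mulrBl mulrDl.
Qed.

Lemma posdef_unitmx (A : 'M[R]_m) :
  (forall v, v != 0 -> 0 < inner A v v) -> A \in unitmx.
Proof.
move=> Apos; rewrite -row_free_unit -kermx_eq0; apply/eqP/row_matrixP => i.
rewrite row0; apply/eqP/negPn/negP => /Apos.
by rewrite /inner -row_mul mulmx_ker row0 mul0mx mxE ltxx.
Qed.

Lemma smooth_on_differentiable (W : normedModType R) (U : set 'rV[R]_m)
  (h : 'rV[R]_m -> W) x : smooth_on U h -> U x -> differentiable h x.
Proof. by move=> sh Ux; have [dh _] := sh 1; exact: dh. Qed.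

Lemma nabla_torsion_free (M : charted R m) (g : field M 'M[R]_m)
    (X Y : field M 'rV[R]_m) i x :
  is_manifold M -> is_riemannian_metric g -> chart_image i x ->
  nabla g X Y i x - nabla g Y X i x = 'D_(X i x) (Y i) x - 'D_(Y i x) (X i) x.
Proof.
move=> hM hg ix; rewrite /nabla; suff -> : christoffel (g i) x (X i x) (Y i x) =
  christoffel (g i) x (Y i x) (X i x) by rewrite opprD addrACA subrr addr0.
rewrite /christoffel; congr (_ *m _); apply/rowP => l; rewrite [LHS]mxE [RHS]mxE.
rewrite [X in _ * (X - _)]addrC; congr (_ * (_ - _)).
apply: near_eq_derive.
have := @manifold_image_open _ _ _ hM i; rewrite openE => /(_ _ ix).
by apply: filterS => y iy; apply: inner_sym; exact: (metric_sym hg iy).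
Qed.

Lemma nabla_metric (M : charted R m) (g : field M 'M[R]_m)
    (X Y Z : field M 'rV[R]_m) i x :
  is_riemannian_metric g -> is_vector_field Y -> is_vector_field Z ->
  is_manifold M -> chart_image i x ->
  'D_(X i x) (fun y => inner (g i y) (Y i y) (Z i y)) x =
  inner (g i x) (nabla g X Y i x) (Z i x)
  + inner (g i x) (Y i x) (nabla g X Z i x).
Proof.
move=> hg [sY _] [sZ _] hM ix.
have dY := smooth_on_differentiable (sY i) ix.
have dZ := smooth_on_differentiable (sZ i) ix.
have dg := smooth_on_differentiable (metric_smooth hg i) ix.
have gs := metric_sym hg ix.
have gu : g i x \in unitmx by apply: posdef_unitmx => v; exact: metric_pos.
have innerDl u v w :
    inner (g i x) (u + v) w = inner (g i x) u w + inner (g i x) v w.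
  by rewrite /inner !mulmxDl mxE.
have [_ ->] := is_derive_inner (diff_derivable (v := X i x) dg)
  (diff_derivable (v := X i x) dY) (diff_derivable (v := X i x) dZ).
have Dsym : inner ('D_(X i x) (g i) x) (Z i x) (Y i x) =
            inner ('D_(X i x) (g i) x) (Y i x) (Z i x).
  rewrite -!derive_innerl; do ?exact: diff_derivable.
  apply: near_eq_derive.
  have := @manifold_image_open _ _ _ hM i; rewrite openE => /(_ _ ix).
  by apply: filterS => y iy; apply: inner_sym; exact: (metric_sym hg iy).
rewrite (inner_sym (Y i x) (nabla g X Z i x) gs) /nabla !innerDl.
have := inner_christoffel (X i x) (Y i x) (Z i x) gu dg.
have := inner_christoffel (X i x) (Z i x) (Y i x) gu dg.
rewrite (inner_sym (Y i x) ('D_(X i x) (Z i) x) gs).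
move: Dsym.
generalize ('D_(X i x) (g i) x) ('D_(Y i x) (g i) x) ('D_(Z i x) (g i) x).
generalize ('D_(X i x) (Y i) x) ('D_(X i x) (Z i) x).
generalize (christoffel (g i) x (X i x) (Y i x)).
generalize (christoffel (g i) x (X i x) (Z i x)).
move=> c c' a b A B C -> -> ->; lra.
Qed.

End LeviCivita.

Record weak_metric_f_structure (R : realType) (n s : nat)
    (M : charted R (2 * n + s))
    (f Q : field M 'M[R]_(2 * n + s))
    (xi : 'I_s -> field M 'rV[R]_(2 * n + s))
    (eta : 'I_s -> field M 'cV[R]_(2 * n + s))
    (g : field M 'M[R]_(2 * n + s)) : Prop := WeakMetricFStructure {
  wf_metric : is_riemannian_metric g;
  wf_f_endo : is_endo_field f;
  wf_f_rank : forall i x, chart_image i x -> \rank (f i x) = (2 * n)%N;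
  wf_f_skew : skew_endo g f;
  wf_Q_endo : is_endo_field Q;
  wf_Q_selfadjoint : selfadjoint_endo g Q;
  wf_Q_nonsingular : forall i x, chart_image i x -> Q i x \in unitmx;
  wf_xi_field : forall a, is_vector_field (xi a);
  wf_xi_orthonormal : forall a b i x, chart_image i x ->
    inner (g i x) (xi a i x) (xi b i x) = (a == b)%:R;
  wf_eta_form : forall a, is_one_form (eta a);
  wf_f_square : forall i x, chart_image i x ->
    f i x *m f i x = - Q i x + \sum_(a < s) eta a i x *m xi a i x;
  wf_eta_xi : forall a b i x, chart_image i x ->
    (xi b i x *m eta a i x) 0 0 = (a == b)%:R;
  wf_Q_xi : forall a i x, chart_image i x -> xi a i x *m Q i x = xi a i x;
  wf_compatible : forall i x u v, chart_image i x ->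
    inner (g i x) (u *m f i x) (v *m f i x) =
    inner (g i x) u (v *m Q i x)
    - \sum_(a < s) (u *m eta a i x) 0 0 * (v *m eta a i x) 0 0 }.

Definition weak_nearly_C_manifold (R : realType) (n s : nat)
    (M : charted R (2 * n + s))
    (f Q : field M 'M[R]_(2 * n + s))
    (xi : 'I_s -> field M 'rV[R]_(2 * n + s))
    (eta : 'I_s -> field M 'cV[R]_(2 * n + s))
    (g : field M 'M[R]_(2 * n + s)) : Prop :=
  [/\ is_manifold M, weak_metric_f_structure f Q xi eta g
    & nearly_parallel_endo g f].

Section Maps.
Context {R : realType} {m m' : nat} (M : charted R m) (N : charted R m').

Definition local_rep (h : M -> N) (i : index M) (j : index N) :
  'rV[R]_m -> 'rV[R]_m' := coord j \o h \o param i.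

Definition smooth_map (U : set M) (h : M -> N) : Prop :=
  (forall p, U p -> {for p, continuous h}) /\
  (forall i j, smooth_on (coord i @` (U `&` dom i `&` h @^-1` dom j))
                         (local_rep h i j)).

Definition isometric_map (gM : field M 'M[R]_m) (gN : field N 'M[R]_m')
    (U : set M) (h : M -> N) : Prop :=
  forall p i j u v, U p -> dom i p -> dom j (h p) ->
    inner (gN j (coord j (h p)))
      ('d (local_rep h i j) (coord i p) u) ('d (local_rep h i j) (coord i p) v)
    = inner (gM i (coord i p)) u v.

Definition carries_vector_field (X : field M 'rV[R]_m) (Y : field N 'rV[R]_m')
    (U : set M) (h : M -> N) : Prop :=
  forall p i j, U p -> dom i p -> dom j (h p) ->
    'd (local_rep h i j) (coord i p) (X i (coord i p)) = Y j (coord j (h p)).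

Definition carries_endo (F : field M 'M[R]_m) (F' : field N 'M[R]_m')
    (U : set M) (h : M -> N) : Prop :=
  forall p i j u, U p -> dom i p -> dom j (h p) ->
    'd (local_rep h i j) (coord i p) (u *m F i (coord i p)) =
    'd (local_rep h i j) (coord i p) u *m F' j (coord j (h p)).

Definition prod_charted : charted R (m + m') :=
  @Charted R (m + m') (M * N)%type (index M * index N)%type
    (fun ij => dom ij.1 `*` dom ij.2)
    (fun ij p => row_mx (coord ij.1 p.1) (coord ij.2 p.2))
    (fun ij z => (param ij.1 (lsubmx z), param ij.2 (rsubmx z))).

(* The (1,1)-tensor acting as F on the first factor and F' on the second, or
   the bilinear form restricting to F and F' and making the factors
   orthogonal. *)
Definition prod_field (F : field M 'M[R]_m) (F' : field N 'M[R]_m') :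
    field prod_charted 'M[R]_(m + m') :=
  fun ij z => block_mx (F ij.1 (lsubmx z)) 0 0 (F' ij.2 (rsubmx z)).

(* A vector field on the first factor, tangent to the product. *)
Definition lift_field (X : field M 'rV[R]_m) :
    field prod_charted 'rV[R]_(m + m') :=
  fun ij z => row_mx (X ij.1 (lsubmx z)) 0.

End Maps.

Definition diffeo (R : realType) (m m' : nat) (M : charted R m)
    (N : charted R m') (U : set M) (V : set N) (h : M -> N) : Prop :=
  [/\ open U, open V, smooth_map U h & exists k : N -> M,
   [/\ smooth_map V k, (forall p, U p -> V (h p) /\ k (h p) = p)
     & (forall q, V q -> U (k q) /\ h (k q) = q)]].

Definition euclidean (R : realType) (s : nat) : charted R s :=
  @Charted R s 'rV[R]_s unit (fun=> setT) (fun=> id) (fun=> id).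

Definition euclidean_metric (R : realType) (s : nat) :
  field (euclidean R s) 'M[R]_s := fun _ _ => 1%:M.

Definition coordinate_field (R : realType) (s : nat) (a : 'I_s) :
  field (euclidean R s) 'rV[R]_s := fun _ _ => delta_mx 0 a.

(* The local isometry identifies the structures and not only the metrics: the
   Euclidean coordinate fields correspond to the xi's, and the (1,1)-tensor of
   the weak nearly Kahler factor (extended by 0) to f.  With the metrics alone
   the characterisation of nabla xi = 0 fails: on R^3 minus the origin, with
   the flat metric, f X = p x X and xi = p / |p| at the point p, together with
   Q = |p|^2 on the orthogonal complement of xi, define a weak nearly
   C-structure (n = s = 1) whose xi is not parallel. *)
Definition locally_euclidean_times_weak_nearly_kahler (R : realType)
    (n s : nat) (M : charted R (2 * n + s))
    (f : field M 'M[R]_(2 * n + s))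
    (xi : 'I_s -> field M 'rV[R]_(2 * n + s))
    (g : field M 'M[R]_(2 * n + s)) : Prop :=
  forall p : M,
  exists (N : charted R (2 * n)) (fN gN : field N 'M[R]_(2 * n)),
    weak_nearly_kahler fN gN /\
    exists (U : set M) (V : set (prod_charted (euclidean R s) N))
           (h : M -> prod_charted (euclidean R s) N),
      [/\ U p, diffeo U V h,
          isometric_map g (prod_field (@euclidean_metric R s) gN) U h,
          (forall a, carries_vector_field
             (xi a) (lift_field (@coordinate_field R s a)) U h)
        & carries_endo f (prod_field (fun _ _ => 0) fN) U h].

(* Main.v *)
From HB Require Import structures.
From Pilot Require Import Defs.
From mathcomp Require Import all_boot all_order all_algebra.
From mathcomp Require Import all_classical all_reals all_analysis.
From mathcomp Require Import zify ring lra.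
Import Pilot.Defs.
Set Implicit Arguments.
Unset Strict Implicit.
Unset Printing Implicit Defensive.
Import Order.TTheory GRing.Theory Num.Theory.
Import numFieldNormedType.Exports.
Local Open Scope classical_set_scope.
Local Open Scope ring_scope.

(* If the [xi]'s are parallel, they commute, their metric duals are closed, and
   each of them is a Killing field.  Primitives of the dual forms give functions
   [t] with [xi_a t_b = delta_ab]; flowing the slice [t = const] along the [xi]'s
   yields a chart [(t, y)] in which the metric is [dt^2 + gN].  The nearly
   parallel condition makes [f] invariant under the flow and tangent to the
   slices, so that [gN] and the restriction [fN] of [f] do not depend on [t];
   the slices are totally geodesic, whence [fN] is again nearly parallel.
   Conversely, the preimage [xi] of a coordinate field is a Killing field with
   closed dual form: the symmetric and the antisymmetric parts of [nabla xi]
   vanish.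

   The flow is obtained as the limit of the Euler polygons with [2 ^ j] steps;
   its smoothness comes from applying the same convergence result to the
   variational system of the field. *)

(** * Calculus of smooth maps *)

(** Why the condition on [f] yields invariance: [f xi = 0] and [nabla xi = 0] give
    [(nabla_v f) xi = 0], hence [(nabla_xi f) v = 0], which for a parallel [xi] is the vanishing of
    the Lie derivative of [f] along [xi].

    The invariance is proved for bilinear forms. Pulling back a bilinear form involves the Jacobian
    but not its inverse, so one argument serves both [g] and the form [g (f u, v)]; [fN] is then
    recovered by inverting [gN].

    The hypotheses quantify over global vector fields, whereas the argument is pointwise in one
    chart. Tangent vectors are therefore extended by bump functions, and this is where the Hausdorff
    axiom of [M] is used.

    Primitives come from the flow box too: the horizontal lifts of the coordinate fields to the
    product of source and target commute exactly when the form is closed, and their leaves are the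
    graphs of primitives.

    The norm of row vectors is the maximum norm: mean value estimates hold entry by entry without
    loss, and a ball of a product is a product of balls, so the slices and the segments in [t] stay
    inside the chart. *)

Section Calculus.
Context {R : realType}.

(** The bound [C * |h|^2] is below [e * |h|] once [|h| <= e / (|C| + 1)]; the summand 1 avoids a
    division by zero. Limits of polygons, local inverses and the flat exponential at 0 all get their
    derivative from such a bound. *)
Lemma is_diff_quadratic (V W : normedModType R) (f : V -> W)
    (df : {linear V -> W}) (x : V) (C : R) :
  continuous df ->
  (\forall h \near 0, `|f (x + h) - f x - df h| <= C * `|h| ^+ 2) ->
  is_diff x f df.
Proof.
move=> dfc Hf.
have E : f \o shift x = cst (f x) + df +o_ 0 id.
  apply/eqaddoP => _/posnumP[e].
  pose d := e%:num / (`|C| + 1).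
  have d0 : 0 < d by rewrite divr_gt0// ltr_pwDr.
  move: Hf; apply: filter_app; near=> h => Hf.
  have -> : (f \o shift x - (cst (f x) + df)) h = f (x + h) - f x - df h.
    by rewrite !fctE /= opprD addrA addrC [h + x]addrC addrC.
  apply: (le_trans Hf).
  rewrite expr2 mulrA ler_wpM2r//.
  apply: (@le_trans _ _ ((`|C| + 1) * `|h|)).
    by rewrite ler_wpM2r// (le_trans (ler_norm _))// lerDl.
  rewrite mulrC -ler_pdivlMr ?ltr_pwDr//.
apply: DiffDef; last exact: diff_unique.
by apply/diff_locallyP; rewrite (diff_unique dfc E).
Unshelve. all: by end_near. Qed.

Lemma near_eq_is_diff (V W : normedModType R) (f g df : V -> W) (x : V) :
  {near x, f =1 g} -> is_diff x f df -> is_diff x g df.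
Proof.
move=> fg [dfx dfE].
have fc := diff_continuous dfx.
have E : g \o shift x = cst (g x) + 'd f x +o_ 0 id.
  apply/eqaddoP => e e0.
  have /eqaddoP/(_ e e0) := diff_locally dfx.
  have := fg; rewrite near_simpl (near_shift 0 x) => fg0.
  apply: filter_app; near=> y.
  rewrite !fctE /= -(nbhs_singleton fg).
  suff -> : f (y + x) = g (y + x) by [].
  by near: y; apply: filterS fg0 => y /=; rewrite subr0.
have := diff_unique fc E; rewrite dfE => dgE.
apply: DiffDef => //; apply/diff_locallyP; rewrite dgE -dfE; split => //.
Unshelve. all: by end_near. Qed.

Lemma near_eq_differentiable (V W : normedModType R) (f g : V -> W) (x : V) :
  {near x, f =1 g} -> differentiable f x -> differentiable g x.
Proof. by move=> fg /differentiableP /(near_eq_is_diff fg) []. Qed.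

Lemma near_eq_diff (V W : normedModType R) (f g : V -> W) (x : V) :
  {near x, f =1 g} -> differentiable f x -> 'd f x = 'd g x :> (V -> W).
Proof. by move=> fg /differentiableP /(near_eq_is_diff fg) [_ ->]. Qed.

Lemma differentiable_mxP (V : normedModType R) p q (f : V -> 'M[R]_(p, q)) x :
  differentiable f x <-> forall i j, differentiable (fun y => f y i j) x.
Proof.
split=> [df i j|df].
  by apply: (@differentiable_comp _ _ _ _ f (fun N : 'M[R]_(p, q) => N i j))
    => //; exact: differentiable_coord.
have -> : f = \sum_i \sum_j (fun y => f y i j *: delta_mx i j).
  apply/funext => y; rewrite fct_sumE [LHS]matrix_sum_delta.
  by apply: eq_bigr => i _; rewrite fct_sumE.
apply: differentiable_sum => i; apply: differentiable_sum => j.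
exact: differentiableZl.
Qed.

Lemma continuous_mxP (T : topologicalType) p q (f : T -> 'M[R]_(p, q)) x :
  {for x, continuous f} <-> forall i j, {for x, continuous (fun y => f y i j)}.
Proof.
split=> [cf i j|cf].
  apply: (@continuous_comp _ _ _ f (fun N : 'M[R]_(p, q) => N i j)) => //.
  exact: coord_continuous.
apply/cvgrPdist_le => /= e e0; near=> y.
rewrite /Num.Def.normr/= mx_normrE (bigmax_le _ (ltW e0))//= => i _.
rewrite !mxE; move: i; near: y; apply: filter_forall => /= i.
exact: ((cvgrPdist_le _ _).1 (cf i.1 i.2)).
Unshelve. all: by end_near. Qed.

End Calculus.

(** * Locality of [Ck] and its stability under matrix operations *)

Section CkCalculus.
Context {R : realType} {m : nat}.
Implicit Types U V : set 'rV[R]_m.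

Lemma open_near (T : topologicalType) (U : set T) x : open U -> U x ->
  nbhs x U.
Proof. by rewrite openE => oU Ux; exact: oU. Qed.

(** The equality holds on an open set, so the partial derivatives agree there too and the induction
    continues with them. With [f] and [g] equal this is the locality of [Ck], used for fields
    defined by cases. *)
Lemma Ck_local (W : normedModType R) k U (f g : 'rV[R]_m -> W) :
  (forall x, U x -> exists V, [/\ open V, V x,
     forall y, V y -> f y = g y & Ck k V g]) -> Ck k U f.
Proof.
elim: k U f g => [|k IH] U f g loc /=.
  move=> x /loc[V [oV Vx fg Cg]]; rewrite /prop_for /continuous_at fg//.
  have E : {near x, g =1 f}.
    by near=> y; apply/esym/fg; near: y; exact: open_near.
  exact: cvg_trans (near_eq_cvg E) (Cg x Vx).
have near_fg x : U x -> exists V, [/\ open V, V x,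
     forall y, V y -> f y = g y & Ck k.+1 V g] /\ {near x, g =1 f}.
  move=> /loc[V [oV Vx fg Cg]]; exists V; split=> //.
  by near=> y; apply/esym/fg; near: y; exact: open_near.
split=> [x /near_fg[V [[_ Vx _ [dg _]] ng]]|l].
  by apply: near_eq_differentiable ng _; exact: dg.
apply: (IH _ _ (fun x => 'D_(delta_mx 0 l) g x)) => x.
move=> /near_fg[V [[oV Vx fg [dg Cg]] ng]].
exists V; split=> //; last exact: (Cg l).
move=> y Vy; apply: near_eq_derive.
by near=> z; apply/fg; near: z; exact: open_near.
Unshelve. all: by end_near. Qed.

Lemma Ck_ext (W : normedModType R) k U (f g : 'rV[R]_m -> W) : open U ->
  (forall x, U x -> f x = g x) -> Ck k U g -> Ck k U f.
Proof. by move=> oU fg Cg; apply: (@Ck_local _ _ _ _ g) => x Ux; exists U. Qed.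

Lemma Ck_sub (W : normedModType R) k U V (f : 'rV[R]_m -> W) :
  V `<=` U -> Ck k U f -> Ck k V f.
Proof.
move=> VU; elim: k f => [|k IH] f /=; first by move=> cf x /VU; exact: cf.
by move=> [df Cf]; split=> [x /VU|l]; [exact: df|apply: IH].
Qed.

Lemma CkS (W : normedModType R) k U (f : 'rV[R]_m -> W) :
  Ck k.+1 U f -> Ck k U f.
Proof.
elim: k f => [|k IH] f [df Cf] /=.
  by move=> x Ux; apply: differentiable_continuous; exact: df.
by split=> // l; apply: IH.
Qed.

Lemma Ck_continuous (W : normedModType R) k U (f : 'rV[R]_m -> W) x :
  Ck k U f -> U x -> {for x, continuous f}.
Proof. by elim: k => [|k IH]; [exact|move=> /CkS]. Qed.

(** Differentiation acts entry by entry, so the matrix rules below reduce to rules for scalar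
    functions. *)
Lemma Ck_mxP p q k U (f : 'rV[R]_m -> 'M[R]_(p, q)) : open U ->
  Ck k U f <-> forall i j, Ck k U (fun x => f x i j).
Proof.
move=> oU; elim: k f => [|k IH] f /=.
  split=> [cf i j x Ux|cf x Ux].
    exact: ((continuous_mxP f x).1 (cf x Ux) i j).
  by apply: (continuous_mxP f x).2 => i j; exact: cf.
have DE : (forall x, U x -> differentiable f x) -> forall x l i j, U x ->
  ('D_(delta_mx 0 l) f x) i j = 'D_(delta_mx 0 l) (fun x => f x i j) x.
  by move=> df x l i j Ux; rewrite derive_mx ?mxE//; exact/diff_derivable/df.
split=> [[df Cf] i j|cf].
  split=> [x Ux|l]; first exact: ((differentiable_mxP f x).1 (df x Ux) i j).
  have /IH/(_ i j) := Cf l; apply: Ck_ext => // x Ux.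
  by rewrite DE.
have df x : U x -> differentiable f x.
  by move=> Ux; apply: (differentiable_mxP f x).2 => i j; have [d _] := cf i j; exact: d.
split=> // l; apply/IH => i j; have [_ /(_ l)] := cf i j.
by apply: Ck_ext => // x Ux; rewrite DE.
Qed.

Lemma Ck_cst (W : normedModType R) k U (c : W) : Ck k U (fun=> c).
Proof.
elim: k c => [|k IH] c /=; first by move=> x _; exact: cst_continuous.
split=> [x _|l]; first exact: differentiable_cst.
by under eq_fun do rewrite derive_cst; exact: IH.
Qed.

Lemma Ck_coord k U i : Ck k U (fun x => x 0 i).
Proof.
case: k => [|k] /=; first by move=> x _; exact: coord_continuous.
split=> [x _|l]; first exact: differentiable_coord.
have -> : (fun x => 'D_(delta_mx 0 l) (fun y : 'rV[R]_m => y 0 i : R) x) =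
    (fun=> (delta_mx 0 l : 'rV[R]_m) 0 i).
  apply/funext => x; have /derive_mx : derivable id x (delta_mx 0 l : 'rV[R]_m).
    exact: derivable_id.
  by rewrite derive_id => /matrixP/(_ 0 i) ->; rewrite mxE.
exact: Ck_cst.
Qed.

Lemma Ck_id k U : open U -> Ck k U id.
Proof. by move=> oU; apply/Ck_mxP => // i j; rewrite ord1; exact: Ck_coord. Qed.

Lemma Ck_add k U (f g : 'rV[R]_m -> R) : open U ->
  Ck k U f -> Ck k U g -> Ck k U (fun x => f x + g x).
Proof.
move=> oU; elim: k f g => [|k IH] f g /=.
  by move=> cf cg x Ux; apply: continuousD; [exact: cf|exact: cg].
move=> [df Cf] [dg Cg]; split=> [x Ux|l].
  by apply: differentiableD; [exact: df|exact: dg].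
have := IH _ _ (Cf l) (Cg l); apply: Ck_ext => // x Ux.
by rewrite deriveD//; apply: diff_derivable; [exact: df|exact: dg].
Qed.

Lemma Ck_mul k U (f g : 'rV[R]_m -> R) : open U ->
  Ck k U f -> Ck k U g -> Ck k U (fun x => f x * g x).
Proof.
move=> oU; elim: k f g => [|k IH] f g.
  by move=> cf cg x Ux; apply: continuousM; [exact: cf|exact: cg].
move=> Cf1 Cg1; have [df Cf] := Cf1; have [dg Cg] := Cg1; split=> [x Ux|l].
  by apply: differentiableM; [exact: df|exact: dg].
have := Ck_add oU (IH _ _ (CkS Cf1) (Cg l)) (IH _ _ (CkS Cg1) (Cf l)).
apply: Ck_ext => // x Ux.
by rewrite deriveM//; apply: diff_derivable; [exact: df|exact: dg].
Qed.

Lemma Ck_opp k U (f : 'rV[R]_m -> R) : open U ->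
  Ck k U f -> Ck k U (fun x => - f x).
Proof.
move=> oU Cf; under eq_fun do rewrite -mulN1r; apply: Ck_mul => //.
exact: Ck_cst.
Qed.

Lemma Ck_sub2 k U (f g : 'rV[R]_m -> R) : open U ->
  Ck k U f -> Ck k U g -> Ck k U (fun x => f x - g x).
Proof. by move=> oU Cf Cg; apply: Ck_add => //; exact: Ck_opp. Qed.

Lemma Ck_sum (I : Type) (r : seq I) (P : pred I) k U
    (f : I -> 'rV[R]_m -> R) : open U ->
  (forall i, Ck k U (f i)) -> Ck k U (fun x => \sum_(i <- r | P i) f i x).
Proof.
move=> oU Cf; elim: r => [|i r IH].
  by under eq_fun do rewrite big_nil; exact: Ck_cst.
under eq_fun do rewrite big_cons.
by case: (P i) => //; apply: Ck_add.
Qed.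

Lemma Ck_prod (I : Type) (r : seq I) (P : pred I) k U
    (f : I -> 'rV[R]_m -> R) : open U ->
  (forall i, Ck k U (f i)) -> Ck k U (fun x => \prod_(i <- r | P i) f i x).
Proof.
move=> oU Cf; elim: r => [|i r IH].
  by under eq_fun do rewrite big_nil; exact: Ck_cst.
under eq_fun do rewrite big_cons.
by case: (P i) => //; apply: Ck_mul.
Qed.

Lemma Ck_inv k U (f : 'rV[R]_m -> R) : open U ->
  (forall x, U x -> f x != 0) -> Ck k U f -> Ck k U (fun x => (f x)^-1).
Proof.
move=> oU f0; elim: k => [|k IH].
  by move=> cf x Ux; apply: continuousV; [exact: f0|exact: cf].
move=> Cf1; have [df Cf] := Cf1; split=> [x Ux|l].
  by apply: differentiableV; [exact: df|exact: f0].
have Ci := IH (CkS Cf1).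
have := Ck_opp oU (Ck_mul oU (Ck_mul oU Ci Ci) (Cf l)).
apply: Ck_ext => // x Ux.
rewrite deriveV ?f0//; last exact/diff_derivable/df.
by rewrite -exprVn expr2 scaleNr.
Qed.

Lemma Ck_mulmx p q r k U (f : 'rV[R]_m -> 'M[R]_(p, q))
    (g : 'rV[R]_m -> 'M[R]_(q, r)) : open U ->
  Ck k U f -> Ck k U g -> Ck k U (fun x => f x *m g x).
Proof.
move=> oU /(Ck_mxP _ _ oU) Cf /(Ck_mxP _ _ oU) Cg; apply/Ck_mxP => // i j.
by under eq_fun do rewrite mxE; apply: Ck_sum => // l; apply: Ck_mul.
Qed.

Lemma Ck_addmx p q k U (f g : 'rV[R]_m -> 'M[R]_(p, q)) : open U ->
  Ck k U f -> Ck k U g -> Ck k U (fun x => f x + g x).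
Proof.
move=> oU /(Ck_mxP _ _ oU) Cf /(Ck_mxP _ _ oU) Cg; apply/Ck_mxP => // i j.
by under eq_fun do rewrite mxE; apply: Ck_add.
Qed.

Lemma Ck_oppmx p q k U (f : 'rV[R]_m -> 'M[R]_(p, q)) : open U ->
  Ck k U f -> Ck k U (fun x => - f x).
Proof.
move=> oU /(Ck_mxP _ _ oU) Cf; apply/Ck_mxP => // i j.
by under eq_fun do rewrite mxE; apply: Ck_opp.
Qed.

Lemma Ck_submx p q k U (f g : 'rV[R]_m -> 'M[R]_(p, q)) : open U ->
  Ck k U f -> Ck k U g -> Ck k U (fun x => f x - g x).
Proof. by move=> oU Cf Cg; apply: Ck_addmx => //; exact: Ck_oppmx. Qed.

Lemma Ck_scalemx p q k U (a : 'rV[R]_m -> R) (f : 'rV[R]_m -> 'M[R]_(p, q)) :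
  open U -> Ck k U a -> Ck k U f -> Ck k U (fun x => a x *: f x).
Proof.
move=> oU Ca /(Ck_mxP _ _ oU) Cf; apply/Ck_mxP => // i j.
by under eq_fun do rewrite mxE; apply: Ck_mul.
Qed.

Lemma Ck_trmx p q k U (f : 'rV[R]_m -> 'M[R]_(p, q)) : open U ->
  Ck k U f -> Ck k U (fun x => (f x)^T).
Proof.
move=> oU /(Ck_mxP _ _ oU) Cf; apply/Ck_mxP => // i j.
by under eq_fun do rewrite mxE.
Qed.

Lemma Ck_row_mx p q r k U (f : 'rV[R]_m -> 'M[R]_(p, q))
    (g : 'rV[R]_m -> 'M[R]_(p, r)) : open U ->
  Ck k U f -> Ck k U g -> Ck k U (fun x => row_mx (f x) (g x)).
Proof.
move=> oU /(Ck_mxP _ _ oU) Cf /(Ck_mxP _ _ oU) Cg; apply/Ck_mxP => // i j.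
by under eq_fun do rewrite mxE; case: (fintype.split j) => l.
Qed.

Lemma Ck_lsubmx p q r k U (f : 'rV[R]_m -> 'M[R]_(p, q + r)) : open U ->
  Ck k U f -> Ck k U (fun x => lsubmx (f x)).
Proof.
move=> oU /(Ck_mxP _ _ oU) Cf; apply/Ck_mxP => // i j.
by under eq_fun do rewrite mxE.
Qed.

Lemma Ck_rsubmx p q r k U (f : 'rV[R]_m -> 'M[R]_(p, q + r)) : open U ->
  Ck k U f -> Ck k U (fun x => rsubmx (f x)).
Proof.
move=> oU /(Ck_mxP _ _ oU) Cf; apply/Ck_mxP => // i j.
by under eq_fun do rewrite mxE.
Qed.

Lemma Ck_det p k U (f : 'rV[R]_m -> 'M[R]_p) : open U ->
  Ck k U f -> Ck k U (fun x => \det (f x)).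
Proof.
move=> oU /(Ck_mxP _ _ oU) Cf; apply: Ck_sum => // s.
by apply: Ck_mul => //; [exact: Ck_cst|exact: Ck_prod].
Qed.

Lemma Ck_invmx p k U (f : 'rV[R]_m -> 'M[R]_p) : open U ->
  (forall x, U x -> f x \in unitmx) ->
  Ck k U f -> Ck k U (fun x => invmx (f x)).
Proof.
move=> oU fu Cf; have Cf' := (Ck_mxP _ _ oU).1 Cf.
apply: (@Ck_ext _ _ _ _ (fun x => (\det (f x))^-1 *: \adj (f x))) => //.
  by move=> x Ux; rewrite /invmx fu.
apply: Ck_scalemx => //.
  apply: Ck_inv => //; last exact: Ck_det.
  by move=> x /fu; rewrite unitmxE unitfE.
apply/Ck_mxP => // i j; under eq_fun do rewrite mxE.
apply: Ck_mul => //; first exact: Ck_cst.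
apply: Ck_det => //; apply/Ck_mxP => // a b.
by under eq_fun do rewrite !mxE.
Qed.

Lemma derive_sum_delta (W : normedModType R) (f : 'rV[R]_m -> W) x v :
  differentiable f x -> 'D_v f x = \sum_l v 0 l *: 'D_(delta_mx 0 l) f x.
Proof.
move=> df; rewrite [in LHS](row_sum_delta v) deriveE // linear_sum /=.
by apply: eq_bigr => l _; rewrite linearZ /= -deriveE.
Qed.

Lemma Ck_deriveR k U (f : 'rV[R]_m -> R) (v : 'rV[R]_m -> 'rV[R]_m) : open U ->
  Ck k.+1 U f -> Ck k U v -> Ck k U (fun x => 'D_(v x) f x).
Proof.
move=> oU [df Cf] /(Ck_mxP _ _ oU) Cv.
apply: (@Ck_ext _ _ _ _
    (fun x => \sum_l v x 0 l * 'D_(delta_mx 0 l) f x)) => //.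
  by move=> x Ux; rewrite derive_sum_delta//; exact: df.
by apply: Ck_sum => // l; apply: (Ck_mul oU (Cv 0 l)); exact: Cf.
Qed.

Lemma Ck_derive p q k U (f : 'rV[R]_m -> 'M[R]_(p, q))
    (v : 'rV[R]_m -> 'rV[R]_m) : open U ->
  Ck k.+1 U f -> Ck k U v -> Ck k U (fun x => 'D_(v x) f x).
Proof.
move=> oU Cf Cv; have [df _] := Cf.
apply/Ck_mxP => // i j.
apply: (@Ck_ext _ _ _ _ (fun x => 'D_(v x) (fun x => f x i j) x)) => //.
  by move=> x Ux; rewrite derive_mx ?mxE//; exact/diff_derivable/df.
by apply: Ck_deriveR => //; exact: (Ck_mxP k.+1 f oU).1.
Qed.

End CkCalculus.

Section CkComp.
Context {R : realType}.

Lemma derive_comp (V W Z : normedModType R) (f : V -> W) (g : W -> Z) x v :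
  differentiable f x -> differentiable g (f x) ->
  'D_v (g \o f) x = 'D_('D_v f x) g (f x).
Proof.
move=> df dg; rewrite !deriveE//; last exact: differentiable_comp.
by rewrite diff_comp.
Qed.

Lemma Ck_compR m d k (U : set 'rV[R]_m) (V : set 'rV[R]_d)
    (f : 'rV[R]_m -> 'rV[R]_d) (g : 'rV[R]_d -> R) : open U ->
  (forall x, U x -> V (f x)) -> Ck k U f -> Ck k V g -> Ck k U (g \o f).
Proof.
move=> oU fUV; elim: k g => [|k IH] g.
  by move=> cf cg x Ux; apply: continuous_comp; [exact: cf|exact/cg/fUV].
move=> Cf1 Cg1; have [df Cf] := Cf1; have [dg Cg] := Cg1; split=> [x Ux|l].
  by apply: differentiable_comp; [exact: df|exact/dg/fUV].
(* The direction ['D_(delta_mx 0 l) f x] varies with [x]; expanding it in partial derivatives of [g]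
   makes the induction hypothesis applicable to each of them. *)
apply: (@Ck_ext _ _ _ _ _ _ (fun x => \sum_j
  ('D_(delta_mx 0 l) f x) 0 j * 'D_(delta_mx 0 j) g (f x))) => //.
  move=> x Ux; rewrite derive_comp; [|exact: df|exact/dg/fUV].
  by rewrite derive_sum_delta; [|exact/dg/fUV].
apply: Ck_sum => // j; apply: Ck_mul => //.
  exact: ((Ck_mxP k _ oU).1 (Cf l)).
exact: IH (CkS Cf1) (Cg j).
Qed.

Lemma Ck_comp m d k p q (U : set 'rV[R]_m) (V : set 'rV[R]_d)
    (f : 'rV[R]_m -> 'rV[R]_d) (g : 'rV[R]_d -> 'M[R]_(p, q)) :
  open U -> open V ->
  (forall x, U x -> V (f x)) -> Ck k U f -> Ck k V g -> Ck k U (g \o f).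
Proof.
move=> oU oV fUV Cf /(Ck_mxP _ _ oV) Cg; apply/Ck_mxP => // i j.
exact: (Ck_compR oU fUV Cf (Cg i j)).
Qed.

End CkComp.

(** * Mean value inequalities and uniform bounds on compact convex sets *)

Section MeanValue.
Context {R : realType}.

Lemma mx_norm_leP p q (A : 'M[R]_(p, q)) (B : R) : 0 <= B ->
  `|A| <= B <-> forall i j, `|A i j| <= B.
Proof.
move=> B0; split=> [AB i j|AB]; last first.
  rewrite /Num.Def.normr/= mx_normrE bigmax_le// => -[i j] _; exact: AB.
apply: le_trans AB; rewrite [leRHS]/Num.Def.normr/= mx_normrE.
exact: (le_bigmax _ (fun ij => `|A ij.1 ij.2|) (i, j)).
Qed.

Lemma mx_norm_entry p q (A : 'M[R]_(p, q)) i j : `|A i j| <= `|A|.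
Proof. by have /mx_norm_leP := lexx `|A|; apply. Qed.

Lemma mx_norm_mulmx p q r (A : 'M[R]_(p, q)) (B : 'M[R]_(q, r)) :
  `|A *m B| <= q%:R * `|A| * `|B|.
Proof.
apply/mx_norm_leP; first by rewrite !mulr_ge0.
move=> i j; rewrite mxE (le_trans (ler_norm_sum _ _ _))//.
apply: (@le_trans _ _ (\sum_(l < q) `|A| * `|B|)).
  by apply: ler_sum => l _; rewrite normrM ler_pM// mx_norm_entry.
by rewrite sumr_const card_ord -mulrA mulr_natl.
Qed.

Lemma mulmx_continuous p q r (B : 'M[R]_(q, r)) :
  continuous (fun A : 'M[R]_(p, q) => A *m B).
Proof.
move=> A; apply: (continuous_mxP _ _).2 => i j.
have -> : (fun A : 'M[R]_(p, q) => (A *m B) i j) =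
    \sum_l (fun A : 'M[R]_(p, q) => A i l * B l j).
  by apply/funext => A'; rewrite mxE fct_sumE.
elim/big_ind : _ => [|f g cf cg|l _].
- exact: cst_continuous.
- by apply: continuousD.
- by apply: continuousM; [exact: coord_continuous|exact: cst_continuous].
Qed.

(** The scalar mean value theorem is applied to each entry of [f (x + t *: v) - t *: c]. The
    comparison vector [c] covers several uses: [c = 0] gives Lipschitz bounds, [c = 'D_v f x] the
    Taylor remainder, and [B = 0] an exact increment. *)
Lemma mean_value_le (V : normedModType R) p q (f : V -> 'M[R]_(p, q))
    (x v : V) (c : 'M[R]_(p, q)) (B : R) :
  (forall t : R, 0 <= t <= 1 -> differentiable f (x + t *: v)
    /\ `|'D_v f (x + t *: v) - c| <= B) ->
  `|f (x + v) - f x - c| <= B.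
Proof.
move=> H; have [|_ B0] := H 0; first by rewrite lexx ler01.
have {B0} B0 : 0 <= B by apply: le_trans B0.
apply/mx_norm_leP => // i j.
pose phi t := f (x + t *: v) i j - t * c i j.
have dphi (t : R) : 0 <= t <= 1 ->
    is_derive t 1 phi (('D_v f (x + t *: v)) i j - c i j).
  move=> /H[df _].
  have dl : is_diff t (fun s : R => x + s *: v) ( *:%R ^~ v).
    by apply: is_diff_eq; rewrite add0r.
  have dfl : differentiable (f \o (fun s : R => x + s *: v)) t.
    by apply: differentiable_comp.
  have dfij := (differentiable_mxP _ _).1 dfl i j.
  have D1 : is_derive t 1 (fun s => f (x + s *: v) i j)
      (('D_v f (x + t *: v)) i j).
    apply: DeriveDef; first exact: diff_derivable.
    transitivity (('D_1 (f \o (fun s : R => x + s *: v)) t) i j).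
      by rewrite [in RHS]derive_mx ?mxE//; exact: diff_derivable.
    rewrite derive_comp//; congr ('D__ f _ i j).
    by rewrite deriveE// diff_val scale1r.
  apply: is_deriveB; apply: is_derive_eq.
  by rewrite scaler0 add0r /GRing.scale /= mulr1.
have [c0 c01] : exists2 s, s \in `[0, 1]%R & phi 1 - phi 0 =
    (('D_v f (x + s *: v)) i j - c i j) * (1 - 0).
  apply: MVT_segment => // [t|].
    by rewrite in_itv /= => /andP[/ltW t0 /ltW t1]; apply: dphi; rewrite t0.
  apply: continuous_in_subspaceT => t; rewrite inE /= in_itv /= => t01.
  have [dt _] := dphi t t01.
  by apply: differentiable_continuous; apply/derivable1_diffP.
rewrite subr0 mulr1 /phi scale1r scale0r addr0 mul0r subr0 mul1r => E.
have [_] := H c0 c01 => /mx_norm_leP-/(_ B0 i j).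
by rewrite !mxE -E addrAC.
Qed.

Definition convex_in (V : normedModType R) (K : set V) :=
  forall x y (t : R), K x -> K y -> 0 <= t <= 1 -> K (x + t *: (y - x)).

Lemma compact_norm_bound (T : topologicalType) (W : normedModType R) (K : set T)
    (f : T -> W) : compact K -> (forall x, K x -> {for x, continuous f}) ->
  exists2 M, 0 < M & forall x, K x -> `|f x| <= M.
Proof.
move=> cK cf; have : compact (f @` K).
  apply: continuous_compact => //; apply: continuous_in_subspaceT => x.
  by rewrite inE => /cf.
move=> /compact_bounded/pinfty_ex_gt0[M M0 H]; exists M => // x Kx.
by apply: H; exists x.
Qed.

Context {m : nat}.
Implicit Types K U : set 'rV[R]_m.

Lemma derive_bound p q (f : 'rV[R]_m -> 'M[R]_(p, q)) K U :
  compact K -> K `<=` U -> Ck 1 U f ->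
  exists2 L, 0 < L & forall x v, K x -> `|'D_v f x| <= L * `|v|.
Proof.
move=> cK KU [df cf].
have /choice[M HM] : forall l : 'I_m, exists M, 0 < M /\
    forall x, K x -> `|'D_(delta_mx 0 l) f x| <= M.
  move=> l; have [|M M0 HM] := compact_norm_bound (f := 'D_(delta_mx 0 l) f) cK.
    by move=> x /KU; exact: cf.
  by exists M.
(* The summand 1 keeps the constant positive when [m = 0]. *)
exists (1 + \sum_l M l).
  by rewrite ltr_pwDl// sumr_ge0// => l _; rewrite ltW//; case: (HM l).
move=> x v Kx; rewrite derive_sum_delta; last exact/df/KU.
rewrite (le_trans (ler_norm_sum _ _ _))// mulrDl mul1r.
apply: (@le_trans _ _ (\sum_l M l * `|v|)); last by rewrite -mulr_suml lerDr.
apply: ler_sum => l _; rewrite normrZ mulrC ler_pM//.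
- by have [_] := HM l; exact.
- exact: mx_norm_entry.
Qed.

Lemma lipschitz_bound p q (f : 'rV[R]_m -> 'M[R]_(p, q)) K U :
  compact K -> convex_in K -> K `<=` U -> Ck 1 U f ->
  exists2 L, 0 < L & forall x y, K x -> K y -> `|f x - f y| <= L * `|x - y|.
Proof.
move=> cK vK KU Cf; have [L L0 HL] := derive_bound cK KU Cf.
exists L => // x y Kx Ky; have [df _] := Cf.
have := @mean_value_le _ _ _ f y (x - y) 0 (L * `|x - y|).
rewrite subr0 (addrC y) subrK; apply => t t01; rewrite subr0.
have Kt := vK _ _ _ Ky Kx t01.
by split; [exact/df/KU|exact: HL].
Qed.

Lemma derive_lipschitz_bound p q (f : 'rV[R]_m -> 'M[R]_(p, q)) K U :
  compact K -> convex_in K -> K `<=` U -> Ck 2 U f ->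
  exists2 L, 0 < L & forall x y v, K x -> K y ->
    `|'D_v f x - 'D_v f y| <= L * `|x - y| * `|v|.
Proof.
move=> cK vK KU [df Cf].
have /choice[M HM] : forall l : 'I_m, exists M, 0 < M /\
    forall x y, K x -> K y ->
    `|'D_(delta_mx 0 l) f x - 'D_(delta_mx 0 l) f y| <= M * `|x - y|.
  move=> l; have [M M0 H] := lipschitz_bound cK vK KU (Cf l).
  by exists M.
exists (1 + \sum_l M l).
  by rewrite ltr_pwDl// sumr_ge0// => l _; rewrite ltW//; case: (HM l).
move=> x y v Kx Ky.
rewrite !derive_sum_delta; [|exact/df/KU|exact/df/KU].
rewrite -sumrB (le_trans (ler_norm_sum _ _ _))// mulrDl mul1r mulrDl.
apply: (@le_trans _ _ (\sum_l M l * `|x - y| * `|v|)); last first.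
  by rewrite -!mulr_suml lerDr mulr_ge0.
apply: ler_sum => l _; rewrite -scalerBr normrZ mulrC ler_pM//.
- by have [_] := HM l; exact.
- exact: mx_norm_entry.
Qed.

(** Along the segment ['D_v f] differs from its value at [x] by at most [L * |t v| * |v|]; the
    factor 1/2 of the usual remainder is given up. *)
Lemma taylor_bound p q (f : 'rV[R]_m -> 'M[R]_(p, q)) K U :
  compact K -> convex_in K -> K `<=` U -> Ck 2 U f ->
  exists2 L, 0 < L & forall x v, K x -> K (x + v) ->
    `|f (x + v) - f x - 'D_v f x| <= L * `|v| ^+ 2.
Proof.
move=> cK vK KU Cf; have [L L0 HL] := derive_lipschitz_bound cK vK KU Cf.
exists L => // x v Kx Kxv; have [df _] := Cf.
apply: mean_value_le => t t01.
have := vK _ _ _ Kx Kxv t01; rewrite [x + v]addrC addrK => Kt.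
split; first exact/df/KU.
rewrite (le_trans (HL _ _ _ Kt Kx))// [x + _]addrC addrK expr2 mulrA ler_wpM2r//.
rewrite ler_wpM2l ?(ltW L0)// normrZ.
by have /andP[t0 t1] := t01; rewrite ger0_norm// ler_piMl.
Qed.

Lemma compact_closed_ball (x : 'rV[R]_m) r :
  compact [set y | `|y - x| <= r].
Proof.
have -> : [set y | `|y - x| <= r] = [set y : 'rV[R]_m | `|x - y| <= r].
  by apply/seteqP; split=> y /=; rewrite distrC.
apply: bounded_closed_compact.
  exists (`|x| + r); split; first exact: num_real.
  move=> M /ltW hM y /= hy; apply: le_trans hM.
  by rewrite -lerBlDl (le_trans _ hy)// distrC lerB_dist.
exact: closed_closed_ball_.
Qed.

Lemma convex_closed_ball (V : normedModType R) (x : V) r :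
  convex_in [set y | `|y - x| <= r].
Proof.
move=> y z t /= yr zr /andP[t0 t1].
have -> : y + t *: (z - y) - x = (1 - t) *: (y - x) + t *: (z - x).
  rewrite scalerBl scale1r -[RHS]addrA [- _ + _]addrC -scalerBr opprB addrA subrK.
  by rewrite addrAC.
rewrite (le_trans (ler_normD _ _))// !normrZ !ger0_norm ?subr_ge0//.
have -> : r = (1 - t) * r + t * r by ring.
by rewrite lerD// ler_wpM2l// subr_ge0.
Qed.

End MeanValue.

(** * Symmetry of second derivatives *)

Section Schwarz.
Context {R : realType} {m : nat}.

Lemma derive_linear (V W : normedModType R) (f : V -> W) x a u v :
  differentiable f x -> 'D_(a *: u + v) f x = a *: 'D_u f x + 'D_v f x.
Proof. by move=> df; rewrite !deriveE// linearP. Qed.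

(* The second difference of [f] along [t u] and [t v] is
   [t^2 D_v D_u f + O(t^3)] and is symmetric in [u] and [v]. *)
Lemma derive_derive_sym (U : set 'rV[R]_m) p q (f : 'rV[R]_m -> 'M[R]_(p, q))
    (x u v : 'rV[R]_m) : open U -> U x -> Ck 3 U f ->
  'D_u ('D_v f) x = 'D_v ('D_u f) x.
Proof.
move=> oU Ux Cf.
have [r0 r00 Hr0] : exists2 r, 0 < r & forall y, `|y - x| <= r -> U y.
  have /nbhs_normP := open_near oU Ux; case=> r /= r0 H.
  exists (r / 2) => [|y yr]; first by rewrite divr_gt0.
  apply: H => /=; rewrite distrC (le_lt_trans yr)// ltr_pdivrMr// ltr_pMr//.
  by rewrite ltr1n.
pose K := [set y : 'rV[R]_m | `|y - x| <= r0].
have KU : K `<=` U by move=> y; exact: Hr0.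
have cK : compact K := @compact_closed_ball _ _ _ _.
have vK : convex_in K := @convex_closed_ball _ _ _ _.
have Cd w : Ck 2 U ('D_w f).
  by apply: (Ck_derive oU Cf); exact: Ck_cst.
pose D2 (t : R) a b := f (x + t *: a + t *: b) - f (x + t *: a) - f (x + t *: b) + f x.
have D2sym t a b : D2 t a b = D2 t b a.
  by rewrite /D2 -!addrA [t *: a + _]addrC; congr (_ + _); rewrite addrCA.
have main a b : exists C r, [/\ 0 < C, 0 < r & forall t, 0 < t -> t < r ->
    `|D2 t a b - t ^+ 2 *: 'D_b ('D_a f) x| <= C * t ^+ 3].
  have [L L0 HL] := taylor_bound cK vK KU (Cd a).
  pose N := `|a| + `|b| + 1.
  have N0 : 0 < N by rewrite ltr_pwDr.
  exists (L * (N ^+ 2 + N ^+ 2)), (r0 / N); split.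
  - by rewrite mulr_gt0// addr_gt0// exprn_gt0.
  - by rewrite divr_gt0.
  move=> t t0; rewrite ltr_pdivlMr// => tN.
  (* The second difference is the increment of [h] along [t *: a], so the mean value inequality
     leaves only the first derivative ['D_a f] at two points a distance [t *: b] apart. *)
  pose h y := f (y + t *: b) - f y.
  have Kx s e : 0 <= s <= 1 -> 0 <= e <= 1 -> K (x + (s *: (t *: a) + e *: (t *: b))).
    move=> /andP[s0 s1] /andP[e0 e1] /=; rewrite /K /= [x + _]addrC addrK.
    apply: le_trans (ltW tN); rewrite /N !mulrDr.
    rewrite -[leLHS]addr0 lerD//; last by rewrite mulr1 ltW.
    rewrite (le_trans (ler_normD _ _))// !normrZ !ger0_norm ?(ltW t0)//.
    by rewrite lerD// ler_piMl ?mulr_ge0// ltW.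
  have -> : D2 t a b = h (x + t *: a) - h x.
    by rewrite /D2 /h opprB addrAC -!addrA; congr (_ + (_ + _)); rewrite addrC.
  apply: mean_value_le => s s01.
  have K0 := Kx s 0 s01 ltac:(by rewrite lexx ler01).
  have K1 := Kx s 1 s01 ltac:(by rewrite lexx ler01).
  rewrite scale0r addr0 in K0; rewrite scale1r addrA in K1.
  set y := x + s *: (t *: a) in K0 K1 *.
  have [df _] := Cf.
  have dsh z : is_diff z (fun w : 'rV[R]_m => w + t *: b) id.
    by apply: is_diff_eq; rewrite addr0.
  have df1 : differentiable (fun w => f (w + t *: b)) y.
    by apply: (@differentiable_comp _ _ _ _ (fun w : 'rV[R]_m => w + t *: b) f)
      => //; exact/df/KU.
  have df0 : differentiable f y by exact/df/KU.
  split; first exact: differentiableB.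
  have -> : 'D_(t *: a) h y = t *: ('D_a f (y + t *: b) - 'D_a f y).
    rewrite deriveB; [|exact: diff_derivable|exact: diff_derivable].
    rewrite scalerBr; congr (_ - _); last by rewrite !deriveE// linearZ.
    rewrite (@derive_comp _ _ _ _ (fun w : 'rV[R]_m => w + t *: b) f)//; last first.
      exact/df/KU.
    rewrite (deriveE (f := fun w : 'rV[R]_m => w + t *: b))// diff_val.
    by rewrite !deriveE ?linearZ//; exact/df/KU.
  have dDa : differentiable ('D_a f) x.
    by have [d _] := Cd a; apply: d.
  (* Each term on the right is the linear part of the increment of ['D_a f] from [x] to one of the
     two points; Taylor's bound at [x] then applies to both. *)
  have E : t ^+ 2 *: 'D_b ('D_a f) x =
      t *: ('D_(s *: (t *: a) + t *: b) ('D_a f) x - 'D_(s *: (t *: a)) ('D_a f) x).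
    rewrite expr2 -scalerA; congr (_ *: _); rewrite !deriveE//.
    by rewrite linearD /= addrAC subrr add0r linearZ.
  rewrite E -scalerBr normrZ gtr0_norm//.
  have -> : L * (N ^+ 2 + N ^+ 2) * t ^+ 3 =
    t * (L * (t * N) ^+ 2 + L * (t * N) ^+ 2) by ring.
  rewrite ler_pM2l//.
  have Kx0 : K x by rewrite /K /= subrr normr0 ltW.
  have T1 : `|'D_a f (y + t *: b) - 'D_a f x
      - 'D_(s *: (t *: a) + t *: b) ('D_a f) x| <= L * (t * N) ^+ 2.
    have := HL x (s *: (t *: a) + t *: b) Kx0; rewrite addrA -/y.
    move=> /(_ K1) /le_trans; apply.
    rewrite ler_pM2l// lerXn2r ?nnegrE ?mulr_ge0 ?(ltW t0) ?(ltW N0)//.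
    rewrite (le_trans (ler_normD _ _))// !normrZ.
    have /andP[s0 s1] := s01; rewrite !ger0_norm ?(ltW t0)//.
    rewrite /N !mulrDr -[leLHS]addr0 lerD//; last by rewrite mulr1 ltW.
    by rewrite lerD// ler_piMl// mulr_ge0// ltW.
  have T0 : `|'D_a f y - 'D_a f x - 'D_(s *: (t *: a)) ('D_a f) x|
      <= L * (t * N) ^+ 2.
    apply: (le_trans (HL x _ Kx0 K0)).
    rewrite ler_pM2l// lerXn2r ?nnegrE ?mulr_ge0 ?(ltW t0) ?(ltW N0)//.
    rewrite !normrZ.
    have /andP[s0 s1] := s01; rewrite !ger0_norm ?(ltW t0)//.
    rewrite (@le_trans _ _ (t * `|a|))//; first by rewrite ler_piMl// mulr_ge0// ltW.
    by rewrite ler_wpM2l ?(ltW t0)// /N -addrA lerDl.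
  apply: le_trans (lerD T1 T0); move: ('D_a f (y + _)) ('D_a f y) ('D_a f x).
  move: ('D_(_ + _) _ x) ('D_(_ *: _) _ x) => E1 E2 A B D.
  rewrite (_ : A - B - (E1 - E2) = (A - D - E1) - (B - D - E2)) ?ler_normB//.
  by apply/matrixP => i j; rewrite !mxE; ring.
apply/eqP; rewrite -subr_eq0 -normr_le0.
have [C1 [r1 [C10 r10 H1]]] := main u v.
have [C2 [r2 [C20 r20 H2]]] := main v u.
apply/ler_addgt0Pl => e e0; rewrite addr0.
(* After division by [t ^+ 2] the two mixed derivatives differ by at most [(C1 + C2) * t], which
   this choice makes at most [e]. *)
pose t := Num.min (Num.min (r1 / 2) (r2 / 2)) (e / (C1 + C2)).
have t0 : 0 < t by rewrite !lt_min !divr_gt0// addr_gt0.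
have tr1 : t < r1.
  by rewrite !gt_min ltr_pdivrMr// ltr_pMr// ltr1n.
have tr2 : t < r2.
  by rewrite !gt_min [r2 / 2 < _]ltr_pdivrMr// ltr_pMr// ltr1n orbT.
have te : t <= e / (C1 + C2) by rewrite ge_min lexx orbT.
have := lerD (H1 t t0 tr1) (H2 t t0 tr2).
rewrite D2sym => H.
have := le_trans (ler_normB _ _) H.
rewrite opprB [X in `|X|]addrC addrA subrK -scalerBr normrZ.
rewrite ger0_norm ?exprn_ge0 ?(ltW t0)// -mulrDl [_ * t ^+ 3]mulrC [t ^+ 3]exprSr
  -[t ^+ 2 * t * _]mulrA.
rewrite ler_pM2l ?exprn_gt0// => H'.
apply: le_trans H' _; rewrite -ler_pdivlMr ?addr_gt0//.
Qed.

End Schwarz.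

(** * Flows as limits of Euler polygons *)

Section Limits.
Context {R : realType}.

Lemma le_of_eq (a b : R) : a = b -> a <= b. Proof. by move=> ->. Qed.

Lemma cvg_mx (T : Type) (F : set_system T) {FF : Filter F} p q
    (f : T -> 'M[R]_(p, q)) (l : 'M[R]_(p, q)) :
  (forall i j, f x i j @[x --> F] --> l i j) -> f x @[x --> F] --> l.
Proof.
move=> cf; apply/cvgrPdist_le => /= e e0; near=> y.
rewrite /Num.Def.normr/= mx_normrE (bigmax_le _ (ltW e0))//= => i _.
rewrite !mxE; move: i; near: y; apply: filter_forall => /= i.
exact: ((cvgrPdist_le _ _).1 (cf i.1 i.2)).
Unshelve. all: by end_near. Qed.

(** Each entry is a telescoping series dominated by a geometric one. Both the doubled Euler polygons
    and the contraction of the inverse function theorem have steps of this size. *)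
Lemma geometric_steps_cvg p q (u : nat -> 'M[R]_(p, q)) (C : R) :
  (forall j, `|u j.+1 - u j| <= C / 2 ^+ j) ->
  exists l : 'M[R]_(p, q), u x @[x --> \oo] --> l.
Proof.
move=> Hu.
suff /choice[l Hl] : forall ij, exists l : R, u x ij.1 ij.2 @[x --> \oo] --> l.
  exists (\matrix_(i, j) l (i, j)); apply: cvg_mx => i j.
  by rewrite mxE; exact: (Hl (i, j)).
move=> -[i j] /=; pose a n := u n i j.
suff : cvgn (series (telescope a)).
  move=> /cvg_ex[l]; rewrite telescopeK => al; exists (l + a 0%N).
  have -> : (fun n => u n i j) = (fun n => (a n - a 0%N) + a 0%N).
    by apply/funext => n; rewrite subrK.
  by apply: cvgD => //; exact: cvg_cst.
apply: normed_cvg; apply: (@series_le_cvg _ _ (geometric C (2^-1))).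
- by move=> n /=; exact: normr_ge0.
- by move=> n /=; rewrite exprVn; apply: le_trans (Hu n).
- move=> n; rewrite /geometric /= exprVn; apply: le_trans (Hu n).
  by apply: le_trans (mx_norm_entry _ i j); rewrite !mxE.
- by apply: is_cvg_geometric_series; rewrite ger0_norm// invf_lt1// ltr1n.
Qed.

Lemma norm_lim_le (V : normedModType R) (u : nat -> V) l (B : R) :
  u x @[x --> \oo] --> l -> (forall n, `|u n| <= B) -> `|l| <= B.
Proof.
move=> ul uB.
have ul' : `|u x| @[x --> \oo] --> `|l| by apply: cvg_norm.
apply: (closed_cvg (fun x : R => x <= B) _ _ _ ul'); first exact: closed_le.
exact: nearW.
Qed.

(** At most [N] factors [1 + L / N] multiply to at most [expR L], and at most [N] errors [c / N] add
    up to at most [c]; the bound is therefore independent of [N]. *)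
Lemma discrete_gronwall (a : nat -> R) (L c : R) N :
  (0 < N)%N -> 0 <= L -> 0 <= c -> 0 <= a 0%N ->
  (forall k, (k < N)%N -> a k.+1 <= (1 + L / N%:R) * a k + c / N%:R) ->
  forall k, (k <= N)%N -> a k <= (a 0%N + c) * expR L.
Proof.
move=> N0 L0 c0 a0 Ha.
have N0R : 0 < N%:R :> R by rewrite ltr0n.
(* The induction needs the bound at the intermediate time [k / N]; bounding this time by 1 gives the
   claim. *)
suff H k : (k <= N)%N ->
    a k <= (a 0%N + c * (k%:R / N%:R)) * expR (L * (k%:R / N%:R)).
  move=> k kN; apply: le_trans (H k kN) _.
  have kN1 : k%:R / N%:R <= 1 :> R by rewrite ler_pdivrMr// mul1r ler_nat.
  rewrite ler_pM ?expR_ge0//.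
  - by rewrite addr_ge0// mulr_ge0// divr_ge0.
  - by rewrite lerD2l ler_piMr.
  - by rewrite ler_expR ler_piMr.
elim: k => [|k IH] kN; first by rewrite mul0r !mulr0 addr0 expR0 mulr1.
apply: le_trans (Ha k kN) _.
have IHk := IH (ltnW kN).
have e1 : 1 + L / N%:R <= expR (L / N%:R) by exact: expR_ge1Dx.
have -> : expR (L * (k.+1%:R / N%:R)) = expR (L / N%:R) * expR (L * (k%:R / N%:R)).
  by rewrite -expRD -natr1 mulrDl mulrDr mul1r addrC.
set E := expR (L * _) in IHk *; set e := expR _ in e1 *.
have E1 : 1 <= E.
  rewrite /E (le_trans _ (expR_ge1Dx _))// lerDl mulr_ge0//.
have e10 : 1 <= e by rewrite (le_trans _ e1)// lerDl divr_ge0// ltW.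
have LN : 0 <= 1 + L / N%:R by rewrite addr_ge0// divr_ge0// ltW.
have -> : a 0%N + c * (k.+1%:R / N%:R) = a 0%N + c * (k%:R / N%:R) + c / N%:R.
  by rewrite -natr1; ring.
rewrite [in leRHS]mulrDl lerD//.
  apply: (@le_trans _ _ ((1 + L / N%:R) * ((a 0%N + c * (k%:R / N%:R)) * E))).
    by rewrite ler_wpM2l.
  rewrite mulrCA ler_wpM2l//; last by rewrite ler_wpM2r// (le_trans _ E1).
  by rewrite addr_ge0// mulr_ge0// divr_ge0.
by rewrite ler_peMr ?divr_ge0 ?(ltW N0R)// mulr_ege1.
Qed.

End Limits.

Section Euler.
Context {R : realType}.

Definition euler_step d (G : 'rV[R]_d -> 'rV[R]_d) (N : nat) (x : 'rV[R]_d) :=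
  x + N%:R^-1 *: G x.

Fact euler_key : unit. Proof. by []. Qed.

(* Locked, since conversion tests between polygons would unfold matrix sums. *)
Definition euler : forall d, ('rV[R]_d -> 'rV[R]_d) ->
    nat -> nat -> 'rV[R]_d -> 'rV[R]_d :=
  locked_with euler_key (fun d G N k => iter k (@euler_step d G N)).
Arguments euler [d] G N k x.

Definition euler_limit d (G : 'rV[R]_d -> 'rV[R]_d) x :=
  lim (euler G (2 ^ j)%N (2 ^ j)%N x @[j --> \oo]).

(* Unlike a global Lipschitz bound, this passes to the variational system. *)
Definition confined d (G : 'rV[R]_d -> 'rV[R]_d) (O W : set 'rV[R]_d) :=
  forall x, W x -> exists B K, [/\ nbhs x B, compact K, convex_in K, K `<=` O &
    forall y N k, B y -> (0 < N)%N -> (k <= N)%N -> K (euler G N k y)].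

Lemma eulerS d (G : 'rV[R]_d -> 'rV[R]_d) N k x :
  euler G N k.+1 x = euler G N k x + N%:R^-1 *: G (euler G N k x).
Proof. by rewrite /euler !locked_withE. Qed.

Lemma euler0 d (G : 'rV[R]_d -> 'rV[R]_d) N x : euler G N 0 x = x.
Proof. by rewrite /euler locked_withE. Qed.

Section Convergence.
Variables (d : nat) (G : 'rV[R]_d -> 'rV[R]_d) (O : set 'rV[R]_d).
Variables (B K : set 'rV[R]_d).
Hypotheses (GO : Ck 1 O G).
Hypotheses (cK : compact K) (vK : convex_in K) (KO : K `<=` O).
Hypothesis BK : forall y N k, B y -> (0 < N)%N -> (k <= N)%N -> K (euler G N k y).

(** Over a time step [1 / N] the fine polygon evaluates [G] at a second point, within [M / (2 N)] of
    the first. This creates an error of order [L * M / N ^ 2] per step, and Gronwall sums [N] of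
    them. Along [N = 2 ^ j] the resulting bounds are geometric. *)
Lemma euler_refine : exists2 C, 0 <= C & forall y N, B y -> (0 < N)%N ->
  `|euler G (N * 2) (N * 2) y - euler G N N y| <= C / N%:R.
Proof.
have [L L0 HL] := lipschitz_bound cK vK KO GO.
have [M M0 HM] : exists2 M, 0 < M & forall x, K x -> `|G x| <= M.
  apply: compact_norm_bound cK _ => x Kx.
  by apply: Ck_continuous GO _; exact: KO.
exists (L * M * expR L) => [|y N By N0].
  by rewrite !mulr_ge0 ?expR_ge0 ?(ltW L0) ?(ltW M0).
have N0R : 0 < N%:R :> R by rewrite ltr0n.
pose v k := euler G (N * 2) (k * 2) y; pose u k := euler G N k y.
have N20 : (0 < N * 2)%N by rewrite muln_gt0 N0.
have Ku k : (k <= N)%N -> K (u k) by exact: BK.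
have Kv k : (k <= N * 2)%N -> K (euler G (N * 2) k y) by exact: BK.
have H k : (k < N)%N -> `|v k.+1 - u k.+1| <=
    (1 + L / N%:R) * `|v k - u k| + (L * M / N%:R) / N%:R.
  move=> kN.
  pose w := euler G (N * 2) (k * 2).+1 y.
  have Kw : K w by apply: Kv; lia.
  have Kvk : K (v k) by apply: Kv; rewrite leq_mul2r ltnW.
  have Kuk : K (u k) by apply/Ku/ltnW.
  have vS : v k.+1 = w + (N * 2)%:R^-1 *: G w by rewrite /v mulSn eulerS.
  have wE : w = v k + (N * 2)%:R^-1 *: G (v k) by rewrite /w eulerS.
  have NN : (N * 2)%:R^-1 = N%:R^-1 / 2 :> R by rewrite natrM invfM.
  have E : v k.+1 - u k.+1 = (v k - u k) + N%:R^-1 *: (G (v k) - G (u k))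
      + (N%:R^-1 / 2) *: (G w - G (v k)).
    rewrite vS {1}wE /u eulerS -/(u k) NN; apply/matrixP => i j; rewrite !mxE.
    by field; rewrite gt_eqF.
  rewrite E (le_trans (ler_normD _ _))// lerD//.
    rewrite (le_trans (ler_normD _ _))// mulrDl mul1r lerD2l normrZ.
    rewrite ger0_norm ?invr_ge0 ?(ltW N0R)// [L / _]mulrC -mulrA.
    by rewrite ler_wpM2l ?invr_ge0 ?(ltW N0R)// HL.
  rewrite normrZ ger0_norm ?divr_ge0 ?invr_ge0 ?(ltW N0R)//.
  apply: (@le_trans _ _ (N%:R^-1 / 2 * (L * (N%:R^-1 / 2 * M)))).
    rewrite ler_wpM2l ?divr_ge0 ?invr_ge0 ?(ltW N0R)//.
    rewrite (le_trans (HL _ _ Kw Kvk))// ler_wpM2l ?(ltW L0)//.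
    rewrite {1}wE [v k + _]addrC addrK normrZ NN.
    rewrite ger0_norm ?divr_ge0 ?invr_ge0 ?(ltW N0R)//.
    by rewrite ler_wpM2l ?divr_ge0 ?invr_ge0 ?(ltW N0R)// HM.
  have -> : N%:R^-1 / 2 * (L * (N%:R^-1 / 2 * M)) =
    L * M / N%:R / N%:R * (2^-1 * 2^-1) by ring.
  rewrite ler_piMr ?divr_ge0 ?mulr_ge0 ?(ltW L0) ?(ltW M0) ?(ltW N0R)//.
  by rewrite mulr_ile1 ?invr_ge0 ?invf_le1 ?ler1n.
have := discrete_gronwall N0 (ltW L0) _ _ H (leqnn N).
rewrite /v /u mul0n !euler0 subrr normr0 add0r => /(_ _ (lexx _)) H'.
rewrite mulrAC; apply: H'.
by rewrite divr_ge0 ?mulr_ge0 ?(ltW L0) ?(ltW M0) ?(ltW N0R).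
Qed.

Lemma euler_cvg y : B y ->
  euler G (2 ^ j)%N (2 ^ j)%N y @[j --> \oo] --> euler_limit G y.
Proof.
move=> By; have [C C0 HC] := euler_refine.
have [|l Hl] := @geometric_steps_cvg R _ _ (fun j => euler G (2 ^ j)%N (2 ^ j)%N y) C.
  move=> j; have := HC y (2 ^ j)%N By; rewrite expn_gt0 -expnSr natrX; exact.
by apply/cvg_ex; exists l.
Qed.

Lemma euler_limit_mem y : B y -> K (euler_limit G y).
Proof.
move=> By; apply: (@closed_cvg _ _ \oo _ _ K _ _ _ (euler_cvg By)).
  by apply: compact_closed => //; exact: norm_hausdorff.
by apply: nearW => j; apply: BK => //; rewrite expn_gt0.
Qed.

End Convergence.

End Euler.

(** * The variational system and smoothness of the flow *)

Section Prolongation.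
Context {R : realType}.

Lemma norm_row_mx_le p q (a : 'rV[R]_p) (b : 'rV[R]_q) (B : R) :
  `|a| <= B -> `|b| <= B -> `|row_mx a b| <= B.
Proof.
move=> aB bB; have B0 : 0 <= B by apply: le_trans aB.
apply/mx_norm_leP => // i j; rewrite mxE.
by case: (fintype.split j) => l; [apply: le_trans aB|apply: le_trans bB];
  exact: mx_norm_entry.
Qed.

Lemma norm_lsubmx_le p q (w : 'rV[R]_(p + q)) : `|lsubmx w| <= `|w|.
Proof. by apply/mx_norm_leP => // i j; rewrite mxE mx_norm_entry. Qed.

Lemma norm_rsubmx_le p q (w : 'rV[R]_(p + q)) : `|rsubmx w| <= `|w|.
Proof. by apply/mx_norm_leP => // i j; rewrite mxE mx_norm_entry. Qed.

Lemma lsubmx_continuous p q r :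
  continuous (@lsubmx R r p q : 'M[R]_(r, p + q) -> 'M[R]_(r, p)).
Proof.
move=> w; apply: (continuous_mxP _ _).2 => i j.
rewrite (_ : (fun _ => _) = fun w : 'M[R]_(r, p + q) => w i (lshift q j)).
  exact: coord_continuous.
by apply/funext => w'; rewrite mxE.
Qed.

Lemma rsubmx_continuous p q r :
  continuous (@rsubmx R r p q : 'M[R]_(r, p + q) -> 'M[R]_(r, q)).
Proof.
move=> w; apply: (continuous_mxP _ _).2 => i j.
rewrite (_ : (fun _ => _) = fun w : 'M[R]_(r, p + q) => w i (rshift p j)).
  exact: coord_continuous.
by apply/funext => w'; rewrite mxE.
Qed.

Lemma compact_lsub_rsub p q (K : set 'rV[R]_p) (K' : set 'rV[R]_q) :
  compact K -> compact K' ->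
  compact [set w : 'rV[R]_(p + q) | K (lsubmx w) /\ K' (rsubmx w)].
Proof.
move=> cK cK'; apply: bounded_closed_compact.
  have /pinfty_ex_gt0[M M0 HM] := compact_bounded cK.
  have /pinfty_ex_gt0[M' M'0 HM'] := compact_bounded cK'.
  exists (M + M'); split; first exact: num_real.
  move=> B /ltW MB w /= [Kw K'w]; apply: le_trans MB.
  rewrite -[w]hsubmxK; apply: norm_row_mx_le.
    by rewrite (le_trans (HM _ Kw))// lerDl ltW.
  by rewrite (le_trans (HM' _ K'w))// lerDr ltW.
rewrite (_ : [set _ | _] = (@lsubmx R 1 p q) @^-1` K `&` (@rsubmx R 1 p q) @^-1` K')//.
apply: closedI; apply: closed_comp; try by [].
- by move=> w _; exact: lsubmx_continuous.
- by apply: compact_closed => //; exact: norm_hausdorff.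
- by move=> w _; exact: rsubmx_continuous.
- by apply: compact_closed => //; exact: norm_hausdorff.
Qed.

Lemma convex_lsub_rsub p q (K : set 'rV[R]_p) (K' : set 'rV[R]_q) :
  convex_in K -> convex_in K' ->
  convex_in [set w : 'rV[R]_(p + q) | K (lsubmx w) /\ K' (rsubmx w)].
Proof.
move=> vK vK' w w' t /= [Kw K'w] [Kw' K'w'] t01; split.
  by rewrite linearD linearZ linearB /=; exact: vK.
by rewrite linearD linearZ linearB /=; exact: vK'.
Qed.

Lemma open_lsub p q (O : set 'rV[R]_p) : open O ->
  open [set w : 'rV[R]_(p + q) | O (lsubmx w)].
Proof.
move=> oO; apply: (open_comp (f := @lsubmx R 1 p q)) => // w _.
exact: lsubmx_continuous.
Qed.

Lemma open_rsub p q (O : set 'rV[R]_q) : open O ->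
  open [set w : 'rV[R]_(p + q) | O (rsubmx w)].
Proof.
move=> oO; apply: (open_comp (f := @rsubmx R 1 p q)) => // w _.
exact: rsubmx_continuous.
Qed.

(** The variational system [x' = G x], [v' = DG(x) v]. Differentiating an Euler step of [G] in the
    direction [v] gives an Euler step of this system, so its polygons carry the derivatives of the
    polygons of [G]. *)
Definition prolong d (G : 'rV[R]_d -> 'rV[R]_d) (w : 'rV[R]_(d + d)) :=
  row_mx (G (lsubmx w)) ('D_(rsubmx w) G (lsubmx w)).

Lemma euler_prolongl d (G : 'rV[R]_d -> 'rV[R]_d) N k w :
  lsubmx (euler (prolong G) N k w) = euler G N k (lsubmx w).
Proof.
elim: k => [|k IH]; first by rewrite !euler0.
rewrite !eulerS linearD linearZ /= IH.
by rewrite {2}/prolong row_mxKl IH.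
Qed.

Lemma euler_prolongrS d (G : 'rV[R]_d -> 'rV[R]_d) N k w :
  rsubmx (euler (prolong G) N k.+1 w) = rsubmx (euler (prolong G) N k w) +
    N%:R^-1 *: 'D_(rsubmx (euler (prolong G) N k w)) G (euler G N k (lsubmx w)).
Proof.
by rewrite !eulerS linearD linearZ /= {2}/prolong row_mxKr euler_prolongl.
Qed.

Lemma Ck_prolong d (G : 'rV[R]_d -> 'rV[R]_d) O k : open O ->
  Ck k.+1 O G -> Ck k [set w | O (lsubmx w)] (prolong G).
Proof.
move=> oO GO; have oO' := open_lsub (q := d) oO.
have Cl : Ck k [set w : 'rV[R]_(d + d) | O (lsubmx w)] (fun w => lsubmx w).
  by apply: Ck_lsubmx => //; exact: Ck_id.
have Cr : Ck k [set w : 'rV[R]_(d + d) | O (lsubmx w)] (fun w => rsubmx w).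
  by apply: Ck_rsubmx => //; exact: Ck_id.
apply: Ck_row_mx => //; first by apply: (Ck_comp oO' oO _ Cl (CkS GO)).
apply: (@Ck_ext _ _ _ _ _ _ (fun w : 'rV[R]_(d + d) =>
  \sum_l rsubmx w 0 l *: 'D_(delta_mx 0 l) G (lsubmx w))) => //.
  move=> w Ow; rewrite derive_sum_delta//.
  by have [dG _] := GO; exact: dG.
apply/Ck_mxP => // i j; apply: (@Ck_ext _ _ _ _ _ _ (fun x =>
  \sum_l rsubmx x 0 l * ('D_(delta_mx 0 l) G (lsubmx x)) i j)) => //.
  move=> x _; transitivity
    (\sum_l (rsubmx x 0 l *: 'D_(delta_mx 0 l) G (lsubmx x)) i j).
    exact: summxE.
  by apply: eq_bigr => l _; exact: mxE.
apply: Ck_sum => // l.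
apply: Ck_mul => //; first exact: ((Ck_mxP _ _ oO').1 Cr).
have [_ /(_ l) CG] := GO.
exact: ((Ck_mxP _ _ oO').1 (Ck_comp oO' oO (fun w Ow => Ow) Cl CG)).
Qed.

(** The second component obeys a recursion that is linear in it, with coefficient bounded by [L] on
    [K]. By Gronwall it stays within [rho * expR L] for every number of steps. *)
Lemma confined_prolong d (G : 'rV[R]_d -> 'rV[R]_d) O W : open O -> Ck 1 O G ->
  confined G O W ->
  confined (prolong G) [set w | O (lsubmx w)] [set w | W (lsubmx w)].
Proof.
move=> oO GO cG w /= /cG[B [K [Bw cK vK KO BK]]].
have [L L0 HL] := derive_bound cK KO GO.
pose rho := `|rsubmx w| + 1.
have rho0 : 0 < rho by rewrite ltr_pwDr.
exists [set w : 'rV[R]_(d + d) | B (lsubmx w) /\ `|rsubmx w| < rho].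
exists [set w | K (lsubmx w) /\
  [set y | `|y - 0| <= rho * expR L] (rsubmx w)]; split.
- apply: filterI; first exact: (@lsubmx_continuous d d 1 w _ Bw).
  suff H : nbhs (rsubmx w) [set y : 'rV[R]_d | `|y| < rho].
    exact: (@rsubmx_continuous d d 1 w _ H).
  apply/nbhs_ballP; exists 1 => //= y; rewrite -ball_normE /= distrC => yw.
  rewrite /rho -ltrBlDl (le_lt_trans _ yw)//.
  exact: lerB_dist.
- apply: compact_lsub_rsub => //; exact: compact_closed_ball.
- apply: convex_lsub_rsub => //; exact: convex_closed_ball.
- by move=> y /= [/KO].
move=> y N k /= [By yr] N0 kN; rewrite euler_prolongl; split; first exact: BK.
rewrite subr0.
pose a j := `|rsubmx (euler (prolong G) N j y)|.
have Ha j : (j < N)%N -> a j.+1 <= (1 + L / N%:R) * a j + 0 / N%:R.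
  move=> jN; rewrite /a euler_prolongrS mul0r addr0 mulrDl mul1r.
  rewrite (le_trans (ler_normD _ _))// lerD2l normrZ ger0_norm ?invr_ge0//.
  rewrite [L / _]mulrC -mulrA ler_wpM2l ?invr_ge0//; apply: HL.
  by apply: BK => //; exact: ltnW.
have := discrete_gronwall N0 (ltW L0) (lexx 0) _ Ha kN.
rewrite addr0 => H; apply: le_trans (H _) _; first exact: normr_ge0.
by rewrite /a euler0 ler_wpM2r ?expR_ge0// ltW.
Qed.

Lemma euler_prolongr_linear d (G : 'rV[R]_d -> 'rV[R]_d) O N k x a w w1 w2 :
  (forall x, O x -> differentiable G x) ->
  (forall j, (j <= k)%N -> O (euler G N j x)) ->
  lsubmx w = x -> lsubmx w1 = x -> lsubmx w2 = x ->
  rsubmx w = a *: rsubmx w1 + rsubmx w2 ->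
  rsubmx (euler (prolong G) N k w) =
  a *: rsubmx (euler (prolong G) N k w1) + rsubmx (euler (prolong G) N k w2).
Proof.
move=> dG Oj wx w1x w2x E; elim: k Oj => [|k IH] Oj; first by rewrite !euler0.
have E0 := euler_prolongrS G N k w.
have E1 := euler_prolongrS G N k w1.
have E2 := euler_prolongrS G N k w2.
rewrite E0.
rewrite E1.
rewrite E2.
rewrite wx w1x w2x IH => [|j jk]; last exact/Oj/leqW.
rewrite derive_linear; last exact/dG/Oj.
by rewrite !scalerDr !scalerA addrACA [_^-1 * a]mulrC.
Qed.

(** The linearisation error of the [N]-step polygon is quadratic in [h] with a constant independent
    of [N]. The bound therefore survives the limit, and [is_diff_quadratic] applies to the limit
    itself. *)
Lemma euler_limit_diff d (G : 'rV[R]_d -> 'rV[R]_d) O W x : open O ->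
  Ck 2 O G -> confined G O W -> W x ->
  exists df : {linear 'rV[R]_d -> 'rV[R]_d},
    (forall v, df v = rsubmx (euler_limit (prolong G) (row_mx x v))) /\
    is_diff x (euler_limit G) df.
Proof.
move=> oO GO cG Wx; have GO1 := CkS GO.
have [B [K [Bx cK vK KO BK]]] := cG x Wx.
have cP := confined_prolong oO GO1 cG.
have cvgP v : rsubmx (euler (prolong G) (2 ^ j)%N (2 ^ j)%N (row_mx x v))
    @[j --> \oo] --> rsubmx (euler_limit (prolong G) (row_mx x v)).
  have [|B' [K' [B'x cK' vK' KO' BK']]] := cP (row_mx x v).
    by rewrite /= row_mxKl.
  have CP := Ck_prolong oO GO.
  have := euler_cvg CP cK' vK' KO' BK' (nbhs_singleton B'x).
  by move=> H; apply: continuous_cvg H; exact: rsubmx_continuous.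
pose A v := rsubmx (euler_limit (prolong G) (row_mx x v)).
have Alin : linear A.
  move=> a u v; apply: (cvg_unique (@norm_hausdorff _ _) (cvgP _)).
  have -> : (fun j => rsubmx (euler (prolong G) (2 ^ j)%N (2 ^ j)%N
       (row_mx x (a *: u + v)))) =
     (fun j => a *: rsubmx (euler (prolong G) (2 ^ j)%N (2 ^ j)%N (row_mx x u))
       + rsubmx (euler (prolong G) (2 ^ j)%N (2 ^ j)%N (row_mx x v))).
    apply/funext => j.
    apply: (@euler_prolongr_linear _ _ O _ _ x); rewrite ?row_mxKl ?row_mxKr//.
      by move=> y; have [dG _] := GO; exact: dG.
    move=> i ij; apply/KO/BK => //; first exact: nbhs_singleton.
    by rewrite expn_gt0.
  by apply: cvgD; [apply: cvgZr|]; exact: cvgP.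
pose Alin_i := GRing.isLinear.Build _ _ _ _ _ Alin.
pose df : {linear 'rV[R]_d -> 'rV[R]_d} := HB.pack A Alin_i.
exists df; split=> //.
have dfc : continuous df.
  have -> : df = (fun v => v *m lin1_mx df) :> ('rV[R]_d -> 'rV[R]_d).
    by apply/funext => v; rewrite mul_rV_lin1.
  exact: mulmx_continuous.
have [L L0 HL] := lipschitz_bound cK vK KO GO1.
have [L' L'0 HL'] := derive_bound cK KO GO1.
have [T T0 HT] := taylor_bound cK vK KO GO.
pose e (N k : nat) (h : 'rV[R]_d) := euler G N k (x + h) - euler G N k x
  - rsubmx (euler (prolong G) N k (row_mx x h)).
have Be : nbhs (0 : 'rV[R]_d) [set h : 'rV[R]_d | B (x + h)].
  have /nbhs_ballP[r r0 H] := Bx; apply/nbhs_ballP; exists r => // h.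
  rewrite -ball_normE /= sub0r normrN => hr; apply: H.
  by rewrite -ball_normE /= opprD addrA subrr sub0r normrN.
have eN N h : (0 < N)%N -> B (x + h) ->
    `|e N N h| <= (T * expR L ^+ 2 * expR L') * `|h| ^+ 2.
  move=> N0 Bh; have Bx' := nbhs_singleton Bx.
  have Kh k : (k <= N)%N -> K (euler G N k (x + h)) by exact: BK.
  have Kx k : (k <= N)%N -> K (euler G N k x) by exact: BK.
  have lip k : (k <= N)%N ->
      `|euler G N k (x + h) - euler G N k x| <= `|h| * expR L.
    move=> kN; pose a j := `|euler G N j (x + h) - euler G N j x|.
    have Ha j : (j < N)%N -> a j.+1 <= (1 + L / N%:R) * a j + 0 / N%:R.
      move=> jN; rewrite /a !eulerS mul0r addr0 mulrDl mul1r opprD addrACA.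
      rewrite (le_trans (ler_normD _ _))// lerD2l -scalerBr normrZ.
      rewrite ger0_norm ?invr_ge0//.
      rewrite [L / _]mulrC -mulrA ler_wpM2l ?invr_ge0//.
      by apply: HL; [apply/Kh/ltnW|apply/Kx/ltnW].
    have := discrete_gronwall N0 (ltW L0) (lexx 0) _ Ha kN.
    rewrite addr0 /a !euler0 [x + h]addrC addrK => H.
    exact: H.
  have He j : (j < N)%N -> `|e N j.+1 h| <=
      (1 + L' / N%:R) * `|e N j h| + (T * (`|h| * expR L) ^+ 2) / N%:R.
    move=> jN; have jN' := ltnW jN.
    pose p := euler G N j (x + h); pose q := euler G N j x.
    pose r := rsubmx (euler (prolong G) N j (row_mx x h)).
    have dG : differentiable G q by have [dG _] := GO; exact/dG/KO/Kx.
    (* The Taylor remainder of [G] at [q] is the new error, at most [T * |p - q| ^ 2] with [|p - q|]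
       controlled by [lip]; the last term propagates the old error linearly. *)
    have E : e N j.+1 h = e N j h + N%:R^-1 *:
        ((G p - G q - 'D_(p - q) G q) + 'D_(e N j h) G q).
      rewrite /e euler_prolongrS row_mxKl !eulerS -/p -/q -/r.
      have -> : 'D_(p - q - r) G q = 'D_(p - q) G q - 'D_r G q.
        by rewrite !deriveE// linearB.
      clear -p q r; clearbody p q r.
      move: (G p) (G q) ('D_(p - q) G q) ('D_r G q) => A1 A2 A3 A4.
      by apply/matrixP => a b; rewrite !mxE; ring.
    rewrite E (le_trans (ler_normD _ _))// mulrDl mul1r -[leRHS]addrA lerD2l.
    have -> : L' / N%:R * `|e N j h| + T * (`|h| * expR L) ^+ 2 / N%:R =
      N%:R^-1 * (T * (`|h| * expR L) ^+ 2 + L' * `|e N j h|) by ring.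
    rewrite normrZ ger0_norm ?invr_ge0// ler_wpM2l ?invr_ge0//.
    rewrite (le_trans (ler_normD _ _))// lerD//; last exact: HL' (Kx _ jN').
    have pq : q + (p - q) = p by rewrite addrC subrK.
    have := HT q (p - q) (Kx _ jN'); rewrite pq => /(_ (Kh _ jN')) H.
    apply: le_trans H _; rewrite ler_wpM2l ?(ltW T0)// lerXn2r ?nnegrE//.
    exact: lip.
  have e0 : e N 0%N h = 0.
    by rewrite /e !euler0 row_mxKr [x + h]addrC addrK subrr.
  have := discrete_gronwall N0 (ltW L'0) _ _ He (leqnn N).
  rewrite e0 normr0 add0r => H; apply: le_trans (H _ _) _ => //.
    by rewrite mulr_ge0 ?(ltW T0)// exprn_ge0// mulr_ge0// expR_ge0.
  by rewrite exprMn; apply: le_of_eq; ring.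
apply: (@is_diff_quadratic _ _ _ _ _ _ (T * expR L ^+ 2 * expR L')) => //.
apply: filterS Be => h Bh.
apply: (@norm_lim_le _ _ (fun j => e (2 ^ j)%N (2 ^ j)%N h)) => [|j].
  apply: cvgB; last exact: cvgP.
  by apply: cvgB; apply: (euler_cvg GO1 cK vK KO BK) => //; exact: nbhs_singleton.
by apply: eN => //; rewrite expn_gt0.
Qed.

(** A partial derivative of the limit is the second half of the limit for [prolong G], started at a
    basis vector. The induction thus passes to a field in twice the dimension, whence the
    generalisation over [d] and [G]; each prolongation costs one derivative, whence the smoothness
    of [G]. *)
Lemma Ck_euler_limit k d (G : 'rV[R]_d -> 'rV[R]_d) O W : open O -> open W ->
  smooth_on O G -> confined G O W -> Ck k W (euler_limit G).
Proof.
move=> + + + cG; elim: k => [|k IH] in d G O W cG *; move=> oO oW sG.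
  move=> x Wx; have [df [_ [dphi _]]] := euler_limit_diff oO (sG 2) cG Wx.
  exact: differentiable_continuous.
split=> [x Wx|l].
  by have [df [_ [dphi _]]] := euler_limit_diff oO (sG 2) cG Wx.
have oW' := open_lsub (q := d) oW.
have Cphi : Ck k [set w | W (lsubmx w)] (euler_limit (prolong G)).
  apply: (IH _ _ [set w | O (lsubmx w)]) => //.
  - exact: confined_prolong oO (sG 1) cG.
  - exact: open_lsub.
  - by move=> j; exact: Ck_prolong.
apply: (@Ck_ext _ _ _ _ _ _ (fun x =>
  rsubmx (euler_limit (prolong G) (row_mx x (delta_mx 0 l))))) => //.
  move=> x Wx; have [df [dfE [dphi dE]]] := euler_limit_diff oO (sG 2) cG Wx.
  by rewrite deriveE// dE dfE.
apply: Ck_rsubmx => //.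
apply: (Ck_comp (f := fun x => row_mx x (delta_mx 0 l)) oW oW' _ _ Cphi) => //.
  by move=> x Wx /=; rewrite row_mxKl.
by apply: Ck_row_mx => //; [exact: Ck_id|exact: Ck_cst].
Qed.

End Prolongation.

(** * Product and block rules for matrix-valued maps *)

Section DeriveMatrix.
Context {R : realType} {V : normedModType R}.

Lemma derive_mulmx p q r (f : V -> 'M[R]_(p, q)) (g : V -> 'M[R]_(q, r)) x v :
  differentiable f x -> differentiable g x ->
  'D_v (fun y => f y *m g y) x = 'D_v f x *m g x + f x *m 'D_v g x.
Proof.
move=> df dg.
have dfe i j : derivable (fun y => f y i j) x v.
  exact/diff_derivable/((differentiable_mxP _ _).1 df).
have dge i j : derivable (fun y => g y i j) x v.
  exact/diff_derivable/((differentiable_mxP _ _).1 dg).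
have H i k : is_derive x v (fun y => (f y *m g y) i k)
    (('D_v f x *m g x + f x *m 'D_v g x) i k).
  have -> : (fun y => (f y *m g y) i k) =
      \sum_j ((fun y => f y i j) * (fun y => g y j k)).
    by apply/funext => y; rewrite mxE fct_sumE.
  have E : ('D_v f x *m g x + f x *m 'D_v g x) i k =
      \sum_j (f x i j *: 'D_v (fun y => g y j k) x
      + g x j k *: 'D_v (fun y => f y i j) x).
    rewrite mxE [X in X + _]mxE [X in _ + X]mxE -big_split /=.
    apply: eq_bigr => j _; rewrite addrC.
    rewrite (derive_mx (diff_derivable df)) (derive_mx (diff_derivable dg)) !mxE.
    by congr (_ + _); rewrite mulrC.
  rewrite E; apply: is_derive_sum => j.
  by apply: is_deriveM; apply: derivableP.
rewrite derive_mx; last by apply/derivable_mxP => i k; have [] := H i k.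
by apply/matrixP => i k; rewrite mxE; have [_ ->] := H i k.
Qed.

Lemma differentiable_mulmx p q r (f : V -> 'M[R]_(p, q)) (g : V -> 'M[R]_(q, r)) x :
  differentiable f x -> differentiable g x ->
  differentiable (fun y => f y *m g y) x.
Proof.
move=> df dg; apply: (differentiable_mxP _ _).2 => i k.
have -> : (fun y => (f y *m g y) i k) =
    \sum_j ((fun y => f y i j) * (fun y => g y j k)).
  by apply/funext => y; rewrite mxE fct_sumE.
apply: differentiable_sum => j; apply: differentiableM.
  exact: ((differentiable_mxP _ _).1 df).
exact: ((differentiable_mxP _ _).1 dg).
Qed.

Lemma derive_mulmxl p q r (A : 'M[R]_(p, q)) (g : V -> 'M[R]_(q, r)) x v :
  differentiable g x -> 'D_v (fun y => A *m g y) x = A *m 'D_v g x.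
Proof.
move=> dg; rewrite (@derive_mulmx _ _ _ (fun=> A) g)//.
by rewrite derive_cst mul0mx add0r.
Qed.

Lemma derive_mulmxr p q r (A : 'M[R]_(q, r)) (f : V -> 'M[R]_(p, q)) x v :
  differentiable f x -> 'D_v (fun y => f y *m A) x = 'D_v f x *m A.
Proof.
move=> df; rewrite (@derive_mulmx _ _ _ f (fun=> A))//.
by rewrite derive_cst mulmx0 addr0.
Qed.

Lemma derive_row_mx p q r (f : V -> 'M[R]_(p, q)) (g : V -> 'M[R]_(p, r)) x v :
  differentiable f x -> differentiable g x ->
  'D_v (fun y => row_mx (f y) (g y)) x = row_mx ('D_v f x) ('D_v g x).
Proof.
move=> df dg.
have dr : differentiable (fun y => row_mx (f y) (g y)) x.
  apply: (differentiable_mxP _ _).2 => i j; under eq_fun do rewrite mxE.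
  by case: (fintype.split j) => l; apply: (differentiable_mxP _ _).1.
rewrite !derive_mx; [|exact: diff_derivable..].
apply/matrixP => i j; rewrite !mxE; under eq_fun do rewrite mxE.
by case: (fintype.split j) => l; rewrite mxE.
Qed.

Lemma differentiable_row_mx p q r (f : V -> 'M[R]_(p, q)) (g : V -> 'M[R]_(p, r)) x :
  differentiable f x -> differentiable g x ->
  differentiable (fun y => row_mx (f y) (g y)) x.
Proof.
move=> df dg; apply: (differentiable_mxP _ _).2 => i j; under eq_fun do rewrite mxE.
by case: (fintype.split j) => l; apply: (differentiable_mxP _ _).1.
Qed.

Lemma differentiable_lsub p q r (f : V -> 'M[R]_(p, q + r)) x :
  differentiable f x -> differentiable (fun y => lsubmx (f y)) x.
Proof.
move=> df; apply: (differentiable_mxP _ _).2 => i j; under eq_fun do rewrite mxE.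
exact: (differentiable_mxP _ _).1.
Qed.

Lemma differentiable_rsub p q r (f : V -> 'M[R]_(p, q + r)) x :
  differentiable f x -> differentiable (fun y => rsubmx (f y)) x.
Proof.
move=> df; apply: (differentiable_mxP _ _).2 => i j; under eq_fun do rewrite mxE.
exact: (differentiable_mxP _ _).1.
Qed.

Lemma derive_lsub p q r (f : V -> 'M[R]_(p, q + r)) x v :
  differentiable f x -> 'D_v (fun y => lsubmx (f y)) x = lsubmx ('D_v f x).
Proof.
move=> df; have dl := differentiable_lsub df.
rewrite !derive_mx; [|exact: diff_derivable..].
by apply/matrixP => i j; rewrite !mxE; under eq_fun do rewrite mxE.
Qed.

Lemma derive_rsub p q r (f : V -> 'M[R]_(p, q + r)) x v :
  differentiable f x -> 'D_v (fun y => rsubmx (f y)) x = rsubmx ('D_v f x).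
Proof.
move=> df; have dl := differentiable_rsub df.
rewrite !derive_mx; [|exact: diff_derivable..].
by apply/matrixP => i j; rewrite !mxE; under eq_fun do rewrite mxE.
Qed.

Lemma derive_trmx p q (f : V -> 'M[R]_(p, q)) x v :
  differentiable f x -> 'D_v (fun y => (f y)^T) x = ('D_v f x)^T.
Proof.
move=> df; have dl : differentiable (fun y => (f y)^T) x.
  apply: (differentiable_mxP _ _).2 => i j; under eq_fun do rewrite mxE.
  exact: (differentiable_mxP _ _).1.
rewrite !derive_mx; [|exact: diff_derivable..].
by apply/matrixP => i j; rewrite !mxE; under eq_fun do rewrite mxE.
Qed.

Lemma differentiable_trmx p q (f : V -> 'M[R]_(p, q)) x :
  differentiable f x -> differentiable (fun y => (f y)^T) x.
Proof.
move=> df; apply: (differentiable_mxP _ _).2 => i j; under eq_fun do rewrite mxE.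
exact: (differentiable_mxP _ _).1.
Qed.

End DeriveMatrix.

(** * Simultaneous flow of commuting fields *)

Section FlowBox.
Context {R : realType}.

Lemma cvg_geometric_bound (V : normedModType R) (u : nat -> V) l (C : R) :
  u x @[x --> \oo] --> l -> (forall j, `|u j| <= C / 2 ^+ j) -> l = 0.
Proof.
move=> ul uC; apply/eqP; rewrite -normr_le0.
have ul' : `|u x| @[x --> \oo] --> `|l| by apply: cvg_norm.
have gl : geometric C (2^-1) x @[x --> \oo] --> (0 : R).
  by apply: cvg_geometric; rewrite ger0_norm// invf_lt1// ltr1n.
apply: (ler_cvg_to ul' gl); apply: nearW => j.
by rewrite /geometric /= exprVn.
Qed.

Lemma closed_ball_sub d (O : set 'rV[R]_d) x : open O -> O x ->
  exists2 r, 0 < r & forall y, `|y - x| <= r -> O y.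
Proof.
move=> oO Ox; have /nbhs_ballP[r /= r0 H] := open_near oO Ox.
exists (r / 2) => [|y yr]; first by rewrite divr_gt0.
apply: H; rewrite -ball_normE /= distrC (le_lt_trans yr)//.
by rewrite ltr_pdivrMr// ltr_pMr// ltr1n.
Qed.

Lemma open_norm_lt d (x : 'rV[R]_d) r : open [set y : 'rV[R]_d | `|y - x| < r].
Proof.
rewrite (_ : [set _ | _] = ball x r); first exact: ball_open.
by rewrite -ball_normE; apply/seteqP; split=> y /=; rewrite distrC.
Qed.

(* The flow at time 1 of the combinations [t *m X] of commuting fields: its
   derivative in [t] is found by comparing the variational Euler polygon with
   [k / N *: (v *m X)]. *)
Lemma flow_box d p (X : 'rV[R]_d -> 'M[R]_(p, d)) (O : set 'rV[R]_d) x0 :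
  open O -> O x0 -> smooth_on O X ->
  (forall x u v, O x ->
     v *m 'D_(u *m X x) X x = u *m 'D_(v *m X x) X x) ->
  exists (r : R) (phi : 'rV[R]_(p + d) -> 'rV[R]_d),
    let W := [set w : 'rV[R]_(p + d) | `|lsubmx w - 0| < r /\ `|rsubmx w - x0| < r] in
    [/\ 0 < r, smooth_on W phi, forall w, W w -> O (phi w),
      forall x, `|x - x0| < r -> phi (row_mx 0 x) = x &
      forall w v, W w -> 'D_(row_mx v 0) phi w = v *m X (phi w)].
Proof.
move=> oO Ox0 sX comm.
have [r0 r00 Hr0] := closed_ball_sub oO Ox0.
pose K0 := [set y : 'rV[R]_d | `|y - x0| <= r0].
have cK0 : compact K0 by exact: compact_closed_ball.
have vK0 : convex_in K0 by exact: convex_closed_ball.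
have [M M0 HM] : exists2 M, 0 < M & forall x, K0 x -> `|X x| <= M.
  apply: compact_norm_bound cK0 _ => x Kx.
  by apply: Ck_continuous (sX 0%N) _; exact: Hr0.
have [L L0 HL] := derive_bound cK0 Hr0 (sX 1%N).
have [T T0 HT] := taylor_bound cK0 vK0 Hr0 (sX 2%N).
have P0 : 0 < p%:R * M + 1 by rewrite ltr_pwDr// mulr_ge0// ltW.
(* For [|t| < r] the field [t *m X] is bounded by [p * r * M <= r0 / 2], the factor [p] coming from
   the norm of a matrix product. A polygon started within [r0 / 2] of [x0] then stays in [K0] up to
   time 1. *)
pose r := Num.min (r0 / 2) (r0 / 2 / (p%:R * M + 1)).
have rr0 : r <= r0 / 2 by rewrite ge_min lexx.
have rM : p%:R * r * M <= r0 / 2.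
  apply: (@le_trans _ _ (r * (p%:R * M + 1))).
    rewrite mulrDr mulr1 mulrA [r * _]mulrC lerDl.
    by rewrite le_min !divr_ge0 ?ltW.
  by rewrite -ler_pdivlMr// ge_min lexx orbT.
have r_gt0 : 0 < r by rewrite lt_min !divr_gt0.
(* The coefficients [t] are constant coordinates of the system, so smoothness jointly in [(t, x)] is
   smoothness in the initial value. *)
pose G (w : 'rV[R]_(p + d)) := row_mx (0 : 'rV[R]_p) (lsubmx w *m X (rsubmx w)).
pose O' := [set w : 'rV[R]_(p + d) | O (rsubmx w)].
have oO' : open O' by exact: open_rsub.
pose W := [set w : 'rV[R]_(p + d) | `|lsubmx w - 0| < r /\ `|rsubmx w - x0| < r].
have oW : open W.
  have -> : W = [set w | [set y : 'rV[R]_p | `|y - 0| < r] (lsubmx w)] `&`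
     [set w | [set y : 'rV[R]_d | `|y - x0| < r] (rsubmx w)] by [].
  by apply: openI; [apply: open_lsub|apply: open_rsub]; exact: open_norm_lt.
have sXr : smooth_on O' (fun w => X (rsubmx w)).
  move=> k; apply: (Ck_comp oO' oO _ _ (sX k)) => //.
  by apply: Ck_rsubmx => //; exact: Ck_id.
have sG : smooth_on O' G.
  move=> k; apply: Ck_row_mx => //; first exact: Ck_cst.
  apply: (Ck_mulmx oO' _ (sXr k)).
  by apply: Ck_lsubmx => //; exact: Ck_id.
have Gl N k w : lsubmx (euler G N k w) = lsubmx w.
  elim: k => [|k IH]; first by rewrite euler0.
  by rewrite eulerS linearD linearZ /= {2}/G row_mxKl scaler0 addr0.
have Gr N k w : rsubmx (euler G N k.+1 w) = rsubmx (euler G N k w) +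
    N%:R^-1 *: (lsubmx w *m X (rsubmx (euler G N k w))).
  by rewrite eulerS linearD linearZ /= {2}/G row_mxKr Gl.
have tX w x : W w -> K0 x -> `|lsubmx w *m X x| <= p%:R * r * M.
  move=> [wr _] Kx; rewrite (le_trans (mx_norm_mulmx _ _))//.
  rewrite ler_pM ?mulr_ge0//; last exact: HM.
  by rewrite ler_wpM2l// -[lsubmx w]subr0 ltW.
have WK w N k : W w -> (0 < N)%N -> (k <= N)%N -> K0 (rsubmx (euler G N k w)).
  move=> Ww N0 kN.
  have N0R : 0 < N%:R :> R by rewrite ltr0n.
  suff H : `|rsubmx (euler G N k w) - rsubmx w| <= k%:R / N%:R * (p%:R * r * M).
    have [_ /ltW w2] := Ww.
    rewrite /K0 /= -(subrK (rsubmx w) (rsubmx (euler _ _ _ _))) -addrA.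
    rewrite (le_trans (ler_normD _ _))// [leRHS]splitr lerD//; last first.
      exact: le_trans w2 rr0.
    apply: le_trans H _; apply: le_trans rM.
    rewrite ler_piMl ?mulr_ge0 ?(ltW r_gt0) ?(ltW M0)//.
    by rewrite ler_pdivrMr// mul1r ler_nat.
  have : (k <= N)%N by []. 
  elim: {-2}k (leqnn k) => [|j IH] jk jN.
    by rewrite euler0 subrr normr0 !mul0r.
  rewrite Gr addrAC (le_trans (ler_normD _ _))// -natr1 mulrDl mulrDl lerD//.
    by apply: IH; exact: ltnW.
  rewrite normrZ ger0_norm ?invr_ge0 ?(ltW N0R)// mul1r ler_wpM2l ?invr_ge0//.
  apply: tX => //.
  have H : `|rsubmx (euler G N j w) - rsubmx w| <= j%:R / N%:R * (p%:R * r * M).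
    by apply: IH; exact: ltnW.
  have [_ /ltW w2] := Ww.
  rewrite /K0 /= -(subrK (rsubmx w) (rsubmx (euler _ _ _ _))) -addrA.
  rewrite (le_trans (ler_normD _ _))// [leRHS]splitr lerD//; last first.
    exact: le_trans w2 rr0.
  apply: le_trans H _; apply: le_trans rM.
  rewrite ler_piMl ?mulr_ge0 ?(ltW r_gt0) ?(ltW M0)//.
  by rewrite ler_pdivrMr// mul1r ler_nat ltnW.
pose K := [set w : 'rV[R]_(p + d) | [set y | `|y - 0| <= r] (lsubmx w) /\ K0 (rsubmx w)].
have cK : compact K.
  by apply: compact_lsub_rsub => //; exact: compact_closed_ball.
have vK : convex_in K.
  by apply: convex_lsub_rsub => //; exact: convex_closed_ball.
have KO : K `<=` O' by move=> w [_]; exact: Hr0.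
have BK w N k : W w -> (0 < N)%N -> (k <= N)%N -> K (euler G N k w).
  move=> Ww N0 kN; split; last exact: WK.
  by rewrite /= Gl; have [/ltW] := Ww.
have cG : confined G O' W.
  move=> w Ww; exists W, K; split => //; exact: open_near.
exists r, (fun w => rsubmx (euler_limit G w)); split => //.
- move=> k; apply: Ck_rsubmx => //.
  exact: (@Ck_euler_limit _ k _ _ O').
- move=> w Ww; have [_ Kw] := euler_limit_mem (sG 1%N) cK vK KO BK Ww.
  exact: Hr0.
- move=> x xr.
  have Ww : W (row_mx 0 x).
    by rewrite /W /= row_mxKl row_mxKr subrr normr0.
  have E N k : euler G N k (row_mx 0 x) = row_mx 0 x.
    elim: k => [|k IH]; first by rewrite euler0.
    rewrite eulerS IH /G row_mxKl mul0mx.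
    by rewrite row_mx0 scaler0 addr0.
  have := euler_cvg (sG 1%N) cK vK KO BK Ww.
  under eq_fun do rewrite E.
  move=> /(cvg_unique (@norm_hausdorff _ _))/(_ (cvg_cst _)) ->.
  by rewrite row_mxKr.
move=> w v Ww.
have [df [dfE [dphi dE]]] := euler_limit_diff oO' (sG 2%N) cG Ww.
rewrite derive_rsub// deriveE// dE dfE.
have cP := confined_prolong oO' (sG 1%N) cG.
have [|B' [K' [B'x cK' vK' KO' BK']]] := cP (row_mx w (row_mx v 0)).
  by rewrite /= row_mxKl.
pose eta N k := rsubmx (rsubmx (euler (prolong G) N k (row_mx w (row_mx v 0)))).
have CP := Ck_prolong oO' (sG 2%N).
have cvg_eta : eta (2 ^ j)%N (2 ^ j)%N @[j --> \oo] -->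
    rsubmx (rsubmx (euler_limit (prolong G) (row_mx w (row_mx v 0)))).
  have := euler_cvg CP cK' vK' KO' BK' (nbhs_singleton B'x) => H.
  apply: continuous_cvg; first exact: rsubmx_continuous.
  by apply: continuous_cvg; [exact: rsubmx_continuous|exact: H].
have cvg_x : rsubmx (euler G (2 ^ j)%N (2 ^ j)%N w) @[j --> \oo] -->
    rsubmx (euler_limit G w).
  apply: continuous_cvg; first exact: rsubmx_continuous.
  exact: (euler_cvg (sG 1%N) cK vK KO BK Ww).
have cvg_vX : v *m X (rsubmx (euler G (2 ^ j)%N (2 ^ j)%N w)) @[j --> \oo] -->
    v *m X (rsubmx (euler_limit G w)).
  apply: (@continuous_cvg _ _ _ _ _ _ (fun x => v *m X x) _ _ cvg_x).
  apply: (@Ck_continuous _ _ _ 0 O).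
    by apply: (Ck_mulmx oO _ (sX 0%N)); exact: Ck_cst.
  by have [_ Kw] := euler_limit_mem (sG 1%N) cK vK KO BK Ww; exact: Hr0.
pose t := lsubmx w.
have dG' w' u : O' w' -> 'D_u G w' =
    row_mx 0 (lsubmx u *m X (rsubmx w') + lsubmx w' *m 'D_(rsubmx u) X (rsubmx w')).
  move=> Ow'.
  have did : differentiable (fun w : 'rV[R]_(p + d) => w) w' by [].
  have dl := differentiable_lsub did; have dr := differentiable_rsub did.
  have dX : differentiable X (rsubmx w') by have [dX _] := sX 1%N; exact: dX.
  have dXr : differentiable (fun w => X (rsubmx w)) w'.
    exact: (@differentiable_comp _ _ _ _ (fun w : 'rV[R]_(p + d) => rsubmx w) X).
  have dM := differentiable_mulmx dl dXr.
  rewrite /G (derive_row_mx u (differentiable_cst (0 : 'rV[R]_p) w') dM).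
  congr row_mx; first exact: derive_cst.
  rewrite (derive_mulmx u dl dXr) (derive_lsub u did) derive_id; congr (_ + _).
  rewrite (@derive_comp _ _ _ _ (fun w : 'rV[R]_(p + d) => rsubmx w) X _ _ dr dX).
  by rewrite (derive_rsub u did) derive_id.
have zl N k : (0 < N)%N -> (k <= N)%N ->
    lsubmx (rsubmx (euler (prolong G) N k (row_mx w (row_mx v 0)))) = v.
  move=> N0; elim: k => [_|k IH kN]; first by rewrite euler0 row_mxKr row_mxKl.
  rewrite euler_prolongrS linearD linearZ /= IH ?(ltnW kN)//.
  rewrite row_mxKl dG'; last by apply: KO; apply: BK => //; exact: ltnW.
  by rewrite row_mxKl scaler0 addr0.
have etaS N k : (0 < N)%N -> (k < N)%N -> let x := rsubmx (euler G N k w) in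
    eta N k.+1 = eta N k + N%:R^-1 *: (v *m X x + t *m 'D_(eta N k) X x).
  move=> N0 kN x; rewrite /eta euler_prolongrS linearD linearZ /=.
  rewrite row_mxKl dG'; last by apply: KO; apply: BK => //; exact: ltnW.
  by rewrite row_mxKr zl ?(ltnW kN)// Gl.
(* The two local errors, each divided by [N ^ 2]: the Taylor remainder of [X] along a step, and the
   term [t *m 'D_(v *m X x) X x]. *)
pose C := p%:R * `|v| * (T * (p%:R * r * M) ^+ 2)
          + p%:R * r * (L * (p%:R * `|v| * M)).
have C0 : 0 <= C.
  by rewrite addr_ge0// !mulr_ge0 ?exprn_ge0 ?mulr_ge0 ?(ltW r_gt0) ?(ltW M0) ?(ltW T0) ?(ltW L0).
have key N : (0 < N)%N ->
    `|eta N N - v *m X (rsubmx (euler G N N w))| <= C * expR (p%:R * r * L) / N%:R.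
  move=> N0; have N0R : 0 < N%:R :> R by rewrite ltr0n.
  pose x k := rsubmx (euler G N k w).
  pose om k := (k%:R / N%:R) *: (v *m X (x k)).
  pose a k := `|eta N k - om k|.
  have Kx k : (k <= N)%N -> K0 (x k) by move=> kN; exact: WK.
  have tD k u : (k <= N)%N -> `|t *m 'D_u X (x k)| <= p%:R * r * L * `|u|.
    move=> kN; rewrite (le_trans (mx_norm_mulmx _ _))// -!mulrA ler_wpM2l//.
    rewrite ler_pM//; last by apply: HL; exact: Kx.
    by rewrite /t -[lsubmx w]subr0; have [/ltW] := Ww.
  have Ha k : (k < N)%N -> a k.+1 <= (1 + (p%:R * r * L) / N%:R) * a k + (C / N%:R) / N%:R.
    move=> kN; have kN' := ltnW kN.
    have dX : differentiable X (x k).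
      by have [dX _] := sX 1%N; exact/dX/Hr0/Kx.
    have xS : x k.+1 = x k + N%:R^-1 *: (t *m X (x k)) by rewrite /x Gr.
    have E : eta N k.+1 - om k.+1 = (eta N k - om k)
      + N%:R^-1 *: (t *m 'D_(eta N k - om k) X (x k))
      - (k.+1%:R / N%:R) *: (v *m (X (x k.+1) - X (x k)
          - 'D_(N%:R^-1 *: (t *m X (x k))) X (x k)))
      - (N%:R^-1 * N%:R^-1) *: (t *m 'D_(v *m X (x k)) X (x k)).
      rewrite etaS// -/(x k).
      have -> : 'D_(eta N k - om k) X (x k) = 'D_(eta N k) X (x k)
          - (k%:R / N%:R) *: 'D_(v *m X (x k)) X (x k).
        by rewrite !deriveE// linearB /= /om linearZ.
      have -> : 'D_(N%:R^-1 *: (t *m X (x k))) X (x k) =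
          N%:R^-1 *: 'D_(t *m X (x k)) X (x k).
        by rewrite !deriveE// linearZ.
      (* Commutation turns the increment of [v *m X] along the polygon into
         [t *m 'D_(v *m X x) X x], which up to order [N ^ -2] is what the variational equation gives
         for [om]. The difference [eta - om] thus obeys a homogeneous recursion up to
         [C / N ^ 2]. *)
      rewrite /om !mulmxBr -!scalemxAr (comm (x k) t v); last exact/Hr0/Kx.
      move: (v *m X (x k.+1)) (v *m X (x k)) (t *m 'D_(eta N k) X _) => A1 A2 A3.
      move: (t *m _) (eta N k) => A4 A5.
      apply/matrixP => i j; rewrite !mxE -natr1; field; rewrite gt_eqF//.
    rewrite /a E (le_trans (ler_normB _ _))//.
    apply: (@le_trans _ _ ((1 + p%:R * r * L / N%:R) * `|eta N k - om k|
      + p%:R * `|v| * (T * (p%:R * r * M) ^+ 2) / N%:R / N%:R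
      + p%:R * r * (L * (p%:R * `|v| * M)) / N%:R / N%:R)); last first.
      by rewrite -addrA lerD2l -!mulrDl.
    rewrite lerD//; last first.
      rewrite normrZ ger0_norm ?mulr_ge0 ?invr_ge0//.
      rewrite -[leRHS]mulrA [leRHS]mulrC ler_wpM2l ?mulr_ge0 ?invr_ge0//.
      rewrite (le_trans (tD _ _ kN'))// -!mulrA !ler_wpM2l ?(ltW r_gt0) ?(ltW L0)//.
      rewrite (le_trans (mx_norm_mulmx _ _))// -!mulrA !ler_wpM2l//.
      exact/HM/Kx.
    rewrite (le_trans (ler_normB _ _))// lerD//.
      rewrite (le_trans (ler_normD _ _))// mulrDl mul1r lerD2l normrZ.
      have -> : p%:R * r * L / N%:R * `|eta N k - om k| =
        N%:R^-1 * (p%:R * r * L * `|eta N k - om k|) by ring.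
      by rewrite ger0_norm ?invr_ge0// ler_wpM2l ?invr_ge0//; exact: tD.
    rewrite normrZ ger0_norm ?divr_ge0//.
    apply: (@le_trans _ _ (1 * (p%:R * `|v| * (T * (N%:R^-1 * (p%:R * r * M)) ^+ 2)))).
      apply: ler_pM => //.
        by rewrite ler_pdivrMr// mul1r ler_nat.
      rewrite (le_trans (mx_norm_mulmx _ _))// ler_wpM2l ?mulr_ge0//.
      rewrite xS; have := HT (x k) (N%:R^-1 *: (t *m X (x k))) (Kx _ kN').
      rewrite -xS => /(_ (Kx _ kN)) H; apply: le_trans H _.
      rewrite ler_wpM2l ?(ltW T0)// lerXn2r ?nnegrE//.
        by rewrite mulr_ge0 ?invr_ge0// !mulr_ge0 ?(ltW r_gt0) ?(ltW M0).
      rewrite normrZ ger0_norm ?invr_ge0// ler_wpM2l ?invr_ge0//.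
      exact: (tX _ _ Ww (Kx _ kN')).
    by apply: le_of_eq; rewrite exprMn; ring.
  have pL0 : 0 <= p%:R * r * L by rewrite !mulr_ge0 ?(ltW r_gt0) ?(ltW L0).
  have := discrete_gronwall N0 pL0 _ _ Ha (leqnn N).
  have a0 : a 0%N = 0.
    by rewrite /a /om /eta euler0 !row_mxKr mul0r scale0r subrr normr0.
  rewrite a0 add0r /a /om divff ?gt_eqF// scale1r => H.
  rewrite mulrAC; apply: H => //; by rewrite divr_ge0.
apply/eqP; rewrite -subr_eq0; apply/eqP.
apply: (cvg_geometric_bound (cvgB cvg_eta cvg_vX)) => j.
by have := key (2 ^ j)%N; rewrite expn_gt0 natrX; exact.
Qed.

End FlowBox.

(** * Closed forms and the inverse function theorem *)

Section Poincare.
Context {R : realType}.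

Lemma open_setI_preimage (T U : topologicalType) (A : set T) (V : set U) (f : T -> U) :
  open A -> (forall x, A x -> {for x, continuous f}) -> open V ->
  open [set x | A x /\ V (f x)].
Proof.
move=> oA cf oV; rewrite openE => x [Ax Vfx]; apply: filterI.
  exact: open_near.
by apply: (cf x Ax); exact: open_near.
Qed.

Lemma smooth_differentiable m (W : normedModType R) (U : set 'rV[R]_m)
    (f : 'rV[R]_m -> W) x : smooth_on U f -> U x -> differentiable f x.
Proof. by move=> /(_ 1%N)[df _]; exact: df. Qed.

(** The rows of [X] are the lifts of the coordinate fields to the product with R^s whose vertical
    part is given by [eta]. Closedness of [eta] is their commutation, and the leaf through [(x0, 0)]
    is the graph of [T]. *)
Lemma poincare m s (eta : 'rV[R]_m -> 'M[R]_(m, s)) (O : set 'rV[R]_m) x0 :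
  open O -> O x0 -> smooth_on O eta ->
  (forall x u v, O x -> v *m 'D_u eta x = u *m 'D_v eta x) ->
  exists (r : R) (T : 'rV[R]_m -> 'rV[R]_s),
    [/\ 0 < r, smooth_on [set x | `|x - x0| < r] T,
      forall x, `|x - x0| < r -> O x, T x0 = 0 &
      forall x u, `|x - x0| < r -> 'D_u T x = u *m eta x].
Proof.
move=> oO Ox0 seta closed_eta.
pose X (z : 'rV[R]_(m + s)) := row_mx (1%:M : 'M[R]_m) (eta (lsubmx z)).
pose O' := [set z : 'rV[R]_(m + s) | O (lsubmx z)].
have oO' : open O' by exact: open_lsub.
have Cid k : Ck k O' (fun z : 'rV[R]_(m + s) => z) by exact: Ck_id.
have seta' : smooth_on O' (fun z : 'rV[R]_(m + s) => eta (lsubmx z)).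
  move=> k; apply: (Ck_comp oO' oO _ _ (seta k)) => //.
  exact: (Ck_lsubmx oO' (Cid k)).
have sX : smooth_on O' X.
  by move=> k; apply: (Ck_row_mx oO' _ (seta' k)); exact: Ck_cst.
have dX z u : O' z -> 'D_u X z = row_mx 0 ('D_(lsubmx u) eta (lsubmx z)).
  move=> Oz.
  have did : differentiable (fun w : 'rV[R]_(m + s) => w) z by [].
  have dl := differentiable_lsub did.
  have de := smooth_differentiable seta Oz.
  rewrite /X (derive_row_mx u (differentiable_cst (1%:M : 'M[R]_m) z)
     (smooth_differentiable seta' Oz)).
  congr row_mx; first exact: derive_cst.
  rewrite (@derive_comp _ _ _ _ (fun w : 'rV[R]_(m + s) => lsubmx w) eta _ _ dl de).
  by rewrite (derive_lsub u did) derive_id.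
have lX u z : lsubmx (u *m X z) = u by rewrite /X mul_mx_row mulmx1 row_mxKl.
have DX (z : 'rV[R]_(m + s)) (u v : 'rV[R]_m) : O' z ->
    v *m 'D_(u *m X z) X z = row_mx 0 (v *m 'D_u eta (lsubmx z)).
  by move=> Oz; rewrite dX// lX mul_mx_row mulmx0.
have [|z u v Oz|r [phi]] := @flow_box R _ _ X O' (row_mx x0 0) oO' _ sX.
- by rewrite /O' /= row_mxKl.
- rewrite (DX z u v Oz) (DX z v u Oz); congr row_mx; exact: closed_eta.
move=> [r0 sphi phiO phi0 Dphi].
set W := [set _ | _] in sphi phiO Dphi.
pose D := [set x : 'rV[R]_m | `|x - x0| < r].
have oD : open D by exact: open_norm_lt.
(* Flow for the time vector [x - x0], starting from [(x0, 0)]: this reaches the point of the leaf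
   above [x]. *)
pose iota x := row_mx (x - x0) (row_mx x0 0) : 'rV[R]_(m + (m + s)).
have iW x : D x -> W (iota x).
  by move=> Dx; rewrite /W /iota /= row_mxKl row_mxKr subr0 subrr normr0.
have oW : open W.
  have -> : W = [set w | [set y : 'rV[R]_m | `|y - 0| < r] (lsubmx w)] `&`
     [set w | [set y : 'rV[R]_(m + s) | `|y - row_mx x0 0| < r] (rsubmx w)] by [].
  by apply: openI; [apply: open_lsub|apply: open_rsub]; exact: open_norm_lt.
have siota : smooth_on D iota.
  move=> k; apply: Ck_row_mx => //; last exact: Ck_cst.
  by apply: Ck_submx => //; [exact: Ck_id|exact: Ck_cst].
pose F x := phi (iota x).
have sF : smooth_on D F.
  by move=> k; exact: (Ck_comp oD oW iW (siota k) (sphi k)).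
have Diota x u : 'D_u iota x = row_mx u 0.
  have d1 : differentiable (fun x : 'rV[R]_m => x - x0) x by [].
  rewrite /iota (derive_row_mx u d1 (differentiable_cst (row_mx x0 0 : 'rV_(m + s)) x)).
  rewrite derive_cst; congr row_mx.
  rewrite deriveB; [|exact: diff_derivable|exact: diff_derivable].
  by rewrite derive_id derive_cst subr0.
have DF x u : D x -> 'D_u F x = row_mx u (u *m eta (lsubmx (F x))).
  move=> Dx; rewrite /F.
  rewrite (@derive_comp _ _ _ _ iota phi _ _ (smooth_differentiable siota Dx)
    (smooth_differentiable sphi (iW _ Dx))).
  by rewrite Diota (Dphi _ _ (iW _ Dx)) /X mul_mx_row mulmx1.
have Fx0 : F x0 = row_mx x0 0.
  by rewrite /F /iota subrr phi0// subrr normr0.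
(* The base component equals [x0] at [x0] and has the identity as derivative; the mean value
   inequality with bound 0 identifies it. *)
have lF x : D x -> lsubmx (F x) = x.
  move=> Dx.
  have := @mean_value_le R _ _ _ (fun x => lsubmx (F x)) x0 (x - x0) (x - x0) 0.
  rewrite Fx0 row_mxKl [x0 + _]addrC subrK => H.
  have /H : forall t : R, 0 <= t <= 1 ->
      differentiable (fun x => lsubmx (F x)) (x0 + t *: (x - x0)) /\
      `|'D_(x - x0) (fun x => lsubmx (F x)) (x0 + t *: (x - x0)) - (x - x0)| <= 0.
    move=> t /andP[t0 t1].
    have Dt : D (x0 + t *: (x - x0)).
      rewrite /D /= [x0 + _]addrC addrK normrZ ger0_norm//.
      by rewrite (le_lt_trans _ Dx)// ler_piMl.
    have dF := smooth_differentiable sF Dt.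
    split; first exact: differentiable_lsub.
    by rewrite (derive_lsub (x - x0) dF) DF// row_mxKl subrr normr0.
  rewrite normr_le0 opprB addrA subrK subr_eq0 => /eqP; exact.
exists r, (fun x => rsubmx (F x)); split => //.
- by move=> k; exact: (Ck_rsubmx oD (sF k)).
- by move=> x Dx; rewrite -(lF x Dx); exact/phiO/iW.
- by rewrite Fx0 row_mxKr.
move=> x u Dx; rewrite (derive_rsub u (smooth_differentiable sF Dx)).
by rewrite DF// row_mxKr lF.
Qed.

End Poincare.

(** * Inverse function theorem *)

Section InverseFunction.
Context {R : realType}.

Lemma jacobian_entry m d (f : 'rV[R]_m -> 'rV[R]_d) x i j :
  differentiable f x -> jacobian f x i j = ('D_(delta_mx 0 i) f x) 0 j.
Proof. by move=> df; rewrite deriveEjacobian// -rowE [RHS]mxE. Qed.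

Lemma Ck_jacobian m d k (U : set 'rV[R]_m) (f : 'rV[R]_m -> 'rV[R]_d) :
  open U -> Ck k.+1 U f -> Ck k U (jacobian f).
Proof.
move=> oU [df Cf]; apply/Ck_mxP => // i j.
apply: (@Ck_ext _ _ _ _ _ _ (fun x => ('D_(delta_mx 0 i) f x) 0 j)) => //.
  by move=> x Ux; rewrite jacobian_entry//; exact: df.
exact: ((Ck_mxP _ _ oU).1 (Cf i)).
Qed.

Lemma inverse_function q d (psi : 'rV[R]_q -> 'rV[R]_d) (B : set 'rV[R]_q) x0
    (J : 'M[R]_(q, d)) (L : 'M[R]_(d, q)) :
  open B -> B x0 -> smooth_on B psi ->
  (forall v, 'D_v psi x0 = v *m J) -> J *m L = 1%:M -> L *m J = 1%:M ->
  exists (U : set 'rV[R]_q) (V : set 'rV[R]_d) (k : 'rV[R]_d -> 'rV[R]_q),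
    [/\ [/\ open U, open V, U x0 & U `<=` B], smooth_on V k,
      (forall x, U x -> V (psi x) /\ k (psi x) = x),
      (forall y, V y -> U (k y) /\ psi (k y) = y) &
      (forall y, V y -> exists J' : 'M[R]_(d, q),
        [/\ jacobian psi (k y) *m J' = 1%:M, J' *m jacobian psi (k y) = 1%:M
          & forall h, 'D_h k y = h *m J'])].
Proof.
move=> oB Bx0 spsi DJ JL LJ.
have [r0 r00 Hr0] := closed_ball_sub oB Bx0.
(* The solutions of [psi x = y] are the fixed points of [x |-> S x + y *m L], and the derivative of
   [S] vanishes at [x0]. *)
pose S x := x - psi x *m L.
have dpsi x : B x -> differentiable psi x := fun Bx => smooth_differentiable spsi Bx.
have sS : smooth_on B S.
  move=> k; apply: Ck_submx => //; first exact: Ck_id.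
  by apply: (Ck_mulmx oB (spsi k)); exact: Ck_cst.
have DS x v : B x -> 'D_v S x = v - 'D_v psi x *m L.
  move=> Bx; have dM : differentiable (fun y => psi y *m L) x.
    by apply: differentiable_mulmx; [exact: dpsi|exact: differentiable_cst].
  rewrite deriveB; [|exact: diff_derivable|exact: diff_derivable].
  by rewrite derive_id (derive_mulmxr _ _ (dpsi _ Bx)).
have [C C0 HC] := derive_lipschitz_bound (@compact_closed_ball R _ x0 r0)
  (@convex_closed_ball _ _ x0 r0) Hr0 (sS 2%N).
(* Since ['D_v S] is [C]-Lipschitz in the point and zero at [x0], this radius makes [S] contract by
   1/2. *)
pose r := Num.min r0 (C^-1 / 2).
have r_gt0 : 0 < r by rewrite lt_min r00 divr_gt0 ?invr_gt0.
have rr0 : r <= r0 by rewrite ge_min lexx.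
have Cr : C * r <= 2^-1.
  rewrite -ler_pdivlMl//; apply: le_trans (_ : C^-1 / 2 <= _) => //.
  by rewrite ge_min lexx orbT.
pose K := [set x : 'rV[R]_q | `|x - x0| <= r].
have K0 x : K x -> `|x - x0| <= r0 by move=> Kx; exact: le_trans rr0.
have KB : K `<=` B by move=> x /K0; exact: Hr0.
have vK : convex_in K by exact: convex_closed_ball.
have cK : compact K by exact: compact_closed_ball.
have Kx0 : K x0 by rewrite /K /= subrr normr0 ltW.
have DSx0 v : 'D_v S x0 = 0 by rewrite DS// DJ -mulmxA JL mulmx1 subrr.
have DS_le x v : K x -> `|'D_v S x| <= 2^-1 * `|v|.
  move=> Kx; have := HC x x0 v (K0 _ Kx) (K0 _ Kx0).
  rewrite DSx0 subr0 => /le_trans; apply; rewrite ler_wpM2r//.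
  by apply: le_trans Cr; rewrite ler_wpM2l ?(ltW C0).
have S_le x y : K x -> K y -> `|S x - S y| <= 2^-1 * `|x - y|.
  move=> Kx Ky.
  have := @mean_value_le R _ _ _ S y (x - y) 0 (2^-1 * `|x - y|).
  rewrite [y + _]addrC subrK subr0; apply => t t01.
  have Kt := vK _ _ _ Ky Kx t01.
  by rewrite subr0; split; [exact: smooth_differentiable (KB _ Kt)|exact: DS_le].
(* The iteration moves the centre by less than [r / 2] and contracts by 1/2, hence preserves the
   ball of radius [r]. *)
pose V := [set y : 'rV[R]_d | `|(y - psi x0) *m L| < r / 2].
have oV : open V.
  have -> : V = [set y | setT y /\
      [set z : 'rV[R]_q | `|z - 0| < r / 2] ((y - psi x0) *m L)].
    by apply/seteqP; split=> y /=; rewrite subr0 => // -[].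
  apply: open_setI_preimage; [exact: openT| |exact: open_norm_lt].
  have oT : open [set: 'rV[R]_d] by exact: openT.
  have C1 : Ck 0 setT (fun y : 'rV[R]_d => y - psi x0).
    exact: (Ck_submx oT (Ck_id 0 oT) (Ck_cst _ _ _)).
  have C2 : Ck 0 setT (fun y : 'rV[R]_d => (y - psi x0) *m L).
    exact: (Ck_mulmx oT C1 (Ck_cst _ _ _)).
  by move=> y Ty; exact: (Ck_continuous C2 Ty).
have solve y : exists x, V y -> `|x - x0| < r /\ psi x = y.
  have [Vy|] := pselect (V y); last by exists x0.
  pose u := fix u j := if j is j'.+1 then S (u j') + y *m L else x0 : 'rV[R]_q.
  have step x : K x -> `|S x + y *m L - x0| < r.
    move=> Kx; have -> : S x + y *m L - x0 = (S x - S x0) + (y - psi x0) *m L.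
      rewrite {3}/S mulmxBl; move: (S x) (y *m L) (psi x0 *m L) => a b c.
      by apply/matrixP => i j; rewrite !mxE; ring.
    rewrite (le_lt_trans (ler_normD _ _))// [ltRHS]splitr ler_ltD//.
    rewrite (le_trans (S_le _ _ Kx Kx0))// mulrC ler_pM2r ?invr_gt0//.
  have Ku j : K (u j) by elim: j => [//|j IH]; apply/ltW/step.
  have [|l Hl] := @geometric_steps_cvg R _ _ u r.
    elim=> [|j IH].
      by rewrite /= expr0 divr1; have /ltW := step _ Kx0.
    have -> : u j.+2 - u j.+1 = S (u j.+1) - S (u j).
      by rewrite /= opprD addrACA subrr addr0.
    rewrite (le_trans (S_le _ _ (Ku _) (Ku _)))//.
    rewrite (le_trans (ler_wpM2l _ IH)) ?invr_ge0//.
    by rewrite exprS invfM mulrCA.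
  have Kl : K l.
    apply: (closed_cvg K _ _ _ Hl); first exact: compact_closed (@norm_hausdorff _ _) cK.
    by apply: nearW.
  have cS : {for l, continuous S} := Ck_continuous (sS 0%N) (KB _ Kl).
  have Hl1 : u j.+1 @[j --> \oo] --> l by have := Hl; rewrite -(cvg_shiftS u).
  have Hl2 : u j.+1 @[j --> \oo] --> S l + y *m L.
    apply: cvgD; last exact: cvg_cst.
    exact: (continuous_cvg _ cS Hl).
  have lE : l = S l + y *m L by exact: (cvg_unique (@norm_hausdorff _ _) Hl1 Hl2).
  exists l => _; split.
    by have := step l Kl; rewrite -lE.
  have E : psi l *m L = y *m L.
    move: lE; rewrite /S; move: (psi l *m L) (y *m L) => a b.
    by move=> /matrixP lE; apply/matrixP => i j; have := lE i j; rewrite !mxE; lra.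
  by rewrite -[LHS]mulmx1 -LJ mulmxA E -mulmxA LJ mulmx1.
have [k Hk] := choice solve.
have inj x x' : K x -> K x' -> `|x - x'| <= 2 * `|(psi x - psi x') *m L|.
  move=> Kx Kx'.
  have -> : (psi x - psi x') *m L = (x - x') - (S x - S x').
    rewrite /S mulmxBl; move: (psi x *m L) (psi x' *m L) => a b.
    by apply/matrixP => i j; rewrite !mxE; ring.
  rewrite -ler_pdivrMl//.
  have := S_le _ _ Kx Kx'.
  have := lerB_dist (x - x') (S x - S x').
  move: `|x - x'| `|S x - S x'| `|_ - (_ - _)| => a b c.
  move=> H1 H2; lra.
pose D := [set x : 'rV[R]_q | `|x - x0| < r].
have oD : open D by exact: open_norm_lt.
have DK : D `<=` K by move=> x /ltW.
have DB : D `<=` B by move=> x /DK/KB.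
pose U := [set x : 'rV[R]_q | D x /\ V (psi x)].
have oU : open U.
  apply: open_setI_preimage => // x Dx.
  exact: Ck_continuous (spsi 0%N) (DB _ Dx).
have kpsi x : U x -> k (psi x) = x.
  move=> [Dx Vx]; have [/ltW Kk E] := Hk _ Vx.
  apply/eqP; rewrite -subr_eq0 -normr_le0.
  by rewrite (le_trans (inj _ _ Kk (DK _ Dx)))// E subrr mul0mx normr0 mulr0.
have kD y : V y -> D (k y) by move=> /Hk[].
have psik y : V y -> psi (k y) = y by move=> /Hk[].
pose S1 x := jacobian psi x *m L.
(* A vector [v] in the kernel satisfies ['D_v S x = v], which the contraction bound [|v| / 2] forces
   to be zero. *)
have S1u x : K x -> S1 x \in unitmx.
  move=> Kx; rewrite -row_free_unit -kermx_eq0; apply/eqP/row_matrixP => i.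
  set v := row i _; rewrite row0.
  have vS : v *m S1 x = 0 by rewrite -row_mul mulmx_ker row0.
  apply/eqP; rewrite -normr_le0.
  have := DS_le x v Kx; rewrite (DS x v (KB _ Kx)).
  rewrite (deriveEjacobian v (dpsi _ (KB _ Kx))) -mulmxA -/(S1 x) vS subr0.
  by move=> H; lra.
pose L1 x := L *m invmx (S1 x).
have JL1 : forall x, K x -> jacobian psi x *m L1 x = 1%:M.
  by move=> x Kx; rewrite mulmxA mulmxV// S1u.
have LJ1 : forall x, K x -> L1 x *m jacobian psi x = 1%:M.
  move=> x Kx; have -> : jacobian psi x = S1 x *m J.
    by rewrite /S1 -mulmxA LJ mulmx1.
  by rewrite /L1 mulmxA mulmxKV// S1u.
have sL1 j : Ck j D L1.
  apply: Ck_mulmx => //; first exact: Ck_cst.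
  apply: Ck_invmx => //; first by move=> x /DK/S1u.
  apply: Ck_mulmx => //; last exact: Ck_cst.
  by apply: Ck_jacobian => //; exact: Ck_sub (spsi _).
have [T T0 HT] := taylor_bound cK vK KB (spsi 2%N).
(* Taylor's formula for [psi] between [k y] and [k (y + h)], multiplied by the inverse Jacobian. By
   [inj] the displacement is [O(|h|)], so the remainder is quadratic in [h]. *)
have dk y : V y -> is_diff y k (fun h => h *m L1 (k y)).
  move=> Vy; pose x := k y; have Kx : K x by exact/DK/kD.
  pose c := 2 * (d%:R * `|L|).
  have c0 : 0 <= c by rewrite /c !mulr_ge0.
  apply: (@is_diff_quadratic R _ _ k (mulmxr (L1 x)) y (d%:R * (T * c ^+ 2) * `|L1 x|)).
    exact: mulmx_continuous.
  have Vn : nbhs (0 : 'rV[R]_d) [set h : 'rV[R]_d | V (y + h)].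
    have /nbhs_ballP[e e0 H] := open_near oV Vy; apply/nbhs_ballP; exists e => // h.
    rewrite -ball_normE /= sub0r normrN => hr; apply: H.
    by rewrite -ball_normE /= opprD addrA subrr sub0r normrN.
  apply: filterS Vn => h /= Vyh; pose x' := k (y + h).
  have Kx' : K x' by exact/DK/kD.
  have hE : psi x' - psi x = h by rewrite /x' /x !psik// [y + h]addrC addrK.
  have xx' : `|x' - x| <= c * `|h|.
    apply: le_trans (inj _ _ Kx' Kx) _; rewrite hE /c -mulrA ler_wpM2l//.
    by apply: le_trans (mx_norm_mulmx _ _) _; apply: le_of_eq; ring.
  have := HT x (x' - x) Kx; rewrite [x + _]addrC subrK => /(_ Kx').
  rewrite hE (deriveEjacobian _ (dpsi _ (KB _ Kx))) => HTx.
  have -> : k (y + h) - k y - h *m L1 x = - ((h - (x' - x) *m jacobian psi x) *m L1 x).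
    by rewrite mulmxBl -mulmxA JL1// mulmx1 opprB.
  rewrite normrN (le_trans (mx_norm_mulmx _ _))//.
  rewrite [leRHS]mulrAC ler_wpM2r// -[leRHS]mulrA ler_wpM2l//.
  apply: le_trans HTx _; rewrite -[leRHS]mulrA ler_wpM2l ?(ltW T0)// -exprMn.
  by rewrite lerXn2r ?nnegrE// mulr_ge0.
have Dk y h : V y -> 'D_h k y = h *m L1 (k y).
  by move=> Vy; have [d1 d2] := dk y Vy; rewrite deriveE// d2.
exists U, V, k; split.
- split => //; last by move=> x [/DB].
  split; first by rewrite /D /= subrr normr0.
  by rewrite /V /= subrr mul0mx normr0 divr_gt0.
(* The derivative of [k] is [L1] composed with [k], so each order of smoothness of [k] yields the
   next. *)
- elim=> [|j IH].
    by move=> y Vy; have [d1 _] := dk y Vy; exact: differentiable_continuous.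
  split; first by move=> y Vy; have [d1 _] := dk y Vy.
  move=> l; apply: (@Ck_ext _ _ _ _ _ _ (fun y => delta_mx 0 l *m L1 (k y))) => //.
    by move=> y Vy; rewrite Dk.
  apply: Ck_mulmx => //; first exact: Ck_cst.
  exact: (Ck_comp oV oD kD IH (sL1 j)).
- by move=> x Ux; split; [case: Ux|exact: kpsi].
- by move=> y Vy; split; [split; [exact: kD|rewrite psik]|exact: psik].
move=> y Vy; exists (L1 (k y)); split; last by move=> h; exact: Dk.
  exact/JL1/DK/kD.
exact/LJ1/DK/kD.
Qed.

End InverseFunction.

(** * Vector fields on charted manifolds *)

Section Bump.
Context {R : realType}.

(* The family [t^-k exp(-1/t)] is stable under differentiation. *)
Definition flat_exp (k : nat) (t : R) : R :=
  if 0 < t then t^-1 ^+ k * expR (- t^-1) else 0.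

(** The exponential at [1 / t] dominates the term of order [k + 2] of its series, whence the
    factorial. The exponent 2 makes the derivative at 0 vanish through [is_diff_quadratic]. *)
Lemma flat_exp_le k : exists2 C, 0 < C & forall t, `|flat_exp k t| <= C * `|t| ^+ 2.
Proof.
exists (k.+2)`!%:R => [|t]; first by rewrite ltr0n fact_gt0.
rewrite /flat_exp; case: ifPn => [t0|_]; last by rewrite normr0 mulr_ge0.
have i0 : 0 < t^-1 by rewrite invr_gt0.
rewrite ger0_norm ?mulr_ge0 ?exprn_ge0 ?expR_ge0 ?(ltW i0)//.
rewrite (gtr0_norm t0) expRN -ler_pdivlMr ?invr_gt0 ?expR_gt0// invrK.
have F0 : 0 < (k.+2)`!%:R :> R by rewrite ltr0n fact_gt0.
apply: (@le_trans _ _ ((k.+2)`!%:R * t ^+ 2 * (t^-1 ^+ k.+2 / (k.+2)`!%:R))).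
  rewrite 2![t^-1 ^+ _.+1]exprS; move: F0 (t^-1 ^+ k).
  move: (_`!%:R) => F F0 a; apply: le_of_eq; field.
  by rewrite !gt_eqF.
rewrite ler_wpM2l ?mulr_ge0 ?exprn_ge0 ?(ltW t0)//.
by apply: le_trans (expR_ge1Dxn k.+1 (ltW i0)); rewrite lerDr.
Qed.

Lemma is_derive_flat_exp k (t : R) :
  is_derive t 1 (flat_exp k) (flat_exp k.+2 t - k%:R * flat_exp k.+1 t).
Proof.
have [t0|t0|<-] := ltgtP 0 t.
- have E : {near t, (fun t => t^-1 ^+ k * expR (- t^-1)) =1 flat_exp k}.
    near=> s; rewrite /flat_exp ifT//.
    by near: s; exact: lt_nbhsr.
  apply: (near_eq_is_derive E).
  have tn0 : t != 0 by rewrite gt_eqF.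
  have d1 : is_derive t 1 (fun t : R => t^-1) (- (t^-1 ^+ 2)).
    apply: is_derive_eq; first exact: (is_deriveV tn0).
    by rewrite exprVn scaleNr /GRing.scale /= mulr1.
  have d2 := is_deriveN d1.
  have d3 := @is_derive1_comp _ expR (fun t : R => - t^-1) t _ _
    (is_derive_expR (- t^-1)) d2.
  have d4 := is_deriveX k d1.
  have d5 := is_deriveM d4 d3.
  rewrite (_ : (fun t : R => t^-1 ^+ k * expR (- t^-1)) =
    ((fun t : R => t^-1) ^+ k) * (expR \o (fun t : R => - t^-1))); last first.
    by apply/funext => s; rewrite !fctE.
  apply: (is_derive_eq d5); rewrite /flat_exp t0 /GRing.scale /= !fctE opprK.
  move: (expR _) => e; clear; case: k => [|k] /=; rewrite !exprS ?expr0; ring.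
- have E : {near t, (fun=> 0) =1 flat_exp k}.
    near=> s; rewrite /flat_exp ifN// -leNgt ltW//.
    by near: s; exact: lt_nbhsl.
  apply: (near_eq_is_derive E).
  by rewrite /flat_exp ltNge (ltW t0) /= mulr0 subr0; exact: is_derive_cst.
have [C C0 HC] := flat_exp_le k.
have dz : is_diff (0 : R) (flat_exp k) (\0 : {linear R -> R}).
  apply: (@is_diff_quadratic _ _ _ _ _ _ C); first exact: cst_continuous.
  near=> h; rewrite /= add0r {2}/flat_exp ltxx !subr0.
  exact: HC.
rewrite {2 3}/flat_exp ltxx mulr0 subr0.
have [d1 d2] := dz.
by apply: DeriveDef; [exact: diff_derivable|rewrite deriveE// d2].
Unshelve. all: by end_near. Qed.

Lemma Ck_flat_exp m k j (U : set 'rV[R]_m) (q : 'rV[R]_m -> R) : open U ->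
  (forall i, Ck i U q) -> Ck j U (fun x => flat_exp k (q x)).
Proof.
move=> oU Cq; elim: j k => [|j IH] k.
  move=> x Ux; apply: continuous_comp; first exact: (Cq 0%N).
  apply: differentiable_continuous; apply/derivable1_diffP.
  by have [] := is_derive_flat_exp k (q x).
have [dq Cdq] := Cq j.+1.
have dx x : U x -> differentiable (flat_exp k) (q x).
  by move=> _; apply/derivable1_diffP; have [] := is_derive_flat_exp k (q x).
split=> [x Ux|l].
  by apply: (@differentiable_comp _ _ _ _ q (flat_exp k)); [exact: dq|exact: dx].
apply: (@Ck_ext _ _ _ _ _ _ (fun x => 'D_(delta_mx 0 l) q x *
   (flat_exp k.+2 (q x) - k%:R * flat_exp k.+1 (q x)))) => //.
  move=> x Ux.
  rewrite (@derive_comp _ _ _ _ q (flat_exp k)); [|exact: dq|exact: dx].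
  have [_ <-] := is_derive_flat_exp k (q x).
  rewrite !deriveE; [|exact: dx|exact: dq|exact: dx].
  by rewrite -[X in 'd _ _ X]mulr1 linearZ.
apply: (Ck_mul oU (Cdq l)); apply: (Ck_sub2 oU (IH _)).
exact: (Ck_mul oU (Ck_cst _ _ _) (IH _)).
Qed.

(** A sum of squares replaces the maximum norm, which is not smooth. The Euclidean ball lies inside
    the ball of the maximum norm, whence [bump_out]. *)
Definition bump m (x0 : 'rV[R]_m) (r : R) (x : 'rV[R]_m) :=
  flat_exp 0 (r ^+ 2 - \sum_l (x 0 l - x0 0 l) ^+ 2).

Lemma Ck_bump m k (U : set 'rV[R]_m) (x0 : 'rV[R]_m) r : open U ->
  Ck k U (bump x0 r).
Proof.
move=> oU; apply: Ck_flat_exp => // i.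
apply: Ck_sub2 => //; first exact: Ck_cst.
apply: Ck_sum => // l; rewrite (_ : (fun _ => _) =
  fun x : 'rV[R]_m => (x 0 l - x0 0 l) * (x 0 l - x0 0 l)); last first.
  by apply/funext => x; rewrite expr2.
have C1 : Ck i U (fun x : 'rV[R]_m => x 0 l - x0 0 l).
  by apply: Ck_sub2 => //; [exact: Ck_coord|exact: Ck_cst].
exact: Ck_mul.
Qed.

Lemma bump_center m (x0 : 'rV[R]_m) r : 0 < r -> bump x0 r x0 != 0.
Proof.
move=> r0; rewrite /bump big1 => [|l _]; last by rewrite subrr expr0n.
rewrite subr0 /flat_exp exprn_gt0// expr0 mul1r gt_eqF// expR_gt0//.
Qed.

Lemma bump_out m (x0 : 'rV[R]_m) r x : 0 < r -> ~ `|x - x0| <= r -> bump x0 r x = 0.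
Proof.
move=> r0 xr; rewrite /bump /flat_exp ifN// -leNgt subr_le0.
have [l Hl] : exists l, r < `|x 0 l - x0 0 l|.
  apply: contrapT => H; apply: xr; apply/mx_norm_leP; first exact: ltW.
  move=> i l; rewrite ord1 leNgt; apply/negP => H'; apply: H; exists l.
  by rewrite !mxE in H'.
rewrite (bigD1 l)//= (@le_trans _ _ ((x 0 l - x0 0 l) ^+ 2))//.
  by rewrite -[leRHS]real_normK ?num_real// lerXn2r ?nnegrE// ltW.
by rewrite lerDl sumr_ge0// => i _; exact: sqr_ge0.
Qed.

End Bump.

(** * Overlaps, and extension of a tangent vector to a global field *)

Section ManifoldFacts.
Context {R : realType} {m : nat} (M : charted R m) (hM : is_manifold M).
Implicit Types i j : index M.

Lemma chart_imageP i x : chart_image i x ->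
  dom i (param i x) /\ coord i (param i x) = x.
Proof. by move=> [p ip <-]; rewrite (manifold_coordK hM). Qed.

Lemma overlapE i j :
  overlap i j = [set x | chart_image i x /\ dom j (param i x)].
Proof.
apply/seteqP; split=> x /=.
  by move=> [p [ip jp] <-]; rewrite (manifold_coordK hM)//; split=> //; exists p.
move=> [ix jx]; have [ip E] := chart_imageP ix.
by exists (param i x).
Qed.

Lemma open_overlap i j : open (overlap i j).
Proof.
rewrite overlapE; apply: open_setI_preimage.
- exact: manifold_image_open.
- by move=> x; exact: manifold_param_continuous.
- exact: manifold_dom_open.
Qed.

Lemma overlap_transition i j x : overlap i j x -> overlap j i (transition i j x).
Proof.
by move=> [p [ip jp] <-]; rewrite /transition /= (manifold_coordK hM)//; exists p.
Qed.

Lemma transition_comp i a b x : overlap i a x -> overlap i b x ->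
  {near x, transition a b \o transition i a =1 transition i b}.
Proof.
move=> oa ob; near=> y.
have /= : overlap i a y by near: y; exact: (open_near (@open_overlap i a) oa).
have : overlap i b y by near: y; exact: (open_near (@open_overlap i b) ob).
rewrite !overlapE /transition /= => -[iy bp] [_ ap].
by rewrite (manifold_coordK hM).
Unshelve. all: by end_near. Qed.

Lemma differentiable_transition i j x : overlap i j x ->
  differentiable (transition i j) x.
Proof. by apply: smooth_differentiable; exact: manifold_transition_smooth. Qed.

Lemma derive_transition_comp i a b x v : overlap i a x -> overlap i b x ->
  'D_('D_v (transition i a) x) (transition a b) (transition i a x) =
  'D_v (transition i b) x.
Proof.
move=> oa ob; have da := differentiable_transition oa.
have db : differentiable (transition a b) (transition i a x).
  apply: differentiable_transition; move: oa ob; rewrite !overlapE.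
  rewrite /transition /= => -[ix ap] [_ bp].
  by rewrite (manifold_coordK hM)//; split=> //; exists (param i x).
rewrite -(derive_comp _ da db); apply: near_eq_derive.
exact: transition_comp.
Qed.

Lemma derive_transition_id i x v : chart_image i x ->
  'D_v (transition i i) x = v.
Proof.
move=> ix; rewrite -[RHS](derive_id x); apply: near_eq_derive; near=> y.
suff /chart_imageP[_] : chart_image i y by [].
by near: y; exact: (open_near (@manifold_image_open _ _ _ hM i) ix).
Unshelve. all: by end_near. Qed.

(** Allows conditions stated for all global fields to be tested at one tangent vector. The constant
    field [u] of the chart is cut off by a bump function normalised to 1 at [x], and extended by 0
    outside [dom i]. *)
Lemma vector_field_through i x (u : 'rV[R]_m) : chart_image i x ->
  exists X : field M 'rV[R]_m, is_vector_field X /\ X i x = u.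
Proof.
move=> ix; have [r r0 Hr] := closed_ball_sub (@manifold_image_open _ _ _ hM i) ix.
have rho0 := bump_center x r0.
pose w z := bump x r z *: ((bump x r x)^-1 *: u).
pose X : field M 'rV[R]_m := fun j y => if `[< dom i (param j y) >] then
  'D_(w (coord i (param j y))) (transition i j) (coord i (param j y)) else 0.
have XE j y p : dom j p -> dom i p -> coord j p = y ->
    X j y = 'D_(w (coord i p)) (transition i j) (coord i p).
  by move=> jp ip <-; rewrite /X (manifold_coordK hM)// ifT//; exact/asboolP.
have XN j y p : dom j p -> ~ dom i p -> coord j p = y -> X j y = 0.
  by move=> jp nip <-; rewrite /X (manifold_coordK hM)// asboolF.
exists X; split; last first.
  have [ip xE] := chart_imageP ix.
  rewrite (XE _ _ _ ip ip xE) xE derive_transition_id// /w scalerA divff//.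
  by rewrite scale1r.
split=> [j k|a b y oy]; last first.
  have [p [ap bp] yE] := oy.
  have tE : transition a b y = coord b p.
    by rewrite -yE /transition /= (manifold_coordK hM).
  have [ip|nip] := pselect (dom i p); last first.
    by rewrite (XN _ _ _ bp nip (esym tE)) (XN _ _ _ ap nip yE) linear0.
  have oia : overlap i a (coord i p) by exists p.
  have oib : overlap i b (coord i p) by exists p.
  rewrite (XE _ _ _ bp ip (esym tE)) (XE _ _ _ ap ip yE) -deriveE; last first.
    exact: differentiable_transition.
  have tiE : transition i a (coord i p) = y.
    by rewrite -yE /transition /= (manifold_coordK hM).
  have := derive_transition_comp (w (coord i p)) oia oib.
  by rewrite tiE => <-.
(* [K] is compact, hence closed because the manifold is Hausdorff. A point outside [dom i] then has
   the complement of [K] as a neighbourhood, and the field vanishes there. *)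
pose K := param i @` [set z | `|z - x| <= r].
have cK : closed K.
  apply: compact_closed; first exact: manifold_hausdorff.
  apply: continuous_compact; last exact: compact_closed_ball.
  apply: continuous_in_subspaceT => z; rewrite inE => /Hr iz.
  exact: manifold_param_continuous.
apply: (@Ck_local _ _ _ _ _ _ (X j)) => y jy.
have [jp yE] := chart_imageP jy.
have [ip|nip] := pselect (dom i (param j y)).
  exists (overlap j i); split=> //; first exact: open_overlap.
    by rewrite overlapE.
  have oji := @open_overlap j i; have oij := @open_overlap i j.
  apply: (@Ck_ext _ _ _ _ _ _
    ((fun z => 'D_(w z) (transition i j) z) \o transition j i)) => //.
    move=> z; rewrite overlapE => -[jz iz].
    by have [jp' zE] := chart_imageP jz; rewrite (XE _ _ _ jp' iz zE).
  apply: (Ck_comp (V := overlap i j) oji oij).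
  - exact: overlap_transition.
  - exact: manifold_transition_smooth.
  apply: Ck_derive => //; first exact: manifold_transition_smooth.
  by apply: Ck_scalemx => //; [exact: Ck_bump|exact: Ck_cst].
exists [set z | chart_image j z /\ (~` K) (param j z)]; split.
- apply: open_setI_preimage.
  + exact: manifold_image_open.
  + by move=> z; exact: manifold_param_continuous.
  + exact: closed_openC.
- split=> // -[z zr zE]; apply: nip; rewrite -zE.
  by have [] := chart_imageP (Hr _ zr).
- by [].
apply: (@Ck_ext _ _ _ _ _ _ (fun=> 0)); last exact: Ck_cst.
  apply: open_setI_preimage.
  + exact: manifold_image_open.
  + by move=> z; exact: manifold_param_continuous.
  + exact: closed_openC.
move=> z [jz Kz]; rewrite /X; case: ifPn => // /asboolP iz.
suff -> : w (coord i (param j z)) = 0 by rewrite derive0.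
rewrite /w bump_out ?scale0r// => zr; apply: Kz.
by exists (coord i (param j z)) => //; rewrite (manifold_coordK hM).
Qed.

End ManifoldFacts.

(** * Parallel frames in a chart *)

Section Inner.
Context {R : realType} {m : nat}.
Implicit Types (A B : 'M[R]_m) (u v w : 'rV[R]_m).

Lemma innerDl A u v w : inner A (u + v) w = inner A u w + inner A v w.
Proof. by rewrite /inner !mulmxDl mxE. Qed.

Lemma innerDr A u v w : inner A u (v + w) = inner A u v + inner A u w.
Proof. by rewrite /inner linearD mulmxDr mxE. Qed.

Lemma innerNl A u w : inner A (- u) w = - inner A u w.
Proof. by rewrite /inner !mulNmx mxE. Qed.

Lemma innerNr A u w : inner A u (- w) = - inner A u w.
Proof. by rewrite /inner linearN mulmxN mxE. Qed.

Lemma innerBl A u v w : inner A (u - v) w = inner A u w - inner A v w.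
Proof. by rewrite innerDl innerNl. Qed.

Lemma inner0l A w : inner A 0 w = 0.
Proof. by rewrite /inner !mul0mx mxE. Qed.

Lemma inner0r A w : inner A w 0 = 0.
Proof. by rewrite /inner trmx0 mulmx0 mxE. Qed.

Lemma innerD A B u v : inner (A + B) u v = inner A u v + inner B u v.
Proof. by rewrite /inner mulmxDr mulmxDl mxE. Qed.

Lemma inner_nondeg A u v : A \in unitmx ->
  (forall w, inner A u w = inner A v w) -> u = v.
Proof.
move=> Au H; apply: (can_inj (mulmxK Au)); apply/rowP => l.
have := H (delta_mx 0 l); rewrite /inner trmx_delta -!colE.
by rewrite [in LHS]mxE [in RHS]mxE.
Qed.

Lemma inner_mx_inj A B : (forall u v, inner A u v = inner B u v) -> A = B.
Proof.
move=> H; apply/matrixP => i j; have := H (delta_mx 0 i) (delta_mx 0 j).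
by rewrite /inner trmx_delta -!rowE -!colE !mxE.
Qed.

Lemma derive_inner (V : normedModType R) (G : V -> 'M[R]_m)
    (Y Z : V -> 'rV[R]_m) (x w : V) :
  differentiable G x -> differentiable Y x -> differentiable Z x ->
  'D_w (fun y => inner (G y) (Y y) (Z y)) x =
  inner ('D_w G x) (Y x) (Z x) + inner (G x) ('D_w Y x) (Z x)
     + inner (G x) (Y x) ('D_w Z x).
Proof.
move=> dG dY dZ.
have dZt := differentiable_trmx dZ; have dYG := differentiable_mulmx dY dG.
have dM := differentiable_mulmx dYG dZt.
transitivity (('D_w (fun y => Y y *m G y *m (Z y)^T) x) 0 0).
  by rewrite derive_mx ?mxE//; exact: diff_derivable.
rewrite (derive_mulmx w dYG dZt) (derive_mulmx w dY dG) (derive_trmx w dZ).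
by rewrite mulmxDl /inner mxE [X in X + _ = _]mxE; congr (_ + _); exact: addrC.
Qed.

End Inner.

(** * Christoffel symbols and Lie derivatives along parallel fields *)

Section Christoffel.
Context {R : realType} {m : nat}.
Variables (O : set 'rV[R]_m) (G : 'rV[R]_m -> 'M[R]_m).
Hypotheses (oO : open O) (sG : smooth_on O G).
Hypothesis Gsym : forall x, O x -> (G x)^T = G x.
Hypothesis Gpos : forall x v, O x -> v != 0 -> 0 < inner (G x) v v.
Implicit Types (x u v w : 'rV[R]_m).

Lemma metric_unit x : O x -> G x \in unitmx.
Proof. by move=> Ox; apply: posdef_unitmx => v; exact: Gpos. Qed.

Lemma derive_metric_sym x u v w : O x ->
  inner ('D_w G x) u v = inner ('D_w G x) v u.
Proof.
move=> Ox; apply: inner_sym; have dG := smooth_differentiable sG Ox.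
rewrite -(derive_trmx w dG); apply: near_eq_derive; near=> y.
by apply: Gsym; near: y; exact: (open_near oO Ox).
Unshelve. all: by end_near. Qed.

Lemma christoffel_koszul x u v w : O x ->
  inner (G x) (christoffel G x u v) w =
  2^-1 * (inner ('D_u G x) v w + inner ('D_v G x) u w - inner ('D_w G x) u v).
Proof.
move=> Ox; apply: inner_christoffel; first exact: metric_unit.
exact: smooth_differentiable sG Ox.
Qed.

Lemma christoffel_sym x u v : O x -> christoffel G x u v = christoffel G x v u.
Proof.
move=> Ox; apply: (inner_nondeg (metric_unit Ox)) => w.
have := derive_metric_sym v u w Ox.
have := christoffel_koszul u v w Ox; have := christoffel_koszul v u w Ox.
generalize (christoffel G x u v) (christoffel G x v u).
generalize ('D_u G x) ('D_v G x) ('D_w G x) => A B C c c' -> -> ->; lra.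
Qed.

(* [nabla g = 0] at the level of Christoffel symbols. *)
Lemma christoffel_metric x u v w : O x -> inner ('D_u G x) v w =
  inner (G x) (christoffel G x u v) w + inner (G x) v (christoffel G x u w).
Proof.
move=> Ox; have E := derive_metric_sym w v u Ox.
have K1 := christoffel_koszul u v w Ox; have K2 := christoffel_koszul u w v Ox.
have S := inner_sym v (christoffel G x u w) (Gsym Ox).
move: E K1 K2 S; generalize ('D_u G x) ('D_v G x) ('D_w G x).
generalize (christoffel G x u v) (christoffel G x u w) => c c' A B C.
by move=> E -> K2 ->; rewrite K2 E; lra.
Qed.

(** The coordinate expression of [(nabla_u F) v] with [v] extended as a constant; derivatives of any
    other extension cancel, see [nabla_endoE]. *)
Definition endo_nabla (F : 'rV[R]_m -> 'M[R]_m) x u v :=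
  v *m 'D_u F x + christoffel G x u (v *m F x) - christoffel G x u v *m F x.

Variables (s : nat) (Xi : 'rV[R]_m -> 'M[R]_(s, m)).
Hypothesis sXi : smooth_on O Xi.
Hypothesis par : forall x u c, O x ->
  c *m 'D_u Xi x = - christoffel G x u (c *m Xi x).

(** Its columns are the 1-forms metrically dual to the rows of [Xi]. *)
Definition coframe x := G x *m (Xi x)^T.

Lemma smooth_coframe : smooth_on O coframe.
Proof. by move=> k; apply: (Ck_mulmx oO (sG k)); exact: (Ck_trmx oO (sXi k)). Qed.

Lemma coframeE x (c : 'rV[R]_s) v : inner (G x) v (c *m Xi x) =
  (v *m coframe x *m c^T) 0 0.
Proof. by rewrite /inner trmx_mul !mulmxA. Qed.

Lemma derive_coframe x u v : O x ->
  v *m 'D_u coframe x = christoffel G x u v *m coframe x.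
Proof.
move=> Ox; have dG := smooth_differentiable sG Ox.
have dXi := smooth_differentiable sXi Ox.
have H (c : 'rV[R]_s) : v *m 'D_u coframe x *m c^T =
    christoffel G x u v *m coframe x *m c^T.
  rewrite (derive_mulmx u dG (differentiable_trmx dXi)) (derive_trmx u dXi).
  have L : (v *m ('D_u G x *m (Xi x)^T + G x *m ('D_u Xi x)^T) *m c^T) 0 0 =
      inner ('D_u G x) v (c *m Xi x) + inner (G x) v (c *m 'D_u Xi x).
    by rewrite mulmxDr mulmxDl [LHS]mxE /inner !trmx_mul !mulmxA.
  apply/matrixP => i j; rewrite !ord1 -coframeE L.
  have := christoffel_metric u v (c *m Xi x) Ox; rewrite (par u c Ox) innerNr => ->.
  exact: addrK.
apply/rowP => l; have := H (delta_mx 0 l); rewrite trmx_delta -!colE.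
by move=> /matrixP/(_ 0 0); rewrite [LHS]mxE [RHS]mxE.
Qed.

Lemma coframe_closed x u v : O x ->
  v *m 'D_u coframe x = u *m 'D_v coframe x.
Proof.
move=> Ox; rewrite (derive_coframe u v Ox) (derive_coframe v u Ox).
by rewrite (christoffel_sym u v Ox).
Qed.

Lemma frame_commute x (b c : 'rV[R]_s) : O x ->
  c *m 'D_(b *m Xi x) Xi x = b *m 'D_(c *m Xi x) Xi x.
Proof.
move=> Ox; rewrite (par (b *m Xi x) c Ox) (par (c *m Xi x) b Ox).
by congr (- _); exact: christoffel_sym.
Qed.

(** The Lie derivative of the bilinear form [S] vanishes along every combination of the rows of [Xi]
    with constant coefficients. *)
Definition lie_invariant (S : 'rV[R]_m -> 'M[R]_m) :=
  forall x (c : 'rV[R]_s) u v, O x -> inner ('D_(c *m Xi x) S x) u v +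
    inner (S x) (c *m 'D_u Xi x) v + inner (S x) u (c *m 'D_v Xi x) = 0.

Lemma lie_metric : lie_invariant G.
Proof.
move=> x c u v Ox; rewrite (par u c Ox) (par v c Ox) innerNl innerNr.
rewrite (christoffel_metric (c *m Xi x) u v Ox) -addrA.
rewrite (christoffel_sym (c *m Xi x) u Ox) (christoffel_sym (c *m Xi x) v Ox).
by rewrite -opprD subrr.
Qed.

Variable F : 'rV[R]_m -> 'M[R]_m.
Hypothesis sF : smooth_on O F.
Hypothesis XiF : forall x, O x -> Xi x *m F x = 0.
Hypothesis nearly : forall x u v, O x ->
  endo_nabla F x u v + endo_nabla F x v u = 0.

Lemma lie_endo x (c : 'rV[R]_s) v : O x ->
  v *m 'D_(c *m Xi x) F x - c *m 'D_(v *m F x) Xi x + c *m 'D_v Xi x *m F x = 0.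
Proof.
move=> Ox; have := nearly (c *m Xi x) v Ox; rewrite /endo_nabla.
have dF := smooth_differentiable sF Ox.
have dXi := smooth_differentiable sXi Ox.
(* Differentiate [Xi *m F = 0]. This makes [(nabla_v F)] vanish on the frame, so the nearly parallel
   condition leaves [nabla] of [F] along the frame, rewritten below as a Lie derivative. *)
have E : c *m Xi x *m 'D_v F x = - (c *m 'D_v Xi x) *m F x.
  have : 'D_v (fun y => Xi y *m F y) x = 0.
    rewrite -[RHS](derive_cst (0 : 'M[R]_(s, m)) x v); apply: near_eq_derive.
    by near=> y; apply: XiF; near: y; exact: (open_near oO Ox).
  rewrite (derive_mulmx v dXi dF) addrC => /eqP; rewrite addr_eq0 => /eqP E.
  by rewrite -mulmxA E mulmxN mulmxA mulNmx.
rewrite E -[c *m Xi x *m F x]mulmxA XiF// mulmx0.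
have -> : christoffel G x v 0 = 0.
  have := par v 0 Ox; rewrite !mul0mx => /eqP; rewrite eq_sym oppr_eq0.
  by move/eqP.
rewrite (christoffel_sym (c *m Xi x) (v *m F x) Ox) (christoffel_sym (c *m Xi x) v Ox).
have -> : christoffel G x (v *m F x) (c *m Xi x) = - (c *m 'D_(v *m F x) Xi x).
  by rewrite (par _ c Ox) opprK.
have -> : christoffel G x v (c *m Xi x) = - (c *m 'D_v Xi x).
  by rewrite (par v c Ox) opprK.
rewrite mulNmx addr0 subrr addr0 opprK.
move: (v *m _) (c *m 'D_(v *m F x) Xi x) (c *m 'D_v Xi x *m F x) => a b d.
by move=> /matrixP H; apply/matrixP => i j; have := H i j; rewrite !mxE; lra.
Unshelve. all: by end_near. Qed.

(** The product rule combines the invariance of [F] and of [G]. The form [g (F u, v)] replaces [F]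
    because it pulls back without inverting a Jacobian. *)
Lemma lie_form : lie_invariant (fun x => F x *m G x).
Proof.
move=> x c u v Ox; have dF := smooth_differentiable sF Ox.
have dG := smooth_differentiable sG Ox.
rewrite (derive_mulmx _ dF dG).
have iF S T (a b : 'rV[R]_m) : inner (S *m T) a b = inner T (a *m S) b.
  by rewrite /inner !mulmxA.
rewrite innerD !iF; have := lie_metric c (u *m F x) v Ox.
have := lie_endo c u Ox; move/(congr1 (fun a => inner (G x) a v)).
rewrite innerDl innerBl inner0l; lra.
Qed.

End Christoffel.

(** * Charts adapted to commuting fields and closed dual forms *)

Section AdaptedChart.
Context {R : realType}.

(** The adapted chart puts the Euclidean coordinates first, in dimension [s + q], whereas the
    manifold has dimension [2 * n + s]. These numbers are equal but not convertible, so Jacobians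
    stay rectangular and carry two-sided inverses. *)
Lemma mulmx1C_eq p m (J : 'M[R]_(p, m)) (L : 'M[R]_(m, p)) : p = m ->
  J *m L = 1%:M -> L *m J = 1%:M.
Proof. by move=> e; subst p; exact: mulmx1C. Qed.

(** The rows of [A] form a basis of the kernel of [E], which meets the span of [Xi] trivially
    because [Xi *m E = 1]. *)
Lemma complement_frame m s q (Xi : 'M[R]_(s, m)) (E : 'M[R]_(m, s)) :
  (s + q)%N = m -> Xi *m E = 1%:M ->
  exists A : 'M[R]_(q, m), A *m E = 0 /\ exists L : 'M[R]_(m, s + q),
    col_mx Xi A *m L = 1%:M /\ L *m col_mx Xi A = 1%:M.
Proof.
move=> e XE.
have rE : \rank E = s.
  apply/eqP; rewrite eqn_leq rank_leq_col /=.
  by have := mxrankM_maxr Xi E; rewrite XE mxrank1.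
have rK : \rank (kermx E) = q by rewrite mxrank_ker rE -e addKn.
pose A := castmx (rK, erefl m) (row_base (kermx E)).
have AE : A *m E = 0.
  rewrite /A; case: q / rK {e A}; rewrite castmx_id.
  by apply/sub_kermxP; rewrite eq_row_base.
have fA : row_free A.
  rewrite /A; case: q / rK {e A AE}; rewrite castmx_id.
  exact: row_base_free.
exists A; split=> //.
have fJ : row_free (col_mx Xi A).
  rewrite -kermx_eq0; apply/eqP/row_matrixP => i; rewrite row0.
  have := mulmx_ker (col_mx Xi A) => /(congr1 (row i)).
  rewrite row_mul row0; move: (row i _) => v.
  rewrite -[v]hsubmxK mul_row_col => H.
  have l0 : lsubmx v = 0.
    have := congr1 (mulmx^~ E) H.
    by rewrite /= mulmxDl -!mulmxA XE AE mulmx0 addr0 mulmx1 mul0mx.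
  have /row_freeP[A' AA'] := fA.
  have := congr1 (mulmx^~ A') H.
  by rewrite /= l0 mul0mx add0r -mulmxA AA' mulmx1 mul0mx => ->; rewrite row_mx0.
have /row_freeP[L JL] := fJ.
by exists L; split=> //; exact: mulmx1C_eq.
Qed.

Lemma norm_lsub_rsub_lt p q (z : 'rV[R]_(p + q)) r :
  (`|z| < r) <-> (`|lsubmx z| < r /\ `|rsubmx z| < r).
Proof.
split=> [zr|[lr rr]].
  by split; apply: le_lt_trans zr; [exact: norm_lsubmx_le|exact: norm_rsubmx_le].
apply: (@le_lt_trans _ _ (Num.max `|lsubmx z| `|rsubmx z|)).
  rewrite -[z in leLHS]hsubmxK.
  by apply: norm_row_mx_le; rewrite le_max lexx ?orbT.
by rewrite gt_max lr.
Qed.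

(** The affine slice [x0 + y *m A0] is transverse to the fields, but [T] need not be constant on it.
    Flowing from its points for the time [t - T] corrects this, so that [T] becomes the first
    coordinate; differentiating this identity shows that [E] kills the slice directions. *)
Lemma adapted_chart m s q (O : set 'rV[R]_m) x0
    (Xi : 'rV[R]_m -> 'M[R]_(s, m)) (E : 'rV[R]_m -> 'M[R]_(m, s)) :
  (s + q)%N = m -> open O -> O x0 -> smooth_on O Xi -> smooth_on O E ->
  (forall x, O x -> Xi x *m E x = 1%:M) ->
  (forall x u v, O x -> v *m 'D_u E x = u *m 'D_v E x) ->
  (forall x (b c : 'rV[R]_s), O x ->
     c *m 'D_(b *m Xi x) Xi x = b *m 'D_(c *m Xi x) Xi x) ->
  exists (r : R) (V : set 'rV[R]_m) (psi : 'rV[R]_(s + q) -> 'rV[R]_m)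
      (kap : 'rV[R]_m -> 'rV[R]_(s + q)),
    let B := [set z : 'rV[R]_(s + q) | `|z| < r] in
    [/\ [/\ 0 < r, open V, V `<=` O & V x0],
      smooth_on B psi /\ smooth_on V kap,
      (forall z, B z -> V (psi z) /\ kap (psi z) = z) /\
      (forall y, V y -> B (kap y) /\ psi (kap y) = y),
      (forall y, V y -> exists J' : 'M[R]_(m, s + q),
        [/\ jacobian psi (kap y) *m J' = 1%:M, J' *m jacobian psi (kap y) = 1%:M
          & forall h, 'D_h kap y = h *m J']) &
      forall z, B z -> usubmx (jacobian psi z) = Xi (psi z) /\
        dsubmx (jacobian psi z) *m E (psi z) = 0].
Proof.
move=> e oO Ox0 sXi sE XE closedE comm.
have [r1 [T [r1_gt0 sT ballO T0 DT]]] := poincare oO Ox0 sE closedE.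
have [r2 [phi [r2_gt0 sphi phiO phi0 Dphi]]] := flow_box oO Ox0 sXi comm.
set W := [set _ | _] in sphi phiO Dphi.
have [A0 [A0E [L [JL LJ]]]] := complement_frame e (XE x0 Ox0).
pose D1 := [set x : 'rV[R]_m | `|x - x0| < r1].
have oD1 : open D1 by exact: open_norm_lt.
have oW : open W.
  have -> : W = [set w | [set y : 'rV[R]_s | `|y - 0| < r2] (lsubmx w)] `&`
     [set w | [set y : 'rV[R]_m | `|y - x0| < r2] (rsubmx w)] by [].
  by apply: openI; [apply: open_lsub|apply: open_rsub]; exact: open_norm_lt.
pose w0 := row_mx 0 x0 : 'rV[R]_(s + m).
pose W1 := [set w | W w /\ D1 (phi w)].
have oW1 : open W1.
  apply: open_setI_preimage => // w Ww.
  exact: Ck_continuous (sphi 0%N) Ww.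
have W1w0 : W1 w0.
  by split; rewrite /W /w0 /D1 /= ?row_mxKl ?row_mxKr ?phi0 ?subrr ?normr0.
have [rho rho0 Hrho] := closed_ball_sub oW1 W1w0.
(* Along the flow [T] has derivative [t *m Xi *m E = t]; the mean value inequality with bound 0
   integrates this exactly. *)
have Tphi t x : `|row_mx t x - w0| <= rho -> T (phi (row_mx t x)) = T x + t.
  move=> tx; have W1s (a : R) : 0 <= a <= 1 -> W1 (row_mx (a *: t) x).
    move=> /andP[a0 a1]; apply: Hrho; move: tx.
    rewrite /w0 !opp_row_mx !add_row_mx !subr0 => /(le_trans _); apply.
    apply: norm_row_mx_le.
      rewrite normrZ ger0_norm//; apply: le_trans (_ : `|t| <= _).
        by rewrite ler_piMl.
      by have := norm_lsubmx_le (row_mx t (x - x0)); rewrite row_mxKl.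
    by have := norm_rsubmx_le (row_mx t (x - x0)); rewrite row_mxKr.
  have := @mean_value_le R _ _ _ (T \o phi) (row_mx 0 x) (row_mx t 0) t 0.
  rewrite add_row_mx add0r addr0 /= => H.
  have /H : forall a : R, 0 <= a <= 1 ->
      differentiable (T \o phi) (row_mx 0 x + a *: row_mx t 0) /\
      `|'D_(row_mx t 0) (T \o phi) (row_mx 0 x + a *: row_mx t 0) - t| <= 0.
    move=> a a01; rewrite scale_row_mx scaler0 add_row_mx add0r addr0.
    have [Ww D1w] := W1s a a01.
    have dphi := smooth_differentiable sphi Ww.
    have dT := smooth_differentiable sT D1w.
    split; first exact: differentiable_comp.
    rewrite derive_comp// (Dphi _ _ Ww) (DT _ _ D1w) -mulmxA XE; last exact: phiO.
    by rewrite mulmx1 subrr normr0.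
  rewrite normr_le0 => /eqP/subr0_eq.
  have [[_ xr2] _] := W1s 0 ltac:(by rewrite lexx ler01).
  rewrite row_mxKr in xr2; rewrite phi0// => /eqP; rewrite subr_eq => /eqP ->.
  by rewrite addrC.
pose pt (z : 'rV[R]_(s + q)) := x0 + rsubmx z *m A0.
pose B1 := [set z : 'rV[R]_(s + q) | D1 (pt z)].
have sid k (U : set 'rV[R]_(s + q)) : open U -> Ck k U (fun z => z).
  exact: Ck_id.
have spt k U : open U -> Ck k U pt.
  move=> oU; apply: (Ck_addmx oU (Ck_cst _ _ _)).
  exact: (Ck_mulmx oU (Ck_rsubmx oU (sid k U oU)) (Ck_cst _ _ _)).
have oB1 : open B1.
  have -> : B1 = [set z | setT z /\ D1 (pt z)].
    by apply/seteqP; split=> z // -[].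
  apply: open_setI_preimage => //; first exact: openT.
  by move=> z; exact: (Ck_continuous (spt 0%N _ openT)).
pose w z := row_mx (lsubmx z - T (pt z)) (pt z) : 'rV[R]_(s + m).
have sTpt : smooth_on B1 (fun z => T (pt z)).
  move=> k; exact: (Ck_comp oB1 oD1 (fun z h => h) (spt k _ oB1) (sT k)).
have sw : smooth_on B1 w.
  move=> k; apply: (Ck_row_mx oB1 _ (spt k _ oB1)).
  exact: (Ck_submx oB1 (Ck_lsubmx oB1 (sid k _ oB1)) (sTpt k)).
pose B0 := [set z | B1 z /\ [set y : 'rV[R]_(s + m) | `|y - w0| < rho] (w z)].
have oB0 : open B0.
  apply: open_setI_preimage => //; last exact: open_norm_lt.
  by move=> z Bz; exact: (Ck_continuous (sw 0%N) Bz).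
have pt0 : pt 0 = x0 by rewrite /pt linear0 mul0mx addr0.
have w00 : w 0 = w0 by rewrite /w pt0 T0 linear0 subrr.
have B00 : B0 0.
  split; first by rewrite /B1 /= pt0 /D1 /= subrr normr0.
  by rewrite /= w00 subrr normr0.
have wW z : B0 z -> W1 (w z) by move=> [_ /ltW]; exact: Hrho.
pose psi z := phi (w z).
have oW' : forall z, B0 z -> W (w z) by move=> z /wW[].
have sB0 : B0 `<=` B1 by move=> z [].
have spsi : smooth_on B0 psi.
  by move=> k; exact: (Ck_comp oB0 oW oW' (Ck_sub sB0 (sw k)) (sphi k)).
have Dpt z v : 'D_v pt z = rsubmx v *m A0.
  have did : differentiable (fun z : 'rV[R]_(s + q) => z) z by [].
  have dr := differentiable_rsub did.
  have dM := differentiable_mulmx dr (differentiable_cst A0 z).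
  rewrite /pt deriveD; [|exact: derivable_cst|exact: diff_derivable].
  by rewrite derive_cst add0r (derive_mulmxr A0 v dr) (derive_rsub v did) derive_id.
have dptz z : differentiable pt z.
  by have [d _] := spt 1%N _ openT; exact: d.
have Dw z v : B0 z -> 'D_v w z =
    row_mx (lsubmx v - rsubmx v *m A0 *m E (pt z)) (rsubmx v *m A0).
  move=> Bz; have D1z : D1 (pt z) := sB0 _ Bz.
  have did : differentiable (fun z : 'rV[R]_(s + q) => z) z by [].
  have dl := differentiable_lsub did.
  have dT : differentiable (fun z => T (pt z)) z.
    exact: smooth_differentiable sTpt (sB0 _ Bz).
  have dB : differentiable (fun z => lsubmx z - T (pt z)) z.
    exact: differentiableB.
  rewrite /w (derive_row_mx v dB (dptz z)) Dpt; congr row_mx.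
  rewrite deriveB; [|exact: diff_derivable|exact: diff_derivable].
  rewrite (derive_lsub v did) derive_id; congr (_ - _).
  rewrite (@derive_comp _ _ _ _ pt T z v (dptz z) (smooth_differentiable sT D1z)).
  by rewrite Dpt (DT _ _ D1z).
have Dpsi z v : B0 z -> 'D_v psi z = 'D_('D_v w z) phi (w z).
  move=> Bz; apply: derive_comp; first exact: smooth_differentiable sw (sB0 _ Bz).
  exact: smooth_differentiable sphi (oW' _ Bz).
(* At the centre the correction has zero derivative since [A0 *m E x0 = 0], and the remaining frame
   is invertible by [complement_frame]. *)
have Dpsi0 v : 'D_v psi 0 = v *m col_mx (Xi x0) A0.
  rewrite Dpsi// Dw// pt0 -mulmxA A0E mulmx0 subr0 w00.
  have Ww0 : W w0 by have [] := W1w0.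
  have dphi := smooth_differentiable sphi Ww0.
  have -> : row_mx (lsubmx v) (rsubmx v *m A0) =
      1 *: row_mx (lsubmx v) 0 + row_mx 0 (rsubmx v *m A0).
    by rewrite scale1r add_row_mx addr0 add0r.
  rewrite derive_linear// scale1r (Dphi _ _ Ww0).
  have phiw0 : phi w0 = x0 by rewrite phi0// subrr normr0.
  rewrite phiw0 -[v in RHS]hsubmxK mul_row_col; congr (_ + _).
  pose iota (x : 'rV[R]_m) : 'rV[R]_(s + m) := row_mx 0 x.
  have did : differentiable (fun x : 'rV[R]_m => x) x0 by [].
  have di : differentiable iota x0.
    exact: differentiable_row_mx (differentiable_cst _ _) did.
  have Di u : 'D_u iota x0 = row_mx 0 u.
    rewrite /iota (derive_row_mx u (differentiable_cst (0 : 'rV[R]_s) x0) did).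
    by rewrite derive_cst derive_id.
  rewrite -Di -(@derive_comp _ _ _ _ iota phi x0 _ di dphi).
  rewrite -[RHS](derive_id x0); apply: near_eq_derive.
  near=> x; apply: phi0.
  by near: x; apply: (open_near (@open_norm_lt R m x0 r2)); rewrite /= subrr normr0.
have Tpsi z : B0 z -> T (psi z) = lsubmx z.
  move=> Bz; rewrite /psi /w Tphi; first by rewrite addrC subrK.
  by have [_ /ltW] := Bz.
have dpsi z : B0 z -> differentiable psi z by exact: smooth_differentiable.
have [U [V [k [[oU oV U0 UB] sk psiV kU kJ]]]] :=
  inverse_function oB0 B00 spsi Dpsi0 JL LJ.
have [r r0 Hr] := closed_ball_sub oU U0.
pose B := [set z : 'rV[R]_(s + q) | `|z| < r].
have BU : B `<=` U by move=> z /ltW zr; apply: Hr; rewrite subr0.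
have BB0 : B `<=` B0 by move=> z /BU/UB.
have oB : open B.
  have -> : B = [set z : 'rV[R]_(s + q) | `|z - 0| < r].
    by apply/seteqP; split=> z /=; rewrite subr0.
  exact: open_norm_lt.
pose V' := [set y | V y /\ B (k y)].
have V'V : V' `<=` V by move=> y [].
have psi0 : psi 0 = x0 by rewrite /psi w00 phi0// subrr normr0.
exists r, V', psi, k; split.
- split=> //.
  + apply: open_setI_preimage => // y Vy.
    exact: Ck_continuous (sk 0%N) Vy.
  + move=> y [Vy By]; have [Uk <-] := kU y Vy.
    by apply: phiO; have [] := wW _ (UB _ Uk).
  + have [Vx kx] := psiV 0 U0; rewrite psi0 in Vx kx.
    by split=> //; rewrite /B /= kx normr0.
- by split=> j; [exact: Ck_sub (spsi j)|exact: Ck_sub (sk j)].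
- split=> [z Bz|y [Vy By]].
    by have [Vz kz] := psiV z (BU _ Bz); split=> //; split=> //; rewrite kz.
  by have [_ E1] := kU y Vy.
- by move=> y [Vy _]; exact: kJ.
move=> z /BB0 Bz.
have Jl (c : 'rV[R]_s) : c *m usubmx (jacobian psi z) = 'D_(row_mx c 0) psi z.
  rewrite deriveEjacobian; last exact: dpsi.
  by rewrite -[in RHS](vsubmxK (jacobian psi z)) mul_row_col mul0mx addr0.
have Jr (b : 'rV[R]_q) : b *m dsubmx (jacobian psi z) = 'D_(row_mx 0 b) psi z.
  rewrite deriveEjacobian; last exact: dpsi.
  by rewrite -[in RHS](vsubmxK (jacobian psi z)) mul_row_col mul0mx add0r.
split.
  apply/row_matrixP => i; rewrite !rowE Jl Dpsi// Dw// row_mxKl row_mxKr.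
  by rewrite !mul0mx subr0 (Dphi _ _ (oW' _ Bz)).
have D1z : D1 (psi z) by have [] := wW _ Bz.
apply/row_matrixP => i; rewrite row0 rowE mulmxA Jr.
rewrite -(DT _ _ D1z) -(derive_comp _ (dpsi _ Bz) (smooth_differentiable sT D1z)).
have did : differentiable (fun z : 'rV[R]_(s + q) => z) z by [].
transitivity ('D_(row_mx 0 (delta_mx 0 i)) (fun z : 'rV[R]_(s + q) => lsubmx z) z).
  apply: near_eq_derive; near=> z'; apply: Tpsi.
  by near: z'; exact: (open_near oB0 Bz).
by rewrite (derive_lsub _ did) derive_id row_mxKl.
Unshelve. all: by end_near. Qed.

End AdaptedChart.

(** * The local splitting *)

Section JacobianSymmetry.
Context {R : realType} {p m : nat}.
Variables (B : set 'rV[R]_p) (psi : 'rV[R]_p -> 'rV[R]_m).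
Hypotheses (oB : open B) (spsi : smooth_on B psi).

Lemma smooth_jacobian : smooth_on B (jacobian psi).
Proof. by move=> k; exact: Ck_jacobian. Qed.

Lemma derive_jacobian z a v : B z ->
  a *m 'D_v (jacobian psi) z = 'D_v ('D_a psi) z.
Proof.
move=> Bz; rewrite -derive_mulmxl; last exact: smooth_differentiable smooth_jacobian Bz.
apply: near_eq_derive; near=> y; rewrite deriveEjacobian//.
apply: (smooth_differentiable spsi).
by near: y; exact: (open_near oB Bz).
Unshelve. all: by end_near. Qed.

Lemma jacobian_sym z a v : B z ->
  a *m 'D_v (jacobian psi) z = v *m 'D_a (jacobian psi) z.
Proof.
move=> Bz; rewrite (derive_jacobian a v Bz) (derive_jacobian v a Bz).
exact: derive_derive_sym oB Bz (spsi 3%N).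
Qed.

End JacobianSymmetry.

Section LocalProduct.
Context {R : realType}.

(** The derivative of the pulled-back form in a Euclidean direction is the pull-back of a Lie
    derivative, hence zero. The form is therefore constant on the segment from [(0, y)] to
    [(t, y)]. *)
Lemma pullback_invariant m s q (O : set 'rV[R]_m) (S : 'rV[R]_m -> 'M[R]_m)
    (Xi : 'rV[R]_m -> 'M[R]_(s, m)) (r : R) (psi : 'rV[R]_(s + q) -> 'rV[R]_m) :
  let B := [set z : 'rV[R]_(s + q) | `|z| < r] in
  smooth_on O S -> smooth_on O Xi -> smooth_on B psi ->
  (forall z, B z -> O (psi z)) ->
  (forall z, B z -> usubmx (jacobian psi z) = Xi (psi z)) ->
  lie_invariant O Xi S -> forall z, B z ->
  let form z := jacobian psi z *m S (psi z) *m (jacobian psi z)^T in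
  form z = form (row_mx 0 (rsubmx z)).
Proof.
move=> B sS sXi spsi psiO JXi lieS z Bz form.
have oB : open B.
  have -> : B = [set z : 'rV[R]_(s + q) | `|z - 0| < r].
    by apply/seteqP; split=> y /=; rewrite subr0.
  exact: open_norm_lt.
pose c := lsubmx z; pose z0 : 'rV[R]_(s + q) := row_mx 0 (rsubmx z).
pose v : 'rV[R]_(s + q) := row_mx c 0.
have zE : z = z0 + v by rewrite add_row_mx add0r addr0 hsubmxK.
have Bt (t : R) : 0 <= t <= 1 -> B (z0 + t *: v).
  move=> /andP[t0 t1]; rewrite /z0 /v scale_row_mx scaler0 add_row_mx add0r addr0.
  have /norm_lsub_rsub_lt[zl zr] := Bz.
  apply/norm_lsub_rsub_lt; rewrite row_mxKl row_mxKr; split=> //.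
  by rewrite normrZ ger0_norm// (le_lt_trans _ zl)// ler_piMl.
have Dv y : B y -> 'D_v psi y = c *m Xi (psi y).
  move=> By; rewrite deriveEjacobian; last exact: smooth_differentiable spsi By.
  by rewrite -[jacobian psi y]vsubmxK JXi// mul_row_col mul0mx addr0.
(* By symmetry of second derivatives, differentiating the Jacobian along [v] amounts to
   differentiating ['D_v psi = c *m Xi (psi y)]. *)
have DJ y a : B y -> a *m 'D_v (jacobian psi) y =
    c *m 'D_(a *m jacobian psi y) Xi (psi y).
  move=> By; have dp := smooth_differentiable spsi By.
  have dX := smooth_differentiable sXi (psiO _ By).
  rewrite (jacobian_sym oB spsi a v By) (derive_jacobian oB spsi v a By).
  rewrite -(deriveEjacobian a dp) -(derive_comp a dp dX).
  rewrite -(derive_mulmxl c a (differentiable_comp dp dX)).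
  apply: near_eq_derive; near=> y'; apply: Dv.
  by near: y'; exact: (open_near oB By).
have dform y : B y -> differentiable form y /\ 'D_v form y = 0.
  move=> By; have dp := smooth_differentiable spsi By.
  have dJ := smooth_differentiable (smooth_jacobian oB spsi) By.
  have dS := smooth_differentiable sS (psiO _ By).
  have dSp := differentiable_comp dp dS.
  have dJS := differentiable_mulmx dJ dSp.
  have dJt := differentiable_trmx dJ.
  split; first exact: (differentiable_mulmx dJS dJt).
  have -> : 'D_v form y = ('D_v (jacobian psi) y *m S (psi y)
      + jacobian psi y *m 'D_(c *m Xi (psi y)) S (psi y)) *m (jacobian psi y)^T
      + jacobian psi y *m S (psi y) *m ('D_v (jacobian psi) y)^T.
    transitivity ('D_v (fun y => jacobian psi y *m (S \o psi) y *m (jacobian psi y)^T) y).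
      by [].
    rewrite (derive_mulmx v dJS dJt) (derive_mulmx v dJ dSp) (derive_trmx v dJ).
    by rewrite (derive_comp v dp dS) (Dv _ By).
  apply: inner_mx_inj => a b.
  transitivity (inner ('D_(c *m Xi (psi y)) S (psi y)) (a *m jacobian psi y)
     (b *m jacobian psi y)
     + inner (S (psi y)) (a *m 'D_v (jacobian psi) y) (b *m jacobian psi y)
     + inner (S (psi y)) (a *m jacobian psi y) (b *m 'D_v (jacobian psi) y)).
    rewrite /inner mulmxDr mulmxDl [LHS]mxE; congr (_ + _); last first.
      by rewrite trmx_mul !mulmxA.
    rewrite mulmxDl mulmxDr mulmxDl [LHS]mxE addrC trmx_mul !mulmxA.
    by [].
  rewrite (DJ _ a By) (DJ _ b By).
  have -> : inner 0 a b = 0 by rewrite /inner mulmx0 mul0mx mxE.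
  exact: (lieS (psi y) c (a *m jacobian psi y) (b *m jacobian psi y) (psiO _ By)).
have := @mean_value_le R _ _ _ form z0 v 0 0.
rewrite -zE !subr0 => H; apply/eqP; rewrite -subr_eq0 -normr_le0; apply: H => t t01.
have [d1 d2] := dform _ (Bt t t01).
by split=> //; rewrite d2 subr0 normr0.
Unshelve. all: by end_near. Qed.

(** The splitting inside one chart, as matrix identities. The tensors of the factor are read off on
    the slice [t = 0], and [pullback_invariant] carries them to every [t]. *)
Lemma local_product m s q (O : set 'rV[R]_m) x0 (G F : 'rV[R]_m -> 'M[R]_m)
    (Xi : 'rV[R]_m -> 'M[R]_(s, m)) :
  (s + q)%N = m -> open O -> O x0 ->
  smooth_on O G -> (forall x, O x -> (G x)^T = G x) ->
  (forall (x v : 'rV[R]_m), O x -> v != 0 -> 0 < inner (G x) v v) ->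
  smooth_on O Xi ->
  (forall (x u : 'rV[R]_m) (c : 'rV[R]_s), O x ->
     c *m 'D_u Xi x = - christoffel G x u (c *m Xi x)) ->
  smooth_on O F -> (forall x, O x -> Xi x *m F x = 0) ->
  (forall (x u v : 'rV[R]_m), O x -> endo_nabla G F x u v + endo_nabla G F x v u = 0) ->
  (forall x, O x -> Xi x *m coframe G Xi x = 1%:M) ->
  (forall (x u v : 'rV[R]_m), O x -> inner (G x) (u *m F x) v = - inner (G x) u (v *m F x)) ->
  (forall (x v : 'rV[R]_m), O x -> v *m coframe G Xi x = 0 -> v *m F x = 0 -> v = 0) ->
  exists (r : R) (V : set 'rV[R]_m) (psi : 'rV[R]_(s + q) -> 'rV[R]_m)
      (kap : 'rV[R]_m -> 'rV[R]_(s + q)) (gN fN : 'rV[R]_q -> 'M[R]_q),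
    let B := [set z : 'rV[R]_(s + q) | `|z| < r] in
    let D := [set y : 'rV[R]_q | `|y| < r] in
    [/\ [/\ 0 < r, open V, V `<=` O & V x0],
      smooth_on B psi /\ smooth_on V kap,
      (forall z, B z -> V (psi z) /\ kap (psi z) = z) /\
      (forall x, V x -> B (kap x) /\ psi (kap x) = x),
      forall x, V x ->
       [/\ forall u v, inner (block_mx 1%:M 0 0 (gN (rsubmx (kap x))))
             ('D_u kap x) ('D_v kap x) = inner (G x) u v,
           forall c : 'rV[R]_s, 'D_(c *m Xi x) kap x = row_mx c 0
         & forall u, 'D_(u *m F x) kap x =
             'D_u kap x *m block_mx 0 0 0 (fN (rsubmx (kap x)))] &
      (smooth_on D gN /\ smooth_on D fN) /\
      forall y, D y ->
       [/\ (gN y)^T = gN y, forall v : 'rV[R]_q, v != 0 -> 0 < inner (gN y) v v,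
           forall u v, inner (gN y) (u *m fN y) v = - inner (gN y) u (v *m fN y),
           forall v : 'rV[R]_q, v != 0 -> inner (gN y) (v *m fN y *m fN y) v < 0
         & forall u v, endo_nabla gN fN y u v + endo_nabla gN fN y v u = 0]].
Proof.
move=> e oO Ox0 sG Gsym Gpos sXi par sF XiF nearly XiE Fskew Finj.
have sE := smooth_coframe oO sG sXi.
have closedE := coframe_closed oO sG Gsym Gpos sXi par.
have comm := frame_commute oO sG Gsym Gpos par.
have [r [V [psi [kap [[r0 oV VO Vx0] [spsi skap] [psiV kapV] HJ' HJ]]]]] :=
  adapted_chart e oO Ox0 sXi sE XiE closedE comm.
set B := [set _ | _] in spsi psiV kapV HJ.
pose D := [set y : 'rV[R]_q | `|y| < r].
have psiO z : B z -> O (psi z) by move=> /psiV[/VO].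
have JXi z : B z -> usubmx (jacobian psi z) = Xi (psi z) by move=> /HJ[].
pose iota (y : 'rV[R]_q) : 'rV[R]_(s + q) := row_mx 0 y.
have oD : open D.
  have -> : D = [set y : 'rV[R]_q | `|y - 0| < r].
    by apply/seteqP; split=> y /=; rewrite subr0.
  exact: open_norm_lt.
have oB : open B.
  have -> : B = [set y : 'rV[R]_(s + q) | `|y - 0| < r].
    by apply/seteqP; split=> y /=; rewrite subr0.
  exact: open_norm_lt.
have iB y : D y -> B (iota y).
  by move=> Dy; apply/norm_lsub_rsub_lt; rewrite row_mxKl row_mxKr normr0.
have rD z : B z -> D (rsubmx z) by move=> /norm_lsub_rsub_lt[].
pose io y := psi (iota y).
have siota : smooth_on D iota.
  by move=> k; exact: (Ck_row_mx oD (Ck_cst _ _ _) (Ck_id k oD)).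
have sio : smooth_on D io.
  by move=> k; exact: (Ck_comp oD oB iB (siota k) (spsi k)).
have ioO y : D y -> O (io y) by move=> /iB/psiO.
pose A z := dsubmx (jacobian psi z).
pose a y := jacobian io y.
have sa : smooth_on D a := smooth_jacobian oD sio.
have Diota y u : 'D_u iota y = row_mx 0 u.
  have did : differentiable (fun x : 'rV[R]_q => x) y by [].
  rewrite /iota (derive_row_mx u (differentiable_cst (0 : 'rV[R]_s) y) did).
  by rewrite derive_cst derive_id.
have aA y : D y -> a y = A (iota y).
  move=> Dy; have dio := smooth_differentiable sio Dy.
  have dp := smooth_differentiable spsi (iB _ Dy).
  apply/row_matrixP => i; rewrite !rowE -(deriveEjacobian _ dio).
  rewrite (derive_comp _ (smooth_differentiable siota Dy) dp) Diota.
  rewrite (deriveEjacobian _ dp) -[X in _ *m X]vsubmxK mul_row_col mul0mx.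
  by rewrite add0r.
have AE z : B z -> A z *m coframe G Xi (psi z) = 0 by move=> /HJ[].
have Jinv z : B z -> exists J' : 'M[R]_(m, s + q),
    [/\ jacobian psi z *m J' = 1%:M, J' *m jacobian psi z = 1%:M
      & forall h, 'D_h kap (psi z) = h *m J'].
  by move=> /psiV[Vz kz]; have := HJ' _ Vz; rewrite kz.
have spanA z (w : 'rV[R]_m) : B z -> w *m coframe G Xi (psi z) = 0 ->
    exists b : 'rV[R]_q, w = b *m A z.
  move=> Bz wE; have [J' [JJ' J'J _]] := Jinv z Bz.
  have wE' : w = lsubmx (w *m J') *m Xi (psi z) + rsubmx (w *m J') *m A z.
    rewrite -mul_row_col hsubmxK -(JXi _ Bz) vsubmxK -mulmxA J'J mulmx1//.
  exists (rsubmx (w *m J')).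
  have := congr1 (mulmx^~ (coframe G Xi (psi z))) wE'.
  rewrite /= mulmxDl -!mulmxA AE// mulmx0 addr0 XiE ?mulmx1; last exact: psiO.
  by rewrite wE => l0; rewrite [LHS]wE' -l0 mul0mx add0r.
(* By skewness the image of [F] is orthogonal to the frame, which [F] annihilates; hence [F]
   preserves the slice directions. *)
have FE x : O x -> F x *m coframe G Xi x = 0.
  move=> Ox; apply/row_matrixP => i; rewrite row0 rowE mulmxA.
  apply/rowP => l; rewrite [RHS]mxE.
  have := coframeE G Xi x (delta_mx 0 l) (delta_mx 0 i *m F x).
  rewrite trmx_delta -colE [X in _ = X]mxE => <-.
  by rewrite Fskew// -mulmxA XiF// mulmx0 inner0r oppr0.
have Ainj z (b : 'rV[R]_q) : B z -> b *m A z = 0 -> b = 0.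
  move=> Bz bA; have [J' [JJ' _ _]] := Jinv z Bz.
  have : row_mx 0 b *m jacobian psi z = 0 :> 'rV[R]_m.
    by rewrite -[jacobian psi z]vsubmxK mul_row_col mul0mx add0r.
  move/(congr1 (mulmx^~ J')); rewrite /= -mulmxA JJ' mulmx1 mul0mx.
  by move/(congr1 rsubmx); rewrite row_mxKr linear0.
pose gN y := a y *m G (io y) *m (a y)^T.
pose hN y := a y *m (F (io y) *m G (io y)) *m (a y)^T.
(* Raising an index of the form [hN]. This makes [fN] visibly smooth and gives it the independence
   of [t] of [hN] and [gN]; that it restricts [F] is [fNA]. *)
pose fN y := hN y *m invmx (gN y).
have lieG := lie_metric oO sG Gsym Gpos par.
have lieF := lie_form oO sG Gsym Gpos sXi par sF XiF nearly.
have sFG : smooth_on O (fun x => F x *m G x).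
  by move=> k; exact: (Ck_mulmx oO (sF k) (sG k)).
have dform (S : 'rV[R]_m -> 'M[R]_m) z : smooth_on O S -> lie_invariant O Xi S ->
    B z -> A z *m S (psi z) *m (A z)^T =
    a (rsubmx z) *m S (io (rsubmx z)) *m (a (rsubmx z))^T.
  move=> sS lS Bz.
  have H := pullback_invariant sS sXi spsi psiO JXi lS Bz.
  rewrite (aA _ (rD _ Bz)).
  have E (J : 'M[R]_(s + q, m)) (T : 'M[R]_m) :
      drsubmx (J *m T *m J^T) = dsubmx J *m T *m (dsubmx J)^T.
    rewrite /drsubmx -!mul_dsub_mx trmx_dsub.
    apply/matrixP => i j; rewrite !mxE; apply: eq_bigr => k _; rewrite !mxE.
    by congr (_ * _).
  have H1 := E (jacobian psi z) (S (psi z)).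
  have H2 := E (jacobian psi (iota (rsubmx z))) (S (io (rsubmx z))).
  exact: etrans (esym H1) (etrans (congr1 drsubmx H) H2).
have gNE z : B z -> A z *m G (psi z) *m (A z)^T = gN (rsubmx z).
  by move=> Bz; exact: (dform G z sG lieG Bz).
have hNE z : B z -> A z *m (F (psi z) *m G (psi z)) *m (A z)^T = hN (rsubmx z).
  by move=> Bz; exact: (dform _ z sFG lieF Bz).
have inN y u v : inner (gN y) u v = inner (G (io y)) (u *m a y) (v *m a y).
  by rewrite /inner /gN trmx_mul !mulmxA.
have ainj y (b : 'rV[R]_q) : D y -> b *m a y = 0 -> b = 0.
  by move=> Dy; rewrite aA//; apply: Ainj; exact: iB.
have gNpos y v : D y -> v != 0 -> 0 < inner (gN y) v v.
  move=> Dy v0; rewrite inN; apply: Gpos; first exact: ioO.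
  by apply: contra v0 => /eqP /(ainj _ _ Dy) ->.
have gNu y : D y -> gN y \in unitmx.
  by move=> Dy; apply: posdef_unitmx => v; exact: gNpos.
have fNA z : B z -> fN (rsubmx z) *m A z = A z *m F (psi z).
  move=> Bz.
  have [C CE] : exists C : 'M[R]_q, A z *m F (psi z) = C *m A z.
    have /choice[b Hb] : forall i : 'I_q, exists b : 'rV[R]_q,
        row i (A z *m F (psi z)) = b *m A z.
      move=> i; apply: (spanA z _ Bz).
      by rewrite -row_mul -mulmxA (FE _ (psiO _ Bz)) mulmx0 row0.
    exists (\matrix_i b i); apply/row_matrixP => i.
    by rewrite Hb row_mul rowK.
  suff -> : fN (rsubmx z) = C by rewrite CE.
  have hC : hN (rsubmx z) = C *m gN (rsubmx z).
    by rewrite -(hNE _ Bz) mulmxA CE -(gNE _ Bz) !mulmxA.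
  by rewrite /fN hC (mulmxK (gNu _ (rD _ Bz))).
have fNa y : D y -> fN y *m a y = a y *m F (io y).
  by move=> Dy; have := fNA _ (iB _ Dy); rewrite row_mxKr -(aA _ Dy).
have sGio : smooth_on D (fun y => G (io y)).
  by move=> k; exact: (Ck_comp oD oO ioO (sio k) (sG k)).
have sFio : smooth_on D (fun y => F (io y)).
  by move=> k; exact: (Ck_comp oD oO ioO (sio k) (sF k)).
have sgN : smooth_on D gN.
  move=> k; apply: (Ck_mulmx oD _ (Ck_trmx oD (sa k))).
  exact: (Ck_mulmx oD (sa k) (sGio k)).
have sfN : smooth_on D fN.
  move=> k; apply: (Ck_mulmx oD _ (Ck_invmx oD gNu (sgN k))).
  apply: (Ck_mulmx oD _ (Ck_trmx oD (sa k))).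
  exact: (Ck_mulmx oD (sa k) (Ck_mulmx oD (sFio k) (sGio k))).
have gNsym y : D y -> (gN y)^T = gN y.
  by move=> Dy; rewrite /gN !trmx_mul trmxK Gsym ?mulmxA//; exact: ioO.
exists r, V, psi, kap, gN, fN; split=> //.
- move=> x Vx; have [Bz xE] := kapV x Vx; set z := kap x in Bz xE *.
  have [J' [JJ' J'J Dk]] := Jinv z Bz; rewrite xE in Dk.
  have JE : jacobian psi z = col_mx (Xi x) (A z).
    by rewrite -[LHS]vsubmxK JXi// xE.
  have Ox := VO _ Vx.
  split=> [u v|c|u].
  + rewrite !Dk.
    have -> : block_mx 1%:M 0 0 (gN (rsubmx z)) =
        jacobian psi z *m G x *m (jacobian psi z)^T.
      rewrite JE tr_col_mx mul_col_mx mul_col_row -(gNE _ Bz) xE.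
      have XG : Xi x *m G x *m (Xi x)^T = 1%:M by rewrite -mulmxA XiE.
      have AG : A z *m G x *m (Xi x)^T = 0.
        by rewrite -mulmxA; have := AE _ Bz; rewrite xE.
      have GA : Xi x *m G x *m (A z)^T = 0.
        by apply: trmx_inj; rewrite !trmx_mul trmxK Gsym// mulmxA AG trmx0.
      by rewrite XG AG GA.
    transitivity (inner (G x) (u *m J' *m jacobian psi z) (v *m J' *m jacobian psi z)).
      by rewrite /inner !trmx_mul !mulmxA.
    by rewrite -(mulmxA u) -(mulmxA v) J'J !mulmx1.
  + rewrite Dk; have -> : c *m Xi x = row_mx c 0 *m jacobian psi z.
      by rewrite JE mul_row_col mul0mx addr0.
    by rewrite -mulmxA JJ' mulmx1.
  rewrite !Dk; have E1 : block_mx 0 0 0 (fN (rsubmx z)) *m jacobian psi z =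
      jacobian psi z *m F x.
    rewrite JE mul_block_col mul_col_mx !mul0mx !add0r (fNA _ Bz) xE.
    by rewrite XiF.
  have E2 : block_mx 0 0 0 (fN (rsubmx z)) = jacobian psi z *m F x *m J'.
    by rewrite -E1 -mulmxA JJ' mulmx1.
  by rewrite E2 !mulmxA -(mulmxA u J') J'J mulmx1.
split=> // y Dy; have Oy := ioO _ Dy.
have avE v : v *m a y *m coframe G Xi (io y) = 0.
  by rewrite -mulmxA aA// (AE _ (iB _ Dy)) mulmx0.
have faE (v : 'rV[R]_q) : v *m fN y *m a y = v *m a y *m F (io y).
  by rewrite -mulmxA (fNa _ Dy) mulmxA.
have fNskew u v : inner (gN y) (u *m fN y) v = - inner (gN y) u (v *m fN y).
  by rewrite !inN (faE u) (faE v) Fskew.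
split=> //; first exact: gNsym.
- by move=> v; exact: gNpos.
(* The value is minus the squared length of [v *m fN y], nonzero because [F] is injective on the
   kernel of the coframe. *)
- move=> v v0; rewrite fNskew oppr_lt0; apply: gNpos => //.
  apply: contra v0 => /eqP vf0; apply/eqP/(ainj y) => //.
  by apply: (Finj (io y)) => //; rewrite -(faE v) vf0 mul0mx.
have dio := smooth_differentiable sio Dy.
have da := smooth_differentiable sa Dy.
have dG := smooth_differentiable sG Oy.
have dF := smooth_differentiable sF Oy.
have dE := smooth_differentiable sE Oy.
have Dio u : 'D_u io y = u *m a y by exact: deriveEjacobian.
(* the slice [t = 0] is totally geodesic *)
have gauss (u v : 'rV[R]_q) : christoffel G (io y) (u *m a y) (v *m a y) + v *m 'D_u a y =
    christoffel gN y u v *m a y.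
  set c := _ + _.
  (* Differentiate [a *m coframe = 0] along the slice: as the dual forms are parallel, the covariant
     derivative of slice directions has no component along the frame. *)
  have cE : c *m coframe G Xi (io y) = 0.
    have : 'D_u (fun y => a y *m coframe G Xi (io y)) y = 0.
      rewrite -[RHS](derive_cst (0 : 'M[R]_(q, s)) y u); apply: near_eq_derive.
      near=> y'; have Dy' : D y' by near: y'; exact: (open_near oD Dy).
      by rewrite aA// (AE _ (iB _ Dy')).
    have := derive_mulmx u da (differentiable_comp dio dE); rewrite /= => ->.
    rewrite (derive_comp u dio dE) Dio => /(congr1 (mulmx v)).
    rewrite mulmxDr mulmx0 (mulmxA v (a y)) (mulmxA v ('D_u a y)).
    rewrite (derive_coframe oO sG Gsym Gpos sXi par (u *m a y) (v *m a y) Oy).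
    by move=> H; rewrite /c mulmxDl addrC; exact: H.
  have [b cb] := spanA (iota y) c (iB _ Dy) cE.
  rewrite -(aA _ Dy) in cb; rewrite cb; congr (_ *m _).
  (* Inner products with slice vectors now suffice. Both sides obey the Koszul formula, and the
     derivatives of [a] match by the symmetry of second derivatives. *)
  apply: (inner_nondeg (gNu _ Dy)) => w.
  rewrite (christoffel_koszul sgN gNpos u v w Dy) inN -cb /c innerDl.
  have DgN (u' v' w' : 'rV[R]_q) : inner ('D_u' gN y) v' w' =
      inner ('D_(u' *m a y) G (io y)) (v' *m a y) (w' *m a y)
      + inner (G (io y)) (v' *m 'D_u' a y) (w' *m a y)
      + inner (G (io y)) (v' *m a y) (w' *m 'D_u' a y).
    have dGio := differentiable_comp dio dG.
    have daG := differentiable_mulmx da dGio.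
    have dat := differentiable_trmx da.
    have -> : 'D_u' gN y = ('D_u' a y *m G (io y)
      + a y *m 'D_(u' *m a y) G (io y)) *m (a y)^T
      + a y *m G (io y) *m ('D_u' a y)^T.
      transitivity ('D_u' (fun y => a y *m (G \o io) y *m (a y)^T) y); first by [].
      rewrite (derive_mulmx u' daG dat) (derive_mulmx u' da dGio).
      by rewrite (derive_trmx u' da) (derive_comp u' dio dG) Dio.
    rewrite /inner mulmxDr mulmxDl [LHS]mxE; congr (_ + _); last first.
      by rewrite trmx_mul !mulmxA.
    by rewrite mulmxDl mulmxDr mulmxDl [LHS]mxE addrC trmx_mul !mulmxA.
  have Dsym (u' v' : 'rV[R]_q) : u' *m 'D_v' a y = v' *m 'D_u' a y.
    exact: (jacobian_sym oD sio u' v' Dy).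
  have K := christoffel_koszul sG Gpos (u *m a y) (v *m a y) (w *m a y) Oy.
  have S := inner_sym (v *m a y) (w *m 'D_u a y) (Gsym _ Oy).
  have e1 := DgN u v w; have e2 := DgN v u w; have e3 := DgN w u v.
  rewrite (Dsym u v) in e2; rewrite (Dsym u w) (Dsym v w) in e3.
  move: K e1 e2 e3 S.
  generalize ('D_u gN y) ('D_v gN y) ('D_w gN y) => N1 N2 N3.
  generalize (christoffel G (io y) (u *m a y) (v *m a y)) => c'.
  generalize ('D_(u *m a y) G (io y)) ('D_(v *m a y) G (io y)).
  generalize ('D_(w *m a y) G (io y)) (v *m 'D_u a y) (w *m 'D_u a y).
  generalize (w *m 'D_v a y) (u *m a y) (v *m a y) (w *m a y) (G (io y)).
  by move=> a1 a2 a3 a4 a5 a6 a7 a8 a9 a10 -> -> -> -> S; lra.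
(* Differentiate [fN *m a = a *m F] and convert the Christoffel terms with [gauss]; the nearly
   parallel condition then descends because [a] is injective. *)
have nablaE (u v : 'rV[R]_q) : endo_nabla gN fN y u v *m a y =
    endo_nabla G F (io y) (u *m a y) (v *m a y).
  have Df : 'D_u fN y *m a y + fN y *m 'D_u a y =
      'D_u a y *m F (io y) + a y *m 'D_(u *m a y) F (io y).
    rewrite -(derive_mulmx u (smooth_differentiable sfN Dy) da).
    rewrite -Dio -(derive_comp u dio dF).
    rewrite -(derive_mulmx u da (differentiable_comp dio dF)).
    apply: near_eq_derive; near=> y'; apply: fNa.
    by near: y'; exact: (open_near oD Dy).
  have Df' : v *m 'D_u fN y *m a y = v *m 'D_u a y *m F (io y)
      + v *m a y *m 'D_(u *m a y) F (io y) - v *m fN y *m 'D_u a y.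
    have /(congr1 (mulmx v)) := Df; rewrite !mulmxDr !mulmxA => <-.
    by rewrite addrK.
  rewrite /endo_nabla mulmxBl mulmxDl -(gauss u (v *m fN y)) (faE v).
  rewrite (faE (christoffel gN y u v)) -(gauss u v) Df' mulmxDl.
  move: (v *m 'D_u a y *m F (io y)) (v *m a y *m 'D_(u *m a y) F (io y)).
  move: (v *m fN y *m 'D_u a y) (christoffel G (io y) (u *m a y) (v *m a y) *m _).
  move: (christoffel G (io y) (u *m a y) (v *m a y *m _)) => a1 a2 a3 a4 a5.
  by apply/matrixP => i j; rewrite !mxE; ring.
move=> u v; apply: (ainj y _ Dy).
have := nearly (io y) (u *m a y) (v *m a y) Oy.
rewrite -(nablaE u v) -(nablaE v u).
generalize (endo_nabla gN fN y u v) (endo_nabla gN fN y v u) => N1 N2.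
by rewrite mulmxDl.
Unshelve. all: by end_near. Qed.

End LocalProduct.

(** * From conditions on global fields to pointwise identities *)

Section PointwiseTensors.
Context {R : realType} {m : nat} (M : charted R m) (hM : is_manifold M).
Variables (g : field M 'M[R]_m) (hg : is_riemannian_metric g).
Implicit Types i j : index M.

Lemma parallel_pointwise (Z : field M 'rV[R]_m) i x u : parallel_field g Z ->
  chart_image i x -> 'D_u (Z i) x = - christoffel (g i) x u (Z i x).
Proof.
move=> pZ ix; have [X [vX Xu]] := vector_field_through hM u ix.
have := pZ X vX i x ix; rewrite /nabla Xu => /eqP; rewrite addr_eq0.
by move/eqP.
Qed.

Lemma nabla_endoE (F : field M 'M[R]_m) (X Y : field M 'rV[R]_m) i x :
  differentiable (F i) x -> differentiable (Y i) x ->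
  nabla_endo g F X Y i x = endo_nabla (g i) (F i) x (X i x) (Y i x).
Proof.
move=> dF dY; rewrite /nabla_endo /nabla /endo_app /endo_nabla.
rewrite (derive_mulmx _ dY dF) mulmxDl.
move: ('D_(X i x) (Y i) x *m F i x) (Y i x *m 'D_(X i x) (F i) x) => a b.
move: (christoffel _ _ _ _) (christoffel _ _ _ _ *m _) => c d.
by apply/matrixP => k l; rewrite !mxE; ring.
Qed.

Lemma nearly_parallel_pointwise (F : field M 'M[R]_m) i x u v :
  is_endo_field F -> nearly_parallel_endo g F -> chart_image i x ->
  endo_nabla (g i) (F i) x u v + endo_nabla (g i) (F i) x v u = 0.
Proof.
move=> [sF _] nF ix.
have [X [vX Xu]] := vector_field_through hM u ix.
have [Y [vY Yv]] := vector_field_through hM v ix.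
have := nF X Y vX vY i x ix.
have [sX _] := vX; have [sY _] := vY.
rewrite !nabla_endoE ?Xu ?Yv//.
- exact: smooth_differentiable (sF i) ix.
- exact: smooth_differentiable (sX i) ix.
- exact: smooth_differentiable (sF i) ix.
- exact: smooth_differentiable (sY i) ix.
Qed.

(** Read off from the Koszul formula; the slot ['D_v] is linear by differentiability of the metric.
    It extends parallelism from each [xi] to their constant combinations. *)
Lemma christoffel_linear i x u : chart_image i x -> linear (christoffel (g i) x u).
Proof.
move=> ix; have sg := metric_smooth hg i; have dg := smooth_differentiable sg ix.
have pos y v : chart_image i y -> v != 0 -> 0 < inner (g i y) v v.
  exact: metric_pos.
have gu := metric_unit pos ix.
have iZ (A : 'M[R]_m) a (v w : 'rV[R]_m) :
    inner A (a *: v) w = a * inner A v w.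
  by rewrite /inner -!scalemxAl mxE.
have iZr (A : 'M[R]_m) a (v w : 'rV[R]_m) :
    inner A v (a *: w) = a * inner A v w.
  by rewrite /inner linearZ -scalemxAr mxE.
have iZm (A : 'M[R]_m) a (v w : 'rV[R]_m) : inner (a *: A) v w = a * inner A v w.
  by rewrite /inner -scalemxAr -scalemxAl mxE.
move=> a v w; apply: (inner_nondeg gu) => z; rewrite innerDl iZ.
have K1 := christoffel_koszul sg pos u (a *: v + w) z ix.
have K2 := christoffel_koszul sg pos u v z ix.
have K3 := christoffel_koszul sg pos u w z ix.
rewrite (derive_linear _ _ _ dg) in K1.
move: K1 K2 K3.
generalize (christoffel (g i) x u (a *: v + w)) (christoffel (g i) x u v).
generalize (christoffel (g i) x u w) ('D_u (g i) x) ('D_v (g i) x).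
generalize ('D_w (g i) x) ('D_z (g i) x) => A1 A2 A3 A4 A5 c1 c2 -> -> ->.
rewrite !innerDl !innerDr innerD !iZ !iZr iZm; ring.
Qed.

Lemma frame_parallel s (xi : 'I_s -> field M 'rV[R]_m) i x u (c : 'rV[R]_s) :
  (forall a, is_vector_field (xi a)) -> (forall a, parallel_field g (xi a)) ->
  chart_image i x ->
  c *m 'D_u (fun y => \matrix_a xi a i y) x =
  - christoffel (g i) x u (c *m \matrix_a xi a i x).
Proof.
move=> vxi pxi ix.
have dxi a : differentiable (xi a i) x.
  by have [sx _] := vxi a; exact: smooth_differentiable (sx i) ix.
have dX : differentiable (fun y => \matrix_a xi a i y) x.
  apply: (differentiable_mxP _ _).2 => a l; under eq_fun do rewrite mxE.
  exact: (differentiable_mxP _ _).1.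
pose lin_i := GRing.isLinear.Build _ _ _ _ _ (christoffel_linear u ix).
pose C : {linear 'rV[R]_m -> 'rV[R]_m} := HB.pack (christoffel (g i) x u) lin_i.
rewrite !mulmx_sum_row -[christoffel _ _ _]/(C : _ -> _) linear_sum -sumrN.
apply: eq_bigr => a _; rewrite linearZ -scalerN /=; congr (_ *: _).
rewrite rowK -(parallel_pointwise u (pxi a) ix) rowE.
rewrite -(derive_mulmxl (delta_mx 0 a) u dX).
by congr ('D_u _ x); apply/funext => y; rewrite -rowE rowK.
Qed.

End PointwiseTensors.

(** * Pointwise algebra of a weak metric f-structure *)

Section StructureFacts.
Context {R : realType} {n s : nat} (M : charted R (2 * n + s)).
Variables (f Q : field M 'M[R]_(2 * n + s)).
Variables (xi : 'I_s -> field M 'rV[R]_(2 * n + s)).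
Variables (eta : 'I_s -> field M 'cV[R]_(2 * n + s)).
Variables (g : field M 'M[R]_(2 * n + s)).
Hypothesis H : weak_metric_f_structure f Q xi eta g.
Variables (i : index M) (x : 'rV[R]_(2 * n + s)).
Hypothesis ix : chart_image i x.

Lemma inner_definite v : inner (g i x) v v = 0 -> v = 0.
Proof.
move=> vv; apply/eqP/negPn/negP => v0.
by have := metric_pos (wf_metric H) ix v0; rewrite vv ltxx.
Qed.

(** Compatibility with both arguments equal to [xi a] gives squared length [1 - 1]. *)
Lemma xi_f a : xi a i x *m f i x = 0.
Proof.
apply: inner_definite; rewrite (wf_compatible H)// (wf_Q_xi H)//.
rewrite (wf_xi_orthonormal H)// eqxx (bigD1 a)//= (wf_eta_xi H)// eqxx mulr1.
rewrite big1 ?addr0 ?subrr// => b ba.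
by rewrite (wf_eta_xi H)// (negbTE ba) mul0r.
Qed.

(** Compatibility with second argument [xi a]: its left side vanishes by [xi_f], and the sum reduces
    to the [a]-th term. *)
Lemma eta_inner v a : (v *m eta a i x) 0 0 = inner (g i x) v (xi a i x).
Proof.
have := wf_compatible H v (xi a i x) ix.
rewrite xi_f inner0r (wf_Q_xi H)// => /esym/eqP; rewrite subr_eq0 => /eqP ->.
rewrite (bigD1 a)//= (wf_eta_xi H)// eqxx mulr1 big1 ?addr0// => b ba.
by rewrite (wf_eta_xi H)// (negbTE ba) mulr0.
Qed.

(** On the orthogonal complement of the [xi]'s, [f] squared is [- Q], which is nonsingular. *)
Lemma f_injective v : (forall a, inner (g i x) v (xi a i x) = 0) ->
  v *m f i x = 0 -> v = 0.
Proof.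
move=> vxi vf.
have : v *m (f i x *m f i x) = 0 by rewrite mulmxA vf mul0mx.
rewrite (wf_f_square H)// mulmxDr mulmxN mulmx_sumr big1 => [|a _]; last first.
  rewrite mulmxA; suff -> : v *m eta a i x = 0 by rewrite mul0mx.
  by apply/matrixP => k l; rewrite !ord1 eta_inner vxi mxE.
move/eqP; rewrite addr0 oppr_eq0 => /eqP vQ.
by rewrite -(mulmxK (wf_Q_nonsingular H ix) v) vQ mul0mx.
Qed.

End StructureFacts.

(** * The open ball as a manifold with one chart *)

Section BallChart.
Context {R : realType} (q : nat) (r : R) (r0 : 0 < r).

Fact norm0_lt : `|0 : 'rV[R]_q| < r. Proof. by rewrite normr0. Qed.

Definition ball_val (y : {y : 'rV[R]_q | `|y| < r}) : 'rV[R]_q := val y.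

Definition ball_space : topologicalType := initial_topology ball_val.

(** Points outside the ball are sent to the centre, a value that is never read. *)
Definition ball_param (y : 'rV[R]_q) : ball_space :=
  insubd (exist _ 0 norm0_lt : {y : 'rV[R]_q | `|y| < r}) y.

Definition ball_chart : charted R q :=
  @Charted R q ball_space unit (fun=> setT) (fun=> ball_val) (fun=> ball_param).

Let D := [set y : 'rV[R]_q | `|y| < r].

Lemma ball_valK : cancel ball_val ball_param.
Proof. by move=> y; exact: valKd. Qed.

Lemma ball_paramK y : D y -> ball_val (ball_param y) = y.
Proof. by move=> Dy; rewrite /ball_val insubdK. Qed.

Lemma ball_val_lt y : D (ball_val y).
Proof. by case: y. Qed.

Lemma ball_val_continuous : continuous (ball_val : ball_space -> 'rV[R]_q).
Proof. exact: initial_continuous. Qed.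

Lemma open_ball_set : open D.
Proof.
have -> : D = [set y : 'rV[R]_q | `|y - 0| < r].
  by apply/seteqP; split=> y /=; rewrite subr0.
exact: open_norm_lt.
Qed.

Lemma ball_param_continuous y : D y -> {for y, continuous ball_param}.
Proof.
move=> Dy A; rewrite /= nbhsE => -[A' [[C oC CA'] A'y] A'A].
have Cy : C y by rewrite -CA' /= ball_paramK in A'y.
apply: filterS (filterI (open_near oC Cy) (open_near open_ball_set Dy)).
by move=> z [Cz Dz]; apply: A'A; rewrite -CA' /= ball_paramK.
Qed.

Lemma ball_chart_image (i : index ball_chart) : chart_image i = D.
Proof.
apply/seteqP; split=> y /=; first by move=> [z _ <-]; exact: ball_val_lt.
by move=> Dy; exists (ball_param y) => //; exact: ball_paramK.
Qed.

Lemma ball_overlap (i j : index ball_chart) : overlap i j = D.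
Proof. by rewrite /overlap setIid -(ball_chart_image i). Qed.

(** The base consists of the traces of balls with rational centre and radius [1 / (n + 1)]; a radius
    below [e / 2] fits around the point inside its [e]-ball. *)
Lemma ball_second_countable : @second_countable ball_space.
Proof.
pose c (k : 'rV[rat]_q * nat) : set ball_space :=
  [set y | `|ball_val y - map_mx ratr k.1| < k.2.+1%:R^-1].
have oc k : open (c k).
  by exists [set y | `|y - map_mx ratr k.1| < k.2.+1%:R^-1] => //; exact: open_norm_lt.
exists [set c k | k in setT].
  exact: sub_countable (card_image_le _ _) (countableP _).
split; first by move=> _ [k _ <-].
move=> y A; rewrite nbhsE => -[_ [[C oC <-] Cy] CA].
have [e e0 He] := closed_ball_sub oC Cy.
have [n Hn] : exists n, n.+1%:R^-1 < e / 2 :> R.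
  have := near_infty_natSinv_lt (PosNum (divr_gt0 e0 (ltr0Sn R 1))).
  by move=> /filter_ex[n /= Hn]; exists n.
have n0 : 0 < n.+1%:R^-1 :> R by rewrite invr_gt0.
have /choice[a Ha] : forall l : 'I_q, exists a : rat,
    `|ball_val y 0 l - ratr a| < n.+1%:R^-1.
  move=> l; have [|a] := @rat_in_itvoo R (ball_val y 0 l - n.+1%:R^-1)
    (ball_val y 0 l + n.+1%:R^-1); first by rewrite ltrD2l (lt_trans _ n0)// oppr_lt0.
  rewrite in_itv /= => /andP[a1 a2]; exists a.
  by rewrite ltr_distlC a1.
pose k := (\row_l a l : 'rV[rat]_q, n).
have yk : c k y.
  rewrite /c /= /Num.Def.normr /= mx_normrE.
  apply/bigmax_ltP; split=> // -[i l] _; rewrite !mxE ord1; exact: Ha.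
exists (c k); first by split=> //; exists k.
move=> z zk; apply: CA; apply: He.
rewrite /c /= in yk zk.
rewrite -(subrKA (map_mx ratr k.1)) (le_trans (ler_normD _ _))//.
rewrite [leRHS]splitr lerD//; first exact: ltW (lt_trans zk Hn).
by rewrite distrC; exact: ltW (lt_trans yk Hn).
Qed.

Lemma ball_manifold : is_manifold ball_chart.
Proof.
split.
- move=> y z; rewrite /cluster /= => yz.
  apply: (can_inj ball_valK); apply: norm_hausdorff => A B yA zB.
  have [w [/= wA wB]] := yz _ _ (ball_val_continuous yA) (ball_val_continuous zB).
  by exists (ball_val w).
- exact: ball_second_countable.
- by move=> p; exists tt.
- by move=> i; exact: openT.
- by move=> i; rewrite ball_chart_image; exact: open_ball_set.
- by move=> i p _; exact: ball_valK.
- by move=> i p _; exact: ball_val_continuous.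
- by move=> i y; rewrite ball_chart_image; exact: ball_param_continuous.
move=> i j k; rewrite ball_overlap; apply: (@Ck_ext _ _ _ _ _ _ id).
- exact: open_ball_set.
- by move=> y Dy; exact: ball_paramK.
- by apply: Ck_id; exact: open_ball_set.
Qed.

Lemma ball_weak_nearly_kahler (gN fN : 'rV[R]_q -> 'M[R]_q) : ~~ odd q ->
  smooth_on D gN -> smooth_on D fN ->
  (forall y, D y ->
     [/\ (gN y)^T = gN y, forall v : 'rV[R]_q, v != 0 -> 0 < inner (gN y) v v,
       forall u v, inner (gN y) (u *m fN y) v = - inner (gN y) u (v *m fN y),
       forall v : 'rV[R]_q, v != 0 -> inner (gN y) (v *m fN y *m fN y) v < 0
       & forall u v, endo_nabla gN fN y u v + endo_nabla gN fN y v u = 0]) ->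
  weak_nearly_kahler ((fun=> fN) : field ball_chart 'M[R]_q) (fun=> gN).
Proof.
move=> eq sg sf H.
have hM := ball_manifold.
have tid (i j : index ball_chart) y v : D y ->
    transition i j y = y /\ 'd (transition i j) y v = v.
  move=> Dy; split; first exact: ball_paramK.
  case: i j => -[]; rewrite -deriveE.
    by apply: derive_transition_id => //; rewrite ball_chart_image.
  by apply: differentiable_transition => //; rewrite ball_overlap.
split; last first.
  move=> X Y [sX _] [sY _] i y iy.
  have dX := smooth_differentiable (sX i) iy.
  have dY := smooth_differentiable (sY i) iy.
  rewrite ball_chart_image in iy; have df := smooth_differentiable sf iy.
  by rewrite !nabla_endoE//; have [_ _ _ _] := H y iy; exact.
split=> //.
- split.
  + by move=> i; rewrite ball_chart_image.
  + move=> i j y u v; rewrite ball_overlap => Dy.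
    have [E E1] := tid i j y u Dy; have [_ E2] := tid i j y v Dy.
    by rewrite E1 E2 E.
  + by move=> i y; rewrite ball_chart_image => /H[].
  + move=> i y v; rewrite ball_chart_image => Dy.
    by have [_ pos _ _ _] := H y Dy; exact: pos.
- split; first by move=> i; rewrite ball_chart_image.
  move=> i j y v; rewrite ball_overlap => Dy.
  have [E E1] := tid i j y v Dy; have [_ E2] := tid i j y (v *m fN y) Dy.
  by rewrite E1 E2 E.
- move=> i y u v; rewrite ball_chart_image => Dy.
  by have [_ _ skew _ _] := H y Dy; exact: skew.
move=> i y v; rewrite ball_chart_image => Dy.
by have [_ _ _ neg _] := H y Dy; exact: neg.
Qed.

End BallChart.

(** * The two implications *)

Section Converse.
Context {R : realType}.

Lemma product_chart_parallel m s q (S : set 'rV[R]_m) (x : 'rV[R]_m)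
    (G : 'rV[R]_m -> 'M[R]_m) (xi : 'rV[R]_m -> 'rV[R]_m)
    (phi : 'rV[R]_m -> 'rV[R]_(s + q)) (C : set 'rV[R]_q)
    (gN : 'rV[R]_q -> 'M[R]_q) (c : 'rV[R]_s) (u : 'rV[R]_m) :
  open S -> S x -> smooth_on S G ->
  (forall y, S y -> (G y)^T = G y) ->
  (forall (y v : 'rV[R]_m), S y -> v != 0 -> 0 < inner (G y) v v) ->
  smooth_on S xi -> smooth_on S phi -> open C -> smooth_on C gN ->
  (forall y, S y -> C (rsubmx (phi y))) ->
  (forall y, S y -> 'D_(xi y) phi y = row_mx c 0) ->
  (forall (y v w : 'rV[R]_m), S y -> inner (block_mx 1%:M 0 0 (gN (rsubmx (phi y))))
     ('D_v phi y) ('D_w phi y) = inner (G y) v w) ->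
  'D_u xi x + christoffel G x u (xi x) = 0.
Proof.
move=> oS Sx sG Gsym Gpos sxi sphi oC sgN phiC Dxi iso.
have dG := smooth_differentiable sG Sx.
have dxi := smooth_differentiable sxi Sx.
have dphi y (Sy : S y) := smooth_differentiable sphi Sy.
pose J := jacobian phi.
have sJ : smooth_on S J := smooth_jacobian oS sphi.
have dJ := smooth_differentiable sJ Sx.
pose P (z : 'rV[R]_(s + q)) := block_mx (1%:M : 'M[R]_s) 0 0 (gN (rsubmx z)) : 'M[R]_(s + q).
have isoJ (y v w : 'rV[R]_m) : S y -> inner (P (phi y)) (v *m J y) (w *m J y) = inner (G y) v w.
  by move=> Sy; rewrite -(iso y v w Sy) !(deriveEjacobian _ (dphi _ Sy)).
pose z0 := phi x; have Cz0 : C (rsubmx z0) := phiC _ Sx.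
have did : differentiable (fun z : 'rV[R]_(s + q) => z) z0 by [].
have dr := differentiable_rsub did.
have dg := smooth_differentiable sgN Cz0.
have dgr := differentiable_comp dr dg.
have dblock (A : 'rV[R]_(s + q) -> 'M[R]_q) : differentiable A z0 ->
    differentiable (fun z => block_mx (1%:M : 'M[R]_s) 0 0 (A z)) z0.
  move=> dA; apply: (differentiable_mxP _ _).2 => i j.
  have dAe := (differentiable_mxP _ _).1 dA.
  rewrite -(splitK i) -(splitK j) /=.
  case: (fintype.split i) => k; case: (fintype.split j) => l /=; under eq_fun do
    rewrite ?block_mxEul ?block_mxEur ?block_mxEdl ?block_mxEdr;
    by [exact: differentiable_cst|exact: dAe].
have dP : differentiable P z0 by exact: (dblock _ dgr).
(* The product metric depends only on the coordinates of the second factor, so it is constant in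
   Euclidean directions. *)
have DP : 'D_(row_mx c 0) P z0 = 0.
  rewrite (derive_mx (diff_derivable dP)); apply/matrixP => i j; rewrite !mxE.
  have dge := (differentiable_mxP _ _).1 dgr.
  rewrite -(splitK i) -(splitK j) /=.
  case: (fintype.split i) => k; case: (fintype.split j) => l /=; under eq_fun do
    rewrite /P ?block_mxEul ?block_mxEur ?block_mxEdl ?block_mxEdr;
    rewrite ?derive_cst//.
  have := derive_mx (diff_derivable (v := row_mx c 0) dgr).
  rewrite (derive_comp _ dr dg) (derive_rsub _ did) derive_id row_mxKr derive0.
  by move=> /matrixP/(_ k l); rewrite !mxE.
have dPphi := differentiable_comp (dphi _ Sx) dP.
(* the symmetric part of [nabla xi] vanishes: [xi] is a Killing field *)
have lie (w : 'rV[R]_m) : inner ('D_(xi x) G x) u w + inner (G x) ('D_u xi x) w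
    + inner (G x) u ('D_w xi x) = 0.
  (* Obtained by differentiating [xi *m J = row_mx c 0], whose right side is constant, and by the
     symmetry of second derivatives. *)
  have DJ (v : 'rV[R]_m) : v *m 'D_(xi x) J x = - ('D_v xi x *m J x).
    rewrite (jacobian_sym oS sphi v (xi x) Sx).
    have : 'D_v (fun y => xi y *m J y) x = 0.
      rewrite -[RHS](derive_cst (row_mx c 0 : 'rV[R]_(s + q)) x v).
      apply: near_eq_derive; near=> y.
      have Sy : S y by near: y; exact: (open_near oS Sx).
      by rewrite -(Dxi _ Sy) (deriveEjacobian _ (dphi _ Sy)).
    rewrite (derive_mulmx v dxi dJ) addrC => /eqP; rewrite addr_eq0.
    by move/eqP.
  have E : 'D_(xi x) (fun y => inner (G y) u w) x =
      'D_(xi x) (fun y => inner ((P \o phi) y) (u *m J y) (w *m J y)) x.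
    apply: near_eq_derive; near=> y.
    by apply/esym/isoJ; near: y; exact: (open_near oS Sx).
  move: E; rewrite (derive_innerl _ _ (diff_derivable dG)) => ->.
  have duJ (v : 'rV[R]_m) : differentiable (fun y => v *m J y) x.
    exact: differentiable_mulmx (differentiable_cst v x) dJ.
  rewrite (derive_inner _ dPphi (duJ u) (duJ w)).
  rewrite (derive_comp _ (dphi _ Sx) dP) (Dxi _ Sx) DP.
  rewrite (derive_mulmxl u _ dJ) (derive_mulmxl w _ dJ) (DJ u) (DJ w).
  rewrite innerNl innerNr !isoJ//.
  have -> : inner 0 (u *m J x) (w *m J x) = 0 by rewrite /inner mulmx0 mul0mx mxE.
  move: (inner _ _ _) (inner _ _ _) => a b; ring.
(* and so does the antisymmetric part: the dual form of [xi] is closed *)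
have xiE (y v : 'rV[R]_m) : S y -> inner (G y) (xi y) v = (lsubmx ('D_v phi y) *m c^T) 0 0.
  move=> Sy; rewrite -(iso _ _ _ Sy) (Dxi _ Sy) /inner.
  rewrite mul_row_block !mul0mx !mulmx0 !addr0 mulmx1.
  rewrite -[X in _ *m X^T](hsubmxK ('D_v phi y)) tr_row_mx mul_row_col mul0mx addr0.
  transitivity ((lsubmx ('D_v phi y) *m c^T)^T 0 0); last by rewrite mxE.
  by rewrite trmx_mul trmxK.
have closed (w : 'rV[R]_m) : inner ('D_u G x) (xi x) w + inner (G x) ('D_u xi x) w =
    inner ('D_w G x) (xi x) u + inner (G x) ('D_w xi x) u.
  have main (v v' : 'rV[R]_m) : inner ('D_v G x) (xi x) v' + inner (G x) ('D_v xi x) v' =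
      (lsubmx ('D_v ('D_v' phi) x) *m c^T) 0 0.
    have : 'D_v (fun y => inner (G y) (xi y) v') x =
        'D_v (fun y => (lsubmx ('D_v' phi y) *m c^T) 0 0) x.
      apply: near_eq_derive; near=> y.
      by apply: xiE; near: y; exact: (open_near oS Sx).
    have dDphi : differentiable ('D_v' phi) x.
      have [d _] := Ck_derive oS (sphi 2%N) (Ck_cst 1 S v').
      exact: d.
    have dl := differentiable_lsub dDphi.
    have dlc := differentiable_mulmx dl (differentiable_cst c^T x).
    rewrite (derive_inner v dG dxi (differentiable_cst v' x)) derive_cst inner0r addr0.
    move=> ->; transitivity (('D_v (fun y => lsubmx ('D_v' phi y) *m c^T) x) 0 0).
      by rewrite (derive_mx (diff_derivable dlc)) mxE.
    by rewrite (derive_mulmxr _ v dl) (derive_lsub v dDphi).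
  by rewrite !main (derive_derive_sym u w oS Sx (sphi 3%N)).
(* By the Koszul formula, twice the inner product of [nabla_u xi] with [w] is the sum of the
   expressions that [lie] and [closed] make vanish. *)
apply: (inner_nondeg (metric_unit Gpos Sx)) => w.
rewrite innerDl inner0l (christoffel_koszul sG Gpos u (xi x) w Sx).
have := lie w; have := closed w.
have := derive_metric_sym oS sG Gsym u (xi x) w Sx.
have := inner_sym u ('D_w xi x) (Gsym _ Sx).
generalize ('D_u G x) ('D_w G x) ('D_(xi x) G x) ('D_u xi x) ('D_w xi x).
move=> A1 A2 A3 a b -> -> E1 E2; lra.
Unshelve. all: by end_near. Qed.

Lemma locally_product_parallel n s (M : charted R (2 * n + s))
    (f Q : field M 'M[R]_(2 * n + s))
    (xi : 'I_s -> field M 'rV[R]_(2 * n + s))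
    (eta : 'I_s -> field M 'cV[R]_(2 * n + s))
    (g : field M 'M[R]_(2 * n + s)) :
  weak_nearly_C_manifold f Q xi eta g ->
  locally_euclidean_times_weak_nearly_kahler f xi g ->
  forall a, parallel_field g (xi a).
Proof.
move=> [hM wf _] loc a X vX i x ix.
have [ip xE] := chart_imageP hM ix; pose p := param i x.
have [N [fN [gN [[whN _] [U [V [h [Up [oU _ [hc hs] _] iso cxi _]]]]]]]] := loc p.
have [j jp] := manifold_cover (wh_manifold whN) (h p).2.
pose j' : index (prod_charted (euclidean R s) N) := (tt, j).
have odj : open (dom j').
  have -> : dom j' = snd @^-1` dom j by apply/seteqP; split=> // ? [].
  apply: open_comp; last exact: manifold_dom_open (wh_manifold whN) j.
  by move=> ? _; exact: cvg_snd.
pose W := [set p' | U p' /\ dom j' (h p')].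
have oW : open W by exact: open_setI_preimage.
pose S := coord i @` (U `&` dom i `&` h @^-1` dom j').
have SE : S = [set y | chart_image i y /\ W (param i y)].
  apply/seteqP; split=> y /=.
    by move=> [p' [[Up' ip'] jp'] <-]; rewrite (manifold_coordK hM)//; split=> //; exists p'.
  move=> [iy [Uy jy]]; have [iq yE] := chart_imageP hM iy.
  by exists (param i y).
have oS : open S.
  rewrite SE; apply: open_setI_preimage => //.
    exact: manifold_image_open.
  by move=> y; exact: manifold_param_continuous.
have Sx : S x by rewrite SE; split=> //; split=> //; split.
have Si : S `<=` chart_image i by move=> y; rewrite SE => -[].
have hg := wf_metric wf.
have sphi := hs i j'; rewrite -/S in sphi.
have Sphi y : S y -> [/\ U (param i y), dom i (param i y),
    dom j' (h (param i y)) & coord i (param i y) = y].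
  by rewrite SE => -[iy [Uy jy]]; have [iq yE] := chart_imageP hM iy.
have dphi y : S y -> differentiable (local_rep h i j') y.
  exact: smooth_differentiable.
rewrite /nabla.
apply: (@product_chart_parallel _ s (2 * n) S x (g i) (xi a i) (local_rep h i j')
  (chart_image j) (gN j) (delta_mx 0 a)) => //.
- by move=> k; exact: Ck_sub Si (metric_smooth hg i k).
- by move=> y /Si; exact: metric_sym.
- by move=> y v /Si; exact: metric_pos.
- by have [sx _] := wf_xi_field wf a; move=> k; exact: Ck_sub Si (sx i k).
- exact: manifold_image_open (wh_manifold whN) j.
- exact: metric_smooth (wh_metric whN) j.
- move=> y /Sphi[_ _ [_ jy] _].
  by rewrite /local_rep /= row_mxKr; exists (h (param i y)).2.
- move=> y Sy; have [Uy iy jy yE] := Sphi y Sy.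
  by have := cxi a _ _ _ Uy iy jy; rewrite yE deriveE//; exact: dphi.
- move=> y v w Sy; have [Uy iy jy yE] := Sphi y Sy.
  have := iso _ _ _ v w Uy iy jy; rewrite yE.
  by rewrite !deriveE//; exact: dphi.
Qed.

End Converse.

Section BlockContinuity.
Context {R : realType} (T : topologicalType).

Lemma continuous_row_mx p q r (f : T -> 'M[R]_(p, q)) (g : T -> 'M[R]_(p, r)) x :
  {for x, continuous f} -> {for x, continuous g} ->
  {for x, continuous (fun y => row_mx (f y) (g y))}.
Proof.
move=> /continuous_mxP cf /continuous_mxP cg; apply/continuous_mxP => i j.
rewrite /prop_for -(splitK j); case: (fintype.split j) => l /=; under eq_fun do
  rewrite ?row_mxEl ?row_mxEr; [exact: cf|exact: cg].
Qed.

End BlockContinuity.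

(** * Parallel characteristic fields split the manifold locally *)

Section Splitting.
Context {R : realType}.

(** Transfers a coordinate splitting to the manifold. The derivative formula in arbitrary charts
    reduces the conditions on metric, fields and endomorphism to identities for [kap] in the single
    chart [i0], through the transformation laws. *)
Lemma product_chart_diffeo m s q (M : charted R m) (hM : is_manifold M)
    (i0 : index M) r (r0 : 0 < r) (V : set 'rV[R]_m)
    (psi : 'rV[R]_(s + q) -> 'rV[R]_m) (kap : 'rV[R]_m -> 'rV[R]_(s + q)) :
  let B := [set z : 'rV[R]_(s + q) | `|z| < r] in
  open V -> V `<=` chart_image i0 -> smooth_on B psi -> smooth_on V kap ->
  (forall z, B z -> V (psi z) /\ kap (psi z) = z) ->
  (forall x, V x -> B (kap x) /\ psi (kap x) = x) ->
  let U := [set p | dom i0 p /\ V (coord i0 p)] in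
  exists (W : set (prod_charted (euclidean R s) (ball_chart q r0)))
      (h : M -> prod_charted (euclidean R s) (ball_chart q r0)),
    diffeo U W h /\
    forall p i j, U p -> dom i p ->
      coord j (h p) = kap (coord i0 p) /\
      forall u, 'd (local_rep h i j) (coord i p) u =
        'D_('D_u (transition i i0) (coord i p)) kap (coord i0 p).
Proof.
move=> B oV Vi spsi skap psiV kapV U.
pose N := prod_charted (euclidean R s) (ball_chart q r0).
pose h (p : M) : N := (lsubmx (kap (coord i0 p)) : euclidean R s,
  ball_param r0 (rsubmx (kap (coord i0 p))) : ball_chart q r0).
pose W : set N := [set z | B (row_mx (z.1 : 'rV[R]_s) (ball_val z.2))].
pose k (z : N) : M := param i0 (psi (row_mx (z.1 : 'rV[R]_s) (ball_val z.2))).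
have oB : open B.
  have -> : B = [set y : 'rV[R]_(s + q) | `|y - 0| < r].
    by apply/seteqP; split=> y /=; rewrite subr0.
  exact: open_norm_lt.
have oU : open U.
  apply: (open_setI_preimage (manifold_dom_open hM i0) _ oV).
  by move=> p; exact: manifold_coord_continuous.
have cval (z : N) : {for z, continuous
    (fun z : N => row_mx (z.1 : 'rV[R]_s) (ball_val z.2))}.
  apply: continuous_row_mx; first exact: cvg_fst.
  apply: (@continuous_comp _ _ _ snd
    (@ball_val R q r : ball_space q r -> 'rV[R]_q)); first exact: cvg_snd.
  exact: ball_val_continuous.
have oW : open W.
  by apply: open_comp oB => z _; exact: cval.
have Dr z : B z -> `|rsubmx z| < r by move=> /norm_lsub_rsub_lt[].
have hcoord p j : U p -> coord j (h p) = kap (coord i0 p).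
  move=> [ip /kapV[/Dr Dk _]].
  by rewrite /= ball_paramK// hsubmxK.
have ckap p : U p -> {for p, continuous (kap \o coord i0)}.
  move=> [ip Vp]; apply: continuous_comp.
    exact: manifold_coord_continuous.
  exact: Ck_continuous (skap 0%N) Vp.
have ch p : U p -> {for p, continuous h}.
  move=> Up; have [ip /kapV[/Dr Dk _]] := Up.
  have c1 : {for p, continuous (fun p => lsubmx (kap (coord i0 p)))}.
    by apply: continuous_comp; [exact: ckap|exact: lsubmx_continuous].
  have c2 : {for p, continuous ((ball_param r0 : 'rV[R]_q -> ball_space q r) \o
      (fun p => rsubmx (kap (coord i0 p))))}.
    apply: continuous_comp; last exact: ball_param_continuous.
    by apply: continuous_comp; [exact: ckap|exact: rsubmx_continuous].
  exact: (cvg_pair c1 c2).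
have setE i j : coord i @` (U `&` dom i `&` h @^-1` dom j) =
    [set x | overlap i i0 x /\ V (transition i i0 x)].
  apply/seteqP; split=> x /=.
    move=> [p [[[i0p Vp] ip] _] <-]; rewrite /transition /= (manifold_coordK hM)//.
    by split=> //; exists p.
  move=> [[p [ip i0p] <-]]; rewrite /transition /= (manifold_coordK hM)// => Vp.
  by exists p.
have oS i : open [set x | overlap i i0 x /\ V (transition i i0 x)].
  apply: (open_setI_preimage (@open_overlap _ _ _ hM i i0) _ oV).
  move=> x ox; exact: Ck_continuous (@manifold_transition_smooth _ _ _ hM i i0 0%N) ox.
have repE i j x : overlap i i0 x /\ V (transition i i0 x) ->
    local_rep h i j x = (kap \o transition i i0) x.
  move=> [ox Vx]; apply: hcoord; split=> //.
  by move: ox; rewrite (overlapE hM) => -[].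
exists W, h; split.
  split=> //.
    split=> [p|i j]; first exact: ch.
    rewrite setE => l; apply: (@Ck_ext _ _ _ _ _ _ (kap \o transition i i0)) => //.
      exact: repE.
    apply: (@Ck_comp _ _ _ _ _ _ _ V) => //; first by move=> x [].
    apply: (@Ck_sub _ _ _ _ (overlap i i0)); first by move=> x [].
    exact: manifold_transition_smooth.
  exists k; split.
  - split=> [z Wz|j i].
      apply: (@continuous_comp _ _ _
        (fun z : N => psi (row_mx (z.1 : 'rV[R]_s) (ball_val z.2))) (param i0)).
        apply: (@continuous_comp _ _ _ (fun z : N => row_mx (z.1 : 'rV[R]_s) (ball_val z.2)) psi).
          exact: cval.
        exact: Ck_continuous (spsi 0%N) Wz.
      by apply: manifold_param_continuous => //; apply: Vi; have [] := psiV _ Wz.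
    have kE z : B z -> k (param j z) = param i0 (psi z).
      by move=> /Dr Dz; rewrite /k /= ball_paramK// hsubmxK.
    have -> : coord j @` (W `&` dom j `&` k @^-1` dom i) =
        [set z | B z /\ overlap i0 i (psi z)].
      apply/seteqP; split=> z /=.
        move=> [w [[Ww _] kw] <-]; split=> //; rewrite (overlapE hM); split=> //.
        by apply: Vi; have [] := psiV _ Ww.
      move=> [Bz]; rewrite (overlapE hM) => -[_ iz].
      exists (param j z : N).
        split; last by rewrite -[k _]/(k (param j z)) kE.
        by split=> //; rewrite /W /= ball_paramK ?hsubmxK//; exact: Dr.
      by rewrite /= ball_paramK ?hsubmxK//; exact: Dr.
    have oA : open [set z | B z /\ overlap i0 i (psi z)].
      apply: (open_setI_preimage oB _ (@open_overlap _ _ _ hM i0 i)).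
      by move=> z; exact: Ck_continuous (spsi 0%N).
    move=> l; apply: (@Ck_ext _ _ _ _ _ _ (transition i0 i \o psi)) => //.
      by move=> z [Bz _]; rewrite /local_rep /transition /= -kE.
    apply: (@Ck_comp _ _ _ _ _ _ _ (overlap i0 i)) => //.
    + exact: open_overlap.
    + by move=> z [].
    + by apply: (@Ck_sub _ _ _ _ B) => // z [].
    + exact: manifold_transition_smooth.
  - move=> p Up; have [ip /kapV[Bp kp]] := Up.
    have E : row_mx ((h p).1 : 'rV[R]_s) (ball_val (h p).2) = kap (coord i0 p).
      exact: (hcoord p (tt, tt) Up).
    by rewrite /W /k /= E kp (manifold_coordK hM).
  - move=> z Wz; have [Vz kz] := psiV _ Wz; have [iz cz] := chart_imageP hM (Vi _ Vz).
    split; first by split; rewrite ?cz.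
    rewrite /h /k cz kz row_mxKl row_mxKr ball_valK.
    by case: (z).
move=> p i j Up ip; split=> [|u]; first exact: hcoord.
have [i0p Vp] := Up.
have ox : overlap i i0 (coord i p) by exists p.
have tE : transition i i0 (coord i p) = coord i0 p.
  by rewrite /transition /= (manifold_coordK hM).
have Vt : V (transition i i0 (coord i p)) by rewrite tE.
have dt := differentiable_transition hM ox.
have dk := smooth_differentiable skap Vt.
have nE : {near coord i p, kap \o transition i i0 =1 local_rep h i j}.
  near=> y; apply/esym/repE; near: y.
  exact: (open_near (oS i) (conj ox Vt)).
have dc := differentiable_comp dt dk.
rewrite -(near_eq_diff nE dc) -(deriveE _ dc).
rewrite (@derive_comp _ _ _ _ (transition i i0) kap _ u dt dk).
by rewrite tE.
Unshelve. all: by end_near. Qed.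

Lemma parallel_locally_product n s (M : charted R (2 * n + s))
    (f Q : field M 'M[R]_(2 * n + s))
    (xi : 'I_s -> field M 'rV[R]_(2 * n + s))
    (eta : 'I_s -> field M 'cV[R]_(2 * n + s))
    (g : field M 'M[R]_(2 * n + s)) :
  weak_nearly_C_manifold f Q xi eta g -> (forall a, parallel_field g (xi a)) ->
  locally_euclidean_times_weak_nearly_kahler f xi g.
Proof.
move=> [hM wf nf] pxi p; have [i0 i0p] := manifold_cover hM p.
have hg := wf_metric wf; have hf := wf_f_endo wf.
pose O := chart_image i0; have oO : open O by exact: manifold_image_open.
have Op : O (coord i0 p) by exists p.
pose Xi y : 'M[R]_(s, 2 * n + s) := \matrix_a xi a i0 y.
have sXi : smooth_on O Xi.
  move=> k; apply/Ck_mxP => // a l; apply: (@Ck_ext _ _ _ _ _ _ (fun y => xi a i0 y 0 l)) => //.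
    by move=> y _; rewrite mxE.
  by have [/(_ i0 k)/(Ck_mxP _ _ oO)] := wf_xi_field wf a; exact.
have innerXi x (v : 'rV[R]_(2 * n + s)) a : (v *m coframe (g i0) Xi x) 0 a =
    inner (g i0 x) v (xi a i0 x).
  by rewrite /coframe /inner mulmxA !mxE; apply: eq_bigr => l _; rewrite !mxE.
have XiF x : O x -> Xi x *m f i0 x = 0.
  move=> Ox; apply/row_matrixP => a; rewrite row_mul rowK row0.
  exact: (xi_f wf Ox).
have XiE x : O x -> Xi x *m coframe (g i0) Xi x = 1%:M.
  move=> Ox; apply/matrixP => a b; rewrite [RHS]mxE.
  rewrite -(wf_xi_orthonormal wf a b Ox) -innerXi -(rowK (fun a => xi a i0 x) a).
  by rewrite -row_mul [RHS]mxE.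
have Finj x (v : 'rV[R]_(2 * n + s)) : O x ->
    v *m coframe (g i0) Xi x = 0 -> v *m f i0 x = 0 -> v = 0.
  move=> Ox vE; apply: (f_injective wf Ox) => a.
  by rewrite -innerXi vE mxE.
have [r [V [psi [kap [gN [fN
    [[r0 oV VO Vp] [spsi skap] [psiV kapV] loc [[sgN sfN] HN]]]]]]]] :=
  @local_product R (2 * n + s) s (2 * n) O (coord i0 p) (g i0) (f i0) Xi
   (addnC _ _) oO Op (metric_smooth hg i0) (@metric_sym _ _ _ _ hg i0)
   (@metric_pos _ _ _ _ hg i0) sXi
   (fun x u c Ox => frame_parallel hM hg u c (wf_xi_field wf) pxi Ox)
   (proj1 hf i0) XiF
   (fun x u v Ox => nearly_parallel_pointwise hM u v hf nf Ox) XiE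
   (fun x u v Ox => wf_f_skew wf u v Ox) Finj.
set B := [set z | _] in spsi psiV kapV.
exists (ball_chart (2 * n) r0), (fun=> fN), (fun=> gN); split.
  apply: ball_weak_nearly_kahler => //; by rewrite oddM.
have [W [h [dif hE]]] := product_chart_diffeo hM r0 oV VO spsi skap psiV kapV.
exists [set p | dom i0 p /\ V (coord i0 p)], W, h; split=> //.
- move=> p' i j u v Up ip _; have [-> Dh] := hE p' i j Up ip.
  have [i0p' Vp'] := Up; have [iso _ _] := loc _ Vp'.
  have ox : overlap i i0 (coord i p') by exists p'.
  have tE : transition i i0 (coord i p') = coord i0 p'.
    by rewrite /transition /= (manifold_coordK hM).
  have dt := differentiable_transition hM ox.
  rewrite -(metric_compatible hg u v ox) tE -!(deriveE _ dt) !Dh; exact: iso.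
- move=> a p' i j Up ip _; have [-> Dh] := hE p' i j Up ip.
  have [i0p' Vp'] := Up; have [_ xiE _] := loc _ Vp'.
  have ox : overlap i i0 (coord i p') by exists p'.
  have tE : transition i i0 (coord i p') = coord i0 p'.
    by rewrite /transition /= (manifold_coordK hM).
  rewrite Dh (deriveE _ (differentiable_transition hM ox)).
  have [_ /(_ i i0 _ ox) <-] := wf_xi_field wf a.
  by rewrite tE -(rowK (fun a => xi a i0 (coord i0 p')) a) rowE xiE.
- move=> p' i j u Up ip _; have [-> Dh] := hE p' i j Up ip.
  have [i0p' Vp'] := Up; have [_ _ fE] := loc _ Vp'.
  have ox : overlap i i0 (coord i p') by exists p'.
  have tE : transition i i0 (coord i p') = coord i0 p'.
    by rewrite /transition /= (manifold_coordK hM).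
  have dt := differentiable_transition hM ox.
  rewrite !Dh (deriveE _ dt) -(proj2 hf i i0 _ u ox) tE -(deriveE _ dt).
  exact: fE.
Qed.

End Splitting.

Theorem theorem2 (R : realType) (n s : nat) (hn : (0 < n)%N) (hs : (0 < s)%N)
    (M : charted R (2 * n + s))
    (f Q : field M 'M[R]_(2 * n + s))
    (xi : 'I_s -> field M 'rV[R]_(2 * n + s))
    (eta : 'I_s -> field M 'cV[R]_(2 * n + s))
    (g : field M 'M[R]_(2 * n + s))
    (hM : weak_nearly_C_manifold f Q xi eta g) :
  (forall a : 'I_s, parallel_field g (xi a)) <->
  locally_euclidean_times_weak_nearly_kahler f xi g.
Proof.
split; [exact: parallel_locally_product hM|exact: locally_product_parallel hM].
Qed.
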